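(* Let $\Omega\subset\mathbb{R}^d$ be a bounded domain and let $\Phi:\Omega\times[0,\infty)\to\mathbb{R}$ be a (possibly discontinuous in $x$) generalized $\Phi$-function satisfying the normalization condition with constant $\beta\in(0,1]$. If $\Phi$ satisfies the jump condition with constant $\delta>0$, then there is a constant $c(\Omega,d,\delta,p_\Phi^+,p_\Phi^-,\beta)$ such that for all $u\in W_0^{1,\Phi(\cdot)}(\Omega)$, $$\|u\|_{L^{\Phi(\cdot)}}\le c(\Omega,d,\delta,p_\Phi^+,p_\Phi^-,\beta)\,\|\nabla u\|_{L^{\Phi(\cdot)}}.$$
   Context: Generalized $\Phi$-function (here without continuity in $x$): $\Phi(x,s)=\int_0^s\varphi(x,t)\,dt$, where $\varphi$ is measurable in $x$, $\varphi(x,\cdot)\in C([0,\infty))\cap C^1((0,\infty))$, $\varphi(x,s)>0$ for $s>0$, and there are constants $p^-,p^+$ with $0<p^--1\le\frac{s\,\partial_s\varphi(x,s)}{\varphi(x,s)}\le p^+-1$ for all $x\in\Omega$, $s>0$. Normalization condition with constant $\beta$: $\beta\le\Phi^{-1}(x,1)\le\beta^{-1}$ for a.e. $x\in\Omega$, where $\Phi^{-1}(x,\cdot)$ is the inverse of $\Phi(x,\cdot)$ (equivalently $\Phi(x,\beta)\le1\le\Phi(x,\beta^{-1})$). For a set $A$ put $p^-_{\Phi,A}=\inf_{y\in A\cap\Omega,\,s>0}\frac{s\varphi(y,s)}{\Phi(y,s)}$, $p^+_{\Phi,A}=\sup_{y\in A\cap\Omega,\,s>0}\frac{s\varphi(y,s)}{\Phi(y,s)}$,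 and $p^\pm_\Phi=p^\pm_{\Phi,\Omega}$. For $0<p<d$ let $p^*=\frac{dp}{d-p}$. Jump condition with constant $\delta>0$: for each $x\in\Omega$, either $p^-_{\Phi,B_\delta(x)}\ge d$, or $p^-_{\Phi,B_\delta(x)}<d$ and $p^+_{\Phi,B_\delta(x)}\le\big(p^-_{\Phi,B_\delta(x)}\big)^*$, where $B_\delta(x)$ is the ball of radius $\delta$ about $x$. $\varrho_{\Phi(\cdot)}(u)=\int_\Omega\Phi(x,|u|)\,dx$; $L^{\Phi(\cdot)}(\Omega)=\{u\in L^1(\Omega):\lim_{\lambda\to0}\varrho_{\Phi(\cdot)}(\lambda u)=0\}$ with norm $\|u\|_{L^{\Phi(\cdot)}}=\inf\{\lambda>0:\varrho_{\Phi(\cdot)}(u/\lambda)\le1\}$; $W^{1,\Phi(\cdot)}(\Omega)$ is the set of $u\in L^{\Phi(\cdot)}(\Omega)$ with weak partial derivatives in $L^{\Phi(\cdot)}(\Omega)$, normed by $\inf\{\lambda>0:\varrho_{\Phi(\cdot)}(u/\lambda)+\sum_k\varrho_{\Phi(\cdot)}(\partial_ku/\lambda)\le1\}$, and $W^{1,\Phi(\cdot)}_0(\Omega)$ is the closure of $C_0^\infty(\Omega)$ in it. *)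

(* Defs.v *)
From HB Require Import structures.
From mathcomp Require Import all_boot all_order all_algebra.
From mathcomp Require Import all_classical all_reals all_analysis.

Set Implicit Arguments.
Unset Strict Implicit.
Unset Printing Implicit Defensive.

Import Order.TTheory GRing.Theory Num.Theory.
Import numFieldNormedType.Exports.

Local Open Scope classical_set_scope.
Local Open Scope ring_scope.

(* The library has Lebesgue measure on R only.  Lebesgue measure on
   R^n = 'rV[R]_n is the completion of the n-fold product of lebesgue_measure,
   the latter being a measure on the product (i.e. Borel) sigma-algebra. *)

Definition rV_display : measure_display.
Proof. exact. Qed.

Section measurable_rV.
Context {R : realType} (n : nat).

Let coord (i : 'I_n) (x : 'rV[R]_n) : measurableTypeR R := x ord0 i.

Let rV_set0 : g_sigma_preimage coord set0.
Proof. exact: sigma_algebra0. Qed.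

Let rV_setC A : g_sigma_preimage coord A -> g_sigma_preimage coord (~` A).
Proof. exact: sigma_algebraC. Qed.

Let rV_bigcup (F : (set 'rV[R]_n)^nat) :
  (forall i, g_sigma_preimage coord (F i)) ->
  g_sigma_preimage coord (\bigcup_i (F i)).
Proof. exact: sigma_algebra_bigcup. Qed.

HB.instance Definition _ := @isMeasurable.Build rV_display
  'rV[R]_n (g_sigma_preimage coord) rV_set0 rV_setC rV_bigcup.

Lemma measurable_coord (i : 'I_n) :
  measurable_fun [set: 'rV[R]_n] (fun x => x ord0 i : measurableTypeR R).
Proof.
move=> _ Y mY; rewrite setTI; apply: sub_sigma_algebra => /=.
rewrite -bigcup_seq/=; exists i => /=; first by rewrite mem_index_enum.
by exists Y => //; rewrite setTI.
Qed.

Lemma measurable_fun_coordP d (T : measurableType d) (f : T -> 'rV[R]_n) :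
  (forall i, measurable_fun [set: T] (fun x => f x ord0 i : measurableTypeR R))
  -> measurable_fun [set: T] f.
Proof.
move=> mf; have : g_sigma_preimage (fun i => coord i \o f) `<=` measurable.
  apply: smallest_sub; first exact: sigma_algebra_measurable.
  move=> A; rewrite -bigcup_seq/= => -[i _ [B mB <-]].
  exact: mf.
rewrite g_sigma_preimage_comp => h _ A mA.
by apply: h; exists A.
Qed.

End measurable_rV.

Definition cons_rV {R : realType} n (p : measurableTypeR R * 'rV[R]_n) :
  'rV[R]_n.+1 := row_mx (p.1 : R)%:M p.2.

Lemma cons_rVE {R : realType} n (p : measurableTypeR R * 'rV[R]_n)
    (i : 'I_n.+1) :
  cons_rV p ord0 i = oapp (fun j => p.2 ord0 j) p.1 (unlift ord0 i).
Proof.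
case: unliftP => [j|] ->.
  have -> : lift ord0 j = @rshift 1 n j by apply/val_inj.
  by rewrite /cons_rV (row_mxEr (p.1 : R)%:M).
have -> : (ord0 : 'I_n.+1) = @lshift 1 n ord0 by apply/val_inj.
by rewrite /cons_rV (row_mxEl (p.1 : R)%:M) mxE.
Qed.

Lemma measurable_cons_rV {R : realType} n :
  measurable_fun setT (@cons_rV R n).
Proof.
apply: measurable_fun_coordP => i.
under eq_fun do rewrite cons_rVE.
case: (unlift ord0 i) => [j|] /=; last exact: measurable_fst.
exact: (measurableT_comp (measurable_coord j) measurable_snd).
Qed.

Section lebesgue_rV_succ.
Local Open Scope ereal_scope.
Context {R : realType} (n : nat).
Variable mu : {sigma_finite_measure set 'rV[R]_n -> \bar R}.

Definition lebesgue_rV_succ : set 'rV[R]_n.+1 -> \bar R :=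
  pushforward (lebesgue_measure \x mu) (@cons_rV R n).

Let mpreimage (A : set 'rV[R]_n.+1) :
  measurable A -> measurable (@cons_rV R n @^-1` A).
Proof.
by move=> mA; rewrite -[X in measurable X]setTI; exact: measurable_cons_rV.
Qed.

Let succ0 : lebesgue_rV_succ set0 = 0.
Proof. by rewrite /lebesgue_rV_succ /pushforward preimage_set0 measure0. Qed.

Let succ_ge0 A : 0 <= lebesgue_rV_succ A.
Proof. by rewrite /lebesgue_rV_succ /pushforward measure_ge0. Qed.

Let succ_sigma_additive : semi_sigma_additive lebesgue_rV_succ.
Proof.
move=> F mF tF mUF; rewrite /lebesgue_rV_succ /pushforward preimage_bigcup.
apply: measure_semi_sigma_additive.
- by move=> k; exact: mpreimage.
- apply/trivIsetP => /= i j _ _ ij; rewrite -preimage_setI.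
  by move/trivIsetP : tF => /(_ _ _ _ _ ij) ->//; rewrite preimage_set0.
- by rewrite -preimage_bigcup; exact: mpreimage.
Qed.

HB.instance Definition _ := isMeasure.Build _ _ _ lebesgue_rV_succ
  succ0 succ_ge0 succ_sigma_additive.

Let uncons (x : 'rV[R]_n.+1) : measurableTypeR R * 'rV[R]_n :=
  (x ord0 ord0, \row_j x ord0 (lift ord0 j)).

Let consK : cancel (@cons_rV R n) uncons.
Proof.
move=> [x y]; rewrite /uncons cons_rVE unlift_none/=; congr (_, _).
by apply/rowP => j; rewrite mxE cons_rVE liftK.
Qed.

Let unconsK : cancel uncons (@cons_rV R n).
Proof.
by move=> x; apply/rowP => i; rewrite cons_rVE; case: unliftP => [j|] ->//=;
  rewrite mxE.
Qed.

Let measurable_uncons : measurable_fun setT uncons.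
Proof.
apply: measurable_fun_pair; first exact: measurable_coord.
apply: measurable_fun_coordP => j; under eq_fun do rewrite mxE.
exact: measurable_coord.
Qed.

Let succ_sigma_finite : sigma_finite setT lebesgue_rV_succ.
Proof.
have [F FT mF] : sigma_finite setT (lebesgue_measure \x mu).
  have /sigma_finiteP[F [TF ndF Foo]] := sigma_finiteT (@lebesgue_measure R).
  have /sigma_finiteP[G [TG ndG Goo]] := sigma_finiteT mu.
  exists (fun k => F k `*` G k).
    rewrite -setXTT TF TG predeqE => -[x y]; split; last first.
      by move=> [k _ []/= ? ?]; split; exists k.
    move=> [/= [k _ Fkx] [l _ Gly]]; exists (maxn k l) => //; split.
    - by move: x Fkx; exact/subsetPset/ndF/leq_maxl.
    - by move: y Gly; exact/subsetPset/ndG/leq_maxr.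
  move=> k; have [? ?] := Foo k; have [? ?] := Goo k.
  split; first exact: measurableX.
  by rewrite product_measure1E// lte_mul_pinfty// ge0_fin_numE.
exists (fun k => uncons @^-1` F k); first by rewrite -preimage_bigcup -FT.
move=> k; have [mFk Fkoo] := mF k; split.
  by rewrite -[X in measurable X]setTI; exact: measurable_uncons.
rewrite /lebesgue_rV_succ /pushforward -comp_preimage.
by rewrite (_ : uncons \o _ = id)//; apply/funext => p /=; rewrite consK.
Qed.

HB.instance Definition _ := Measure_isSigmaFinite.Build _ _ _ lebesgue_rV_succ
  succ_sigma_finite.

End lebesgue_rV_succ.

Fixpoint product_lebesgue {R : realType} (n : nat) :
    {sigma_finite_measure set 'rV[R]_n -> \bar R} :=
  if n is m.+1 then lebesgue_rV_succ (product_lebesgue m)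
  else \d_(0 : 'rV[R]_0).

(* R^n with the Lebesgue sigma-algebra; convertible to 'rV[R]_n. *)
Definition lebesgueRn (R : realType) (n : nat) :=
  caratheodory_type (mu_ext (@product_lebesgue R n)).
HB.instance Definition _ (R : realType) (n : nat) :=
  Measurable.on (lebesgueRn R n).

Definition leb {R : realType} {n : nat} : set (lebesgueRn R n) -> \bar R :=
  @completed_measure_extension _ _ _ (@product_lebesgue R n).
HB.instance Definition _ (R : realType) (n : nat) := Measure.on (@leb R n).

Section sobolev_orlicz.
Context {R : realType} {d : nat}.
Notation Rd := 'rV[R]_d.
Implicit Types (Omega A : set Rd) (phi : Rd -> R -> R) (u v psi : Rd -> R).

Definition enorm (x : Rd) : R := Num.sqrt (\sum_(i < d) x ord0 i ^+ 2).

Definition eball (x : Rd) (r : R) : set Rd := [set y | enorm (y - x) < r].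

Definition dpartial (k : 'I_d) (u : Rd -> R) : Rd -> R :=
  'D_(delta_mx ord0 k : Rd) u.

Definition smooth (u : Rd -> R) : Prop :=
  forall s : seq 'I_d, let v := foldr dpartial u s in
    continuous v /\
    forall (k : 'I_d) (x : Rd), derivable v x (delta_mx ord0 k : Rd).

(* Elements of C_0^oo(Omega), extended by zero to R^d. *)
Definition test_fun Omega (psi : Rd -> R) : Prop :=
  let supp := closure [set x | psi x != 0] in
  [/\ smooth psi, compact supp & supp `<=` Omega].

Definition Phi_of phi (x : Rd) (s : R) : R :=
  (\int[lebesgue_measure]_(t in `[0%R, s]) phi x t)%R.

(* phi x s is only constrained for x in Omega and s >= 0. *)
Definition gen_Phi_function Omega phi : Prop :=
  [/\ forall s : R, 0 <= s ->
        measurable_fun (Omega : set (lebesgueRn R d)) (phi ^~ s),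
      forall x, Omega x -> {within `[0, +oo[, continuous (phi x)},
      forall x s, Omega x -> 0 < s ->
        derivable (phi x) s 1 /\ {for s, continuous (derive1 (phi x))},
      forall x s, Omega x -> 0 < s -> 0 < phi x s &
      exists pm pp : R, 0 < pm - 1 /\
        forall x s, Omega x -> 0 < s ->
          pm - 1 <= s * derive1 (phi x) s / phi x s <= pp - 1].

(* The unique solution s >= 0 of Phi(x, s) = t. *)
Definition Phi_inv phi (x : Rd) (t : R) : R :=
  xget 0 [set s | 0 <= s /\ Phi_of phi x s = t].

Definition normalized Omega phi (beta : R) : Prop :=
  {ae (@leb R d), forall x, Omega x -> beta <= Phi_inv phi x 1 <= beta^-1}.

(* For a generalized Phi-function and A meeting Omega the set below is nonempty
   and bounded, so that its inf and sup in R are the mathematical ones. *)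
Definition growth_quotients Omega phi A : set R :=
  [set s * phi y s / Phi_of phi y s | y in A `&` Omega & s in [set s | 0 < s]].

Definition p_minus Omega phi A : R := inf (growth_quotients Omega phi A).
Definition p_plus Omega phi A : R := sup (growth_quotients Omega phi A).

Definition sobolev_conj (p : R) : R := d%:R * p / (d%:R - p).

Definition jump_condition Omega phi (delta : R) : Prop :=
  forall x, Omega x ->
    let pm := p_minus Omega phi (eball x delta) in
    let pp := p_plus Omega phi (eball x delta) in
    d%:R <= pm \/ (pm < d%:R /\ pp <= sobolev_conj pm).

Definition modular Omega phi u : \bar R :=
  (\int[leb]_(x in (Omega : set (lebesgueRn R d)))
     (Phi_of phi x `|u x|)%:E)%E.

Definition L1 (A : set Rd) (u : Rd -> R) : Prop :=
  leb.-integrable (A : set (lebesgueRn R d)) (EFin \o u).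

Definition L1loc Omega (u : Rd -> R) : Prop :=
  forall K, compact K -> K `<=` Omega -> L1 K u.

(* Functions are everywhere-defined representatives; values outside Omega and
   on null sets are irrelevant. *)
Definition LPhi Omega phi u : Prop :=
  L1 Omega u /\
  modular Omega phi (fun x => l * u x) @[l --> (0 : R)^'] --> (0 : \bar R)%E.

Definition LPhi_norm Omega phi u : \bar R :=
  ereal_inf [set l%:E | l in
    [set l : R | 0 < l /\ (modular Omega phi (fun x => u x / l)%R <= 1)%E]].

Definition is_weak_partial Omega (k : 'I_d) u v : Prop :=
  [/\ L1loc Omega u, L1loc Omega v &
    forall psi, test_fun Omega psi ->
      (\int[leb]_(x in (Omega : set (lebesgueRn R d))) (u x * dpartial k psi x)
       = - \int[leb]_(x in (Omega : set (lebesgueRn R d))) (v x * psi x))%R].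

(* A representative of the weak derivative; it is unique up to a null set. *)
Definition weak_partial Omega (k : 'I_d) u : Rd -> R :=
  xget (fun=> 0) [set v | is_weak_partial Omega k u v].

Definition weak_grad Omega u (x : Rd) : Rd :=
  \row_(k < d) weak_partial Omega k u x.

Definition W1Phi Omega phi u : Prop :=
  LPhi Omega phi u /\
  forall k, exists2 v, is_weak_partial Omega k u v & LPhi Omega phi v.

Definition W1Phi_norm Omega phi u : \bar R :=
  ereal_inf [set l%:E | l in [set l : R | 0 < l /\
    (modular Omega phi (fun x => u x / l)%R +
     \sum_(k < d) modular Omega phi (fun x => weak_partial Omega k u x / l)%R
       <= 1)%E]].

Definition W01Phi Omega phi u : Prop :=
  W1Phi Omega phi u /\
  forall eps : R, 0 < eps -> exists psi,
    [/\ test_fun Omega psi, W1Phi Omega phi psi &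
        (W1Phi_norm Omega phi (fun x => u x - psi x)%R < eps%:E)%E].

End sobolev_orlicz.

(* Main.v *)
Require Import Defs.
From HB Require Import structures.
From mathcomp Require Import all_boot all_order all_algebra.
From mathcomp Require Import all_classical all_reals all_analysis.
From mathcomp Require Import measurable_realfun.
From mathcomp Require Import ring lra.

Set Implicit Arguments.
Unset Strict Implicit.
Unset Printing Implicit Defensive.

Import Order.TTheory GRing.Theory Num.Theory.
Import numFieldNormedType.Exports.

Local Open Scope classical_set_scope.
Local Open Scope ring_scope.

(** The inequality is proved first for test functions, where it takes the form
    of an integrable majorant of Phi(x, |psi x|), and then passed to the limit.

    A Sobolev inequality with variable growth usually asks for regularity in x.
    Here it is replaced by finitely many constant-exponent inequalities.  On a
    set where p^- and p^+ are the extremal growth exponents, the normalization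
    gives (beta t)^q <= 1 + Phi(x, t) for q <= p^- and
    Phi(x, t) <= 1 + (t / beta)^r for r >= p^+ ([Phi_lower], [Phi_upper]).  The
    jump condition says that on a ball of radius delta some r >= p^+ is the
    Sobolev conjugate of some q <= p^- with 1 <= q <= d
    ([conjugate_exponent]).  So a bound on the modular of the gradient controls
    its q-th power on the ball, the Sobolev inequality controls the r-th power
    of psi times a cutoff, and this controls Phi(x, |psi x|) on a smaller ball.
    Finitely many such balls, a number depending on Omega and delta only, cover
    Omega.

    The local Sobolev inequality ([local_estimate]) has to absorb the derivative
    of the cutoff eta without any relation between the exponents on neighbouring
    balls.  The Gagliardo-Nirenberg inequality is applied to
    |eta^d psi|^(r (d - 1) / d); in the term with the derivative of eta, psi is
    interpolated between the L^r norm of eta^d psi and the L^1 norm of psi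
    ([cutoff_interp]).  Both terms on the right then contain the unknown
    integral of |eta^d psi|^r to a power smaller than the left-hand side does,
    and are absorbed ([absorb]).  The L^1 norm of psi is bounded by that of its
    gradient ([poincare_L1]), hence by the modular, as p^- > 1.  In dimension
    one, psi is bounded pointwise by the L^1 norm of its derivative.

    The bound on the gradient of a test function is recorded as: almost
    everywhere, the sum of the |d_k psi| is at most one of finitely many
    functions of modular at most 1 ([dominated_gradient]).  If psi approximates
    u, then d_k psi = d_k u - d_k (u - psi) almost everywhere by uniqueness of
    weak derivatives ([dpartial_weak_partial], from [fundamental_lemma]), so
    |grad u| and the |d_k (u - psi)|, suitably scaled, are such functions
    ([approx_dominated]).  Finally Phi(x, |u|) is bounded by the majorant for
    psi plus Phi(x, |u - psi|), and Phi(x, t / c) <= Phi(x, t) / c for c >= 1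
    turns a bound M + 1 on the modular into the bound 1 ([poincare_modular]).

    Integrals of Phi(x, |u x|) are compared through their definition as suprema
    over simple functions, so that only the majorants have to be measurable. *)

(** * Integrals over coordinate lines *)

Section iterated_integrals.
Context {R : realType}.
Local Open Scope ereal_scope.

Definition upd n (x : 'rV[R]_n) (i : 'I_n) (t : R) : 'rV[R]_n :=
  \row_j (if j == i then t else x ord0 j).

Lemma upd_cons0 n (t s : R) (y : 'rV[R]_n) :
  upd (cons_rV (t, y)) ord0 s = cons_rV (s, y).
Proof.
apply/rowP => i; rewrite mxE !cons_rVE.
by case: unliftP => [j ->|->]/=; rewrite ?eqxx.
Qed.

Lemma upd_consS n (t s : R) (y : 'rV[R]_n) (i : 'I_n) :
  upd (cons_rV (t, y)) (lift ord0 i) s = cons_rV (t, upd y i s).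
Proof.
apply/rowP => j; rewrite mxE !cons_rVE.
case: unliftP => [k ->|->]/=; last by [].
by rewrite mxE (inj_eq lift_inj).
Qed.

Lemma measurable_upd n (i : 'I_n) :
  measurable_fun setT (fun p : 'rV[R]_n * measurableTypeR R => upd p.1 i p.2).
Proof.
apply: measurable_fun_coordP => j; under eq_fun do rewrite mxE.
case: (j == i); first exact: measurable_snd.
exact: (measurableT_comp (measurable_coord j) measurable_fst).
Qed.

Lemma tonelli_cons n (F : 'rV[R]_n.+1 -> \bar R) :
  measurable_fun setT F -> (forall x, 0 <= F x) ->
  \int[product_lebesgue n.+1]_x F x =
  \int[lebesgue_measure]_t \int[product_lebesgue n]_y F (cons_rV (t, y)).
Proof.
move=> mF F0.
have := ge0_integral_pushforward (@measurable_cons_rV R n)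
  (lebesgue_measure \x product_lebesgue n) measurableT mF (fun x _ => F0 x).
rewrite preimage_setT (fubini_tonelli1 (F \o @cons_rV R n))//=.
exact: measurableT_comp mF (@measurable_cons_rV R n).
Qed.

Lemma measurable_cons_r n (t : R) :
  measurable_fun setT (fun y : 'rV[R]_n => cons_rV (t, y)).
Proof.
exact: measurableT_comp (@measurable_cons_rV R n) (pair1_measurable t).
Qed.

Lemma measurable_cons_l n (y : 'rV[R]_n) :
  measurable_fun setT (fun t : measurableTypeR R => cons_rV (t, y)).
Proof.
exact: measurableT_comp (@measurable_cons_rV R n) (pair2_measurable y).
Qed.

Lemma tonelli_cons_swap n (F : 'rV[R]_n.+1 -> \bar R) :
  measurable_fun setT F -> (forall x, 0 <= F x) ->
  \int[product_lebesgue n.+1]_x F x =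
  \int[product_lebesgue n]_y \int[lebesgue_measure]_t F (cons_rV (t, y)).
Proof.
move=> mF F0; rewrite tonelli_cons//.
apply: (fubini_tonelli (F \o @cons_rV R n)) => //=.
exact: measurableT_comp mF (@measurable_cons_rV R n).
Qed.

(** By induction on the dimension: an integral over lines in the first direction
    is the inner integral in one order of Tonelli's theorem; for the other
    directions the first coordinate is frozen. *)
Lemma eq_integral_line n (i : 'I_n) (F G : 'rV[R]_n -> \bar R) :
  measurable_fun setT F -> (forall x, 0 <= F x) ->
  measurable_fun setT G -> (forall x, 0 <= G x) ->
  (forall x, \int[lebesgue_measure]_t F (upd x i t) =
             \int[lebesgue_measure]_t G (upd x i t)) ->
  \int[product_lebesgue n]_x F x = \int[product_lebesgue n]_x G x.
Proof.
elim: n i F G => [[]//|n IH i F G mF F0 mG G0].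
have [j ->|->] := unliftP ord0 i => FG; last first.
  rewrite !tonelli_cons_swap//; apply: eq_integral => y _.
  have := FG (cons_rV (0%R, y)).
  under eq_integral do rewrite upd_cons0.
  by under [RHS]eq_integral do rewrite upd_cons0.
rewrite !tonelli_cons//; apply: eq_integral => t _.
apply: (IH j) => //.
- exact: measurableT_comp mF (measurable_cons_r t).
- exact: measurableT_comp mG (measurable_cons_r t).
move=> y; have := FG (cons_rV (t, y)).
under eq_integral do rewrite upd_consS.
by under [X in _ = X]eq_integral do rewrite upd_consS.
Qed.

End iterated_integrals.

(** * The Hölder and Gagliardo-Nirenberg inequalities *)
Section hoelder.
Context d (T : measurableType d) (R : realType) (mu : {measure set T -> \bar R}).
Lemma powR_AMGM (x y th : R) : (0 <= x)%R -> (0 <= y)%R -> (0 < th < 1)%R ->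
  (x `^ th * y `^ (1 - th) <= th * x + (1 - th) * y)%R.
Proof.
move=> x0 y0 /andP[th0 th1]; have th1' : (0 < 1 - th)%R by rewrite subr_gt0.
have := @conjugate_powR _ (x `^ th) (y `^ (1 - th)) th^-1 (1 - th)^-1.
rewrite !powR_ge0 !invr_gt0 !invrK subrKC => /(_ isT isT th0 th1' erefl).
by rewrite -!powRrM !divff ?gt_eqF// !powRr1// [x * _]mulrC [y * _]mulrC.
Qed.

Local Open Scope ereal_scope.

Lemma measurable_fun_poweR (f : T -> \bar R) r : measurable_fun setT f ->
  measurable_fun setT (fun x => f x `^ r).
Proof. by move=> mf; apply: (measurableT_comp (measurable_poweR r)). Qed.

(** The weighted AM-GM inequality for a / A and b / B, where A and B are the two
    integrals, is integrated; the cases where A or B is 0 or infinite are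
    settled by the conventions on powers of 0 and +oo. *)
Lemma hoelder_poweR (a b : T -> \bar R) (th : R) : (0 < th < 1)%R ->
  measurable_fun setT a -> measurable_fun setT b ->
  (forall x, 0 <= a x) -> (forall x, 0 <= b x) ->
  \int[mu]_x (a x `^ th * b x `^ (1 - th)) <=
  (\int[mu]_x a x) `^ th * (\int[mu]_x b x) `^ (1 - th).
Proof.
move=> /[dup] th01 /andP[th0 th1] ma mb a0 b0.
have th1' : (0 < 1 - th)%R by rewrite subr_gt0.
have int0 (c e : T -> \bar R) r s : (0 < r)%R -> measurable_fun setT c ->
    measurable_fun setT e -> (forall x, 0 <= c x) -> \int[mu]_x c x = 0 ->
    \int[mu]_x (c x `^ r * e x `^ s) = 0.
  move=> r0 mc me c0 ic0.
  have /ae_eq_integral_abs : \int[mu]_x `|c x| = 0.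
    by rewrite -ic0; apply: eq_integral => x _; rewrite gee0_abs.
  move=> /(_ measurableT mc) c0ae.
  transitivity (\int[mu]_x (cst 0 x : \bar R)); last exact: integral0.
  apply: ae_eq_integral => //.
    by apply: emeasurable_funM; exact: measurable_fun_poweR.
  apply: filterS c0ae => x /(_ I) /= cx0 _.
  by rewrite cx0 poweR0r ?mul0e// gt_eqF.
have [A0|A0] := eqVneq (\int[mu]_x a x) 0.
  by rewrite int0// mule_ge0// poweR_ge0.
have [B0|B0] := eqVneq (\int[mu]_x b x) 0.
  under eq_integral do rewrite muleC.
  by rewrite int0// mule_ge0// poweR_ge0.
have {}A0 : 0 < \int[mu]_x a x by rewrite lt0e A0 integral_ge0.
have {}B0 : 0 < \int[mu]_x b x by rewrite lt0e B0 integral_ge0.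
have [Aoo|Aoo] := eqVneq (\int[mu]_x a x) +oo.
  by rewrite Aoo poweRyr ?gt_eqF// gt0_mulye ?leey// poweR_gt0.
have [Boo|Boo] := eqVneq (\int[mu]_x b x) +oo.
  by rewrite Boo poweRyr ?gt_eqF// gt0_muley ?leey// poweR_gt0.
have Af : \int[mu]_x a x \is a fin_num by rewrite ge0_fin_numE ?ltey// ltW.
have Bf : \int[mu]_x b x \is a fin_num by rewrite ge0_fin_numE ?ltey// ltW.
move: A0 B0; rewrite -(fineK Af) -(fineK Bf) !lte_fin.
set A := fine (\int[mu]_x a x); set B := fine (\int[mu]_x b x) => A0 B0.
(* the constant that turns AM-GM for a / A and b / B into a bound on a^th b^(1-th) *)
pose k := (A `^ th * B `^ (1 - th))%R.
have k0 : (0 < k)%R by rewrite mulr_gt0 ?powR_gt0.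
rewrite !poweR_EFin -EFinM -/k.
have kA : (0 < k * th / A)%R by apply: divr_gt0 => //; exact: mulr_gt0.
have kB : (0 < k * (1 - th) / B)%R by apply: divr_gt0 => //; exact: mulr_gt0.
have ptw x : a x `^ th * b x `^ (1 - th) <=
    (k * th / A)%:E * a x + (k * (1 - th) / B)%:E * b x.
  move: (a0 x) (b0 x); case: (a x) => [ax| |]//; last first.
    rewrite gt0_muley ?lte_fin// => _ ?; rewrite addye ?leey//.
    by rewrite -ltNye (@lt_le_trans _ _ 0)// mule_ge0// lee_fin ltW.
  case: (b x) => [bx| |]//; last first.
    by rewrite gt0_muley ?lte_fin// => _ ?; rewrite -EFinM addey ?leey.
  rewrite !poweR_EFin -!EFinM -EFinD !lee_fin => ax0 bx0.
  have := @powR_AMGM (ax / A) (bx / B) th.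
  rewrite !divr_ge0 ?(ltW A0) ?(ltW B0)// => /(_ isT isT th01).
  rewrite !powRM ?invr_ge0 ?(ltW A0) ?(ltW B0)// => /(ler_wpM2l (ltW k0)).
  rewrite [X in (X <= _)%R -> _](_ : _ = ax `^ th * bx `^ (1 - th))%R; last first.
    rewrite /k -(powR_inv1 (ltW A0)) -(powR_inv1 (ltW B0)) -!powRrM.
    rewrite !mulN1r !powRN.
    field; rewrite !gt_eqF ?powR_gt0//.
  by move=> /le_trans; apply; rewrite le_eqVlt; apply/orP; left; apply/eqP; field;
    rewrite !gt_eqF.
apply: (@le_trans _ _ (\int[mu]_x ((k * th / A)%:E * a x + (k * (1 - th) / B)%:E * b x))).
  apply: ge0_le_integral => //.
  - by move=> x _; rewrite mule_ge0// poweR_ge0.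
  - by apply: emeasurable_funM; exact: measurable_fun_poweR.
  - by apply: emeasurable_funD; apply: measurable_funeM.
rewrite ge0_integralD//; last 4 first.
- by move=> x _; rewrite mule_ge0// lee_fin ltW.
- exact: measurable_funeM.
- by move=> x _; rewrite mule_ge0// lee_fin ltW.
- exact: measurable_funeM.
rewrite !ge0_integralZl_EFin ?(ltW kA) ?(ltW kB)//.
rewrite -(fineK Af) -(fineK Bf) -!EFinM -EFinD lee_fin -/A -/B.
by rewrite !divfK ?gt_eqF// -mulrDr subrKC mulr1.
Qed.

End hoelder.

Section gagliardo_nirenberg.
Context {R : realType}.
Local Open Scope ereal_scope.

Lemma integral_rV1 (F : 'rV[R]_1 -> \bar R) (x : 'rV[R]_1) :
  measurable_fun setT F -> (forall x, 0 <= F x) ->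
  \int[product_lebesgue 1]_x F x = \int[lebesgue_measure]_t F (upd x ord0 t).
Proof.
move=> mF F0; rewrite tonelli_cons_swap//= integral_dirac//; last first.
  apply: (measurable_fun_fubini_tonelli_G (fun p => F (cons_rV p))) => //.
  exact: measurableT_comp mF (@measurable_cons_rV R 0).
rewrite diracT mul1e; apply: eq_integral => t _.
congr (F _); apply/rowP => i; rewrite cons_rVE mxE.
by rewrite (ord1 i) unlift_none eqxx.
Qed.

Lemma ge0_mul_poweR (x : \bar R) m : 0 <= x ->
  x * x `^ (m.+1%:R^-1) = x `^ (m.+2%:R / m.+1%:R).
Proof.
move=> x0; rewrite -[X in X * _]poweRe1// -poweRD; last first.
  by apply: add_neq0_poweRD_def; rewrite gt_eqF// addr_gt0.
congr poweR; rewrite -[m.+2%:R]natr1; field.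
by rewrite nat1r pnatr_eq0.
Qed.

Definition dominated_by_lines n (g F : 'rV[R]_n -> \bar R) :=
  forall x i, g x <= \int[lebesgue_measure]_t F (upd x i t).

Let le_intR d (T : measurableType d) (mu : {measure set T -> \bar R})
    (f1 f2 : T -> \bar R) : (forall x, 0 <= f1 x) -> measurable_fun setT f1 ->
  measurable_fun setT f2 -> (forall x, f1 x <= f2 x) ->
  \int[mu]_x f1 x <= \int[mu]_x f2 x.
Proof. by move=> f10 m1 m2 f12; apply: ge0_le_integral. Qed.

(** One half of an induction on the dimension, the other half being [GN_dual].
    On a slice with fixed first coordinate, g is at most w = f0, the integral of
    F along the first direction, so one factor g^(1/(n+1)) of the integrand may
    be replaced by w^(1/(n+1)), which does not depend on the slice; the dual
    form on the slice, integrated over the slices, gives the claim. *)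
Lemma GN_succ n (g F : 'rV[R]_n.+2 -> \bar R) :
  (forall g F w : 'rV[R]_n.+1 -> \bar R,
    measurable_fun setT g -> measurable_fun setT F -> measurable_fun setT w ->
    (forall x, 0 <= g x) -> (forall x, 0 <= F x) -> (forall x, 0 <= w x) ->
    dominated_by_lines g F ->
    \int[product_lebesgue n.+1]_x (g x * w x `^ (n.+1%:R^-1)) <=
    \int[product_lebesgue n.+1]_x F x *
    (\int[product_lebesgue n.+1]_x w x) `^ (n.+1%:R^-1)) ->
  measurable_fun setT g -> measurable_fun setT F ->
  (forall x, 0 <= g x) -> (forall x, 0 <= F x) ->
  dominated_by_lines g F ->
  \int[product_lebesgue n.+2]_x (g x `^ (n.+2%:R / n.+1%:R)) <=
  (\int[product_lebesgue n.+2]_x F x) `^ (n.+2%:R / n.+1%:R).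
Proof.
move=> IH mg mF g0 F0 gF.
pose f0 (y : 'rV[R]_n.+1) := \int[lebesgue_measure]_s F (cons_rV (s, y)).
have f00 y : 0 <= f0 y by exact: integral_ge0.
have mFc : measurable_fun setT (F \o @cons_rV R n.+1).
  exact: measurableT_comp mF (@measurable_cons_rV R _).
have mf0 : measurable_fun setT f0.
  apply: (@measurable_fun_fubini_tonelli_G _ _ (measurableTypeR R) _ R lebesgue_measure (F \o @cons_rV R n.+1)) => // x; exact: F0.
have mFt t : measurable_fun setT (fun y => F (cons_rV (t, y))).
  exact: measurableT_comp mF (@measurable_cons_r R _ t).
have mgt t : measurable_fun setT (fun y => g (cons_rV (t, y))).
  exact: measurableT_comp mg (@measurable_cons_r R _ t).
rewrite -ge0_mul_poweR ?integral_ge0//.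
under eq_integral do rewrite -ge0_mul_poweR//.
have mgg : measurable_fun setT (fun x => g x * g x `^ n.+1%:R^-1).
  by apply: emeasurable_funM => //; exact: measurable_fun_poweR.
rewrite (tonelli_cons mgg); last by move=> x; rewrite mule_ge0// poweR_ge0.
apply: (@le_trans _ _ (\int[lebesgue_measure]_t
  (\int[product_lebesgue n.+1]_y F (cons_rV (t, y)) *
   (\int[product_lebesgue n.+1]_y f0 y) `^ n.+1%:R^-1))); last first.
  rewrite ge0_integralZr//; last 3 first.
  - apply: (@measurable_fun_fubini_tonelli_F _ _ _ _ R (product_lebesgue n.+1)
      (F \o @cons_rV R n.+1)) => // x; exact: F0.
  - by move=> t _; apply: integral_ge0.
  - exact: poweR_ge0.
  by rewrite -tonelli_cons// -tonelli_cons_swap.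
apply: le_intR.
- by move=> t; apply: integral_ge0 => y _; rewrite mule_ge0// poweR_ge0.
- apply: (@measurable_fun_fubini_tonelli_F _ _ _ _ R (product_lebesgue n.+1) (fun p => g (cons_rV p) * g (cons_rV p) `^ n.+1%:R^-1)) => //.
    exact: measurableT_comp mgg (@measurable_cons_rV R _).
  by move=> x; rewrite mule_ge0// poweR_ge0.
- apply: emeasurable_funM => //.
  apply: (@measurable_fun_fubini_tonelli_F _ _ _ _ R (product_lebesgue n.+1)
      (F \o @cons_rV R n.+1)) => // x; exact: F0.
move=> t; apply: (le_trans _ (IH (fun y => g (cons_rV (t, y)))
  (fun y => F (cons_rV (t, y))) f0 (mgt t) (mFt t) mf0 _ _ _ _)) => //.
- apply: le_intR.
  + by move=> y; rewrite mule_ge0// poweR_ge0.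
  + by apply: emeasurable_funM => //; exact: measurable_fun_poweR.
  + by apply: emeasurable_funM => //; exact: measurable_fun_poweR.
  move=> y; rewrite lee_wpmul2l//.
  apply: gt0_ler_poweR; rewrite ?in_itv/= ?leey ?andbT//.
  have := gF (cons_rV (t, y)) ord0.
  by under eq_integral do rewrite upd_cons0.
- move=> y i; have := gF (cons_rV (t, y)) (lift ord0 i).
  by under eq_integral do rewrite upd_consS.
Qed.

(** The dual form follows from the power form in the same dimension by the
    Hölder inequality with exponents (n+1)/(n+2) and 1/(n+2); in dimension one g
    is bounded by the whole integral of F. *)
Lemma GN_dual n (g F w : 'rV[R]_n.+1 -> \bar R) :
  measurable_fun setT g -> measurable_fun setT F -> measurable_fun setT w ->
  (forall x, 0 <= g x) -> (forall x, 0 <= F x) -> (forall x, 0 <= w x) ->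
  dominated_by_lines g F ->
  \int[product_lebesgue n.+1]_x (g x * w x `^ (n.+1%:R^-1)) <=
  \int[product_lebesgue n.+1]_x F x *
  (\int[product_lebesgue n.+1]_x w x) `^ (n.+1%:R^-1).
Proof.
elim: n g F w => [|n IH] g F w mg mF mw g0 F0 w0 gF.
  rewrite invr1; under eq_integral do rewrite poweRe1//.
  rewrite poweRe1 ?integral_ge0//.
  rewrite -ge0_integralZl ?integral_ge0//.
  apply: le_intR.
  - by move=> x; rewrite mule_ge0.
  - exact: emeasurable_funM.
  - exact: measurable_funeM.
  move=> x; rewrite lee_wpmul2r// (integral_rV1 x)//; exact: gF.
have H := GN_succ IH mg mF g0 F0 gF.
pose th : R := (n.+1%:R / n.+2%:R)%R.
have th1 : (1 - th = n.+2%:R^-1)%R.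
  rewrite /th -[n.+2%:R]natr1; field.
  by rewrite nat1r natr1 pnatr_eq0.
have th01 : (0 < th < 1)%R.
  by rewrite divr_gt0//= -subr_gt0 th1 invr_gt0.
have e1 : (n.+2%:R / n.+1%:R * th = 1 :> R)%R.
  by rewrite /th mulrA divfK ?divff.
have := hoelder_poweR (product_lebesgue n.+2) th01
   (measurable_fun_poweR (n.+2%:R / n.+1%:R) mg) mw (fun x => poweR_ge0 _ _) w0.
rewrite th1.
under eq_integral do rewrite -poweRrM e1 poweRe1//.
move=> /le_trans; apply; rewrite lee_wpmul2r ?poweR_ge0//.
rewrite (_ : \int[_]_x F x =
  (\int[product_lebesgue n.+2]_x F x) `^ (n.+2%:R / n.+1%:R) `^ th); last first.
  by rewrite -poweRrM e1 poweRe1// integral_ge0.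
apply: gt0_ler_poweR; rewrite ?in_itv/= ?leey ?andbT ?poweR_ge0 ?integral_ge0//.
- by case/andP : th01 => /ltW.
- by move=> *; exact: poweR_ge0.
Qed.

Lemma gagliardo_nirenberg n (g F : 'rV[R]_n.+2 -> \bar R) :
  measurable_fun setT g -> measurable_fun setT F ->
  (forall x, 0 <= g x) -> (forall x, 0 <= F x) ->
  dominated_by_lines g F ->
  \int[product_lebesgue n.+2]_x (g x `^ (n.+2%:R / n.+1%:R)) <=
  (\int[product_lebesgue n.+2]_x F x) `^ (n.+2%:R / n.+1%:R).
Proof. by apply: GN_succ => *; exact: GN_dual. Qed.

End gagliardo_nirenberg.

(** * Cubes, Borel sets and the Lebesgue sigma-algebra *)
Section borel_rV.
Context {R : realType} {n : nat}.
Notation Rn := 'rV[R]_n.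

Definition cube (c : Rn) (e : R) : set Rn :=
  [set x | forall i, `|x ord0 i - c ord0 i| < e].
Definition ccube (c : Rn) (e : R) : set Rn :=
  [set x | forall i, `|x ord0 i - c ord0 i| <= e].

Lemma ball_cube c e : 0 < e -> ball (c : Rn) e = cube c e.
Proof.
move=> e0; apply/seteqP; split => x.
  by move=> [_ H] i; rewrite distrC; exact: H.
by move=> H; split => // i j; rewrite (ord1 i) /ball/= distrC; exact: H.
Qed.

Lemma measurable_forall_coord (P : 'I_n -> set (measurableTypeR R)) :
  (forall i, measurable (P i)) ->
  measurable [set x : Rn | forall i, P i (x ord0 i)].
Proof.
move=> mP.
rewrite [X in measurable X](_ : _ = \bigcap_(i in [set: 'I_n]) [set x : Rn | P i (x ord0 i)]); last first.
  by apply/seteqP; split => x /= H i; [move=> _; exact: H|exact: (H i I)].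
apply: fin_bigcap_measurable => //.
by move=> i _; rewrite -[X in measurable X]setTI; exact: measurable_coord.
Qed.

Lemma measurable_cube c e : measurable (cube c e).
Proof.
apply: (@measurable_forall_coord (fun i => [set t | `|t - c ord0 i| < e])) => i.
rewrite (_ : [set _ | _] = `](c ord0 i - e), (c ord0 i + e)[%classic).
  exact: measurable_itv.
by apply/seteqP; split => t /=; rewrite in_itv/= ltr_distl.
Qed.

Lemma measurable_ccube c e : measurable (ccube c e).
Proof.
apply: (@measurable_forall_coord (fun i => [set t | `|t - c ord0 i| <= e])) => i.
rewrite (_ : [set _ | _] = `[(c ord0 i - e), (c ord0 i + e)]%classic).
  exact: measurable_itv.
by apply/seteqP; split => t /=; rewrite in_itv/= ler_distl.
Qed.

Lemma compact_ccube c e : compact (ccube c e).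
Proof.
rewrite (_ : ccube c e = [set x : Rn | forall i,
  [set t | c ord0 i - e <= t <= c ord0 i + e] (x ord0 i)]).
  apply: (@rV_compact _ _ (fun i => [set t | c ord0 i - e <= t <= c ord0 i + e])) => i.
  rewrite (_ : [set _ | _] = `[(c ord0 i - e), (c ord0 i + e)]%classic).
    exact: segment_compact.
  by apply/seteqP; split => t /=; rewrite in_itv.
by apply/seteqP; split => x /= H i; [rewrite -ler_distl|rewrite ler_distl]; exact: H.
Qed.

(** The cubes with rational center and radius 1/(m+1), enumerated by the
    countable type of pairs; D selects those whose closure lies in A. *)
Lemma open_bigcup_cube (A : set Rn) : open A ->
  exists (D : set nat) (c : nat -> Rn) (e : nat -> R),
   [/\ forall k, D k -> 0 < e k, forall k, D k -> ccube (c k) (e k) `<=` A &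
      A = \bigcup_(k in D) cube (c k) (e k)].
Proof.
move=> oA.
pose dec k : 'rV[rat]_n * nat := odflt (0, 0%N) (unpickle k).
pose c k : Rn := map_mx ratr (dec k).1.
pose e k : R := (dec k).2.+1%:R^-1.
exists [set k | ccube (c k) (e k) `<=` A], c, e; split => //.
  by move=> k _; rewrite invr_gt0.
apply/seteqP; split; last first.
  move=> x [k /= kA xk]; apply: kA => i; exact/ltW/xk.
move=> x Ax.
have [r r0 xrA] : exists2 r, 0 < r & cube x r `<=` A.
  have /nbhs_ballP[r/= r0 xr] := oA _ Ax.
  by exists r => //; rewrite -ball_cube.
have [m mr] : exists m, m.+1%:R^-1 < r / 2.
  have [m _ /(_ m (leqnn m)) /= mr] :=
    near_infty_natSinv_lt (PosNum (divr_gt0 r0 (ltr0Sn R 1))).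
  by exists m.
have m0 : 0 < (m.+1%:R^-1 : R) by rewrite invr_gt0.
have /choice[q hq] : forall i, exists q : rat, `|x ord0 i - ratr q| < (m.+1%:R^-1 : R).
  move=> i; have /rat_in_itvoo[q qxx] : x ord0 i - m.+1%:R^-1 < x ord0 i + m.+1%:R^-1.
    by rewrite ltrBlDr -addrA ltrDl addr_gt0.
  by exists q; move: qxx; rewrite in_itv/= distrC ltr_distl.
pose k := pickle (\row_i q i : 'rV[rat]_n, m).
have ck i : c k ord0 i = ratr (q i) by rewrite /c /dec pickleK/= !mxE.
have ek : e k = m.+1%:R^-1 by rewrite /e /dec pickleK.
exists k; last by move=> i; rewrite ck ek.
move=> y /= yk; apply: xrA => i.
rewrite (splitr r) -(subrK (ratr (q i)) (y ord0 i)) -addrA.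
rewrite (le_lt_trans (ler_normD _ _))// ltrD//.
  by apply: le_lt_trans mr; rewrite -ek -ck.
by rewrite distrC (lt_trans _ mr).
Qed.

Lemma open_measurable_rV (A : set Rn) : open A -> measurable A.
Proof.
move=> /open_bigcup_cube[D [c [e [_ _ ->]]]].
by apply: bigcup_measurable => k _; exact: measurable_cube.
Qed.

Lemma continuous_measurable_rV (f : Rn -> R) : continuous f ->
  measurable_fun setT (f : _ -> measurableTypeR R).
Proof.
move=> /continuousP cf; apply: (measurability _ (RGenOpens.measurableE R)).
move=> _ [_ [a [b ->] <-]]; rewrite setTI; apply: open_measurable_rV.
exact/cf/interval_open.
Qed.

Local Notation mu := (@product_lebesgue R n).

Lemma borel_lebesgue (A : set Rn) : measurable A ->
  measurable (A : set (lebesgueRn R n)).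
Proof. by move=> mA; apply: sub_caratheodory; exact: sub_sigma_algebra. Qed.

Lemma leb_borel (A : set Rn) : measurable A -> leb (A : set (lebesgueRn R n)) = mu A.
Proof. by move=> mA; rewrite /leb /completed_measure_extension measurable_mu_extE. Qed.

Lemma measurable_borel_lebesgue d (T : measurableType d) (f : Rn -> T) :
  measurable_fun setT f -> measurable_fun (setT : set (lebesgueRn R n)) f.
Proof.
move=> mf _ Y mY; rewrite setTI; apply: borel_lebesgue.
by rewrite -[X in measurable X]setTI; exact: mf.
Qed.

(** The identity is measurable from the Lebesgue to the Borel sigma-algebra and
    pushes the completed measure forward to the product measure. *)
Lemma integral_leb (f : Rn -> \bar R) : measurable_fun setT f ->
  (forall x, 0 <= f x)%E ->
  (\int[leb]_(x in (setT : set (lebesgueRn R n))) f x = \int[mu]_x f x)%E.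
Proof.
move=> mf f0.
have mid : measurable_fun (setT : set (lebesgueRn R n)) (id : lebesgueRn R n -> Rn).
  exact/measurable_borel_lebesgue/measurable_id.
have := ge0_integral_pushforward mid leb measurableT mf (fun x _ => f0 x).
rewrite preimage_setT => <-.
by apply: eq_measure_integral => A mA _; exact: leb_borel.
Qed.

End borel_rV.

Lemma mu_ccube_lty {R : realType} n (c : 'rV[R]_n) e :
  (product_lebesgue n (ccube c e) < +oo)%E.
Proof.
elim: n c => [|n IH] c /=; first by rewrite diracE; case: (_ \in _); rewrite ltry.
rewrite /lebesgue_rV_succ /pushforward.
pose c' : 'rV[R]_n := \row_j c ord0 (lift ord0 j).
rewrite (_ : _ @^-1` _ = `[(c ord0 ord0 - e), (c ord0 ord0 + e)]%classic `*` ccube c' e).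
  rewrite product_measure1E//; last exact: measurable_ccube.
  apply: lte_mul_pinfty => //.
  rewrite ge0_fin_numE//.
  by have := lebesgue_measure_itv `[c ord0 ord0 - e, c ord0 ord0 + e] => /= ->;
    case: ifP; rewrite ?ltry.
apply/seteqP; split => [[t y]|[t y]] /=.
  move=> H; split => /=.
    by have := H ord0; rewrite cons_rVE unlift_none/= in_itv/= ler_distl.
  by move=> i; have := H (lift ord0 i); rewrite cons_rVE liftK mxE.
move=> [/=]; rewrite in_itv/= -ler_distl => t0 H i; rewrite cons_rVE.
by case: unliftP => [j ->|->]//=; have := H j; rewrite mxE.
Qed.

(** * Integrals of nonnegative functions as suprema over simple functions *)
Section lower_integral.
Context d (T : measurableType d) (R : realType) (mu : {measure set T -> \bar R}).
Local Open Scope ereal_scope.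
Import HBNNSimple.

Lemma le_integralT_nomeas (f g : T -> \bar R) :
  (forall x, 0 <= f x) -> (forall x, f x <= g x) ->
  \int[mu]_x f x <= \int[mu]_x g x.
Proof.
move=> f0 fg; have g0 x : 0 <= g x by exact: le_trans (fg x).
rewrite !ge0_integralTE//.
apply: ge_ereal_sup => /= _ [h hf <-].
apply: ereal_sup_ubound; exists h => // x; exact: le_trans (hf x) (fg x).
Qed.

(** Without measurability the integral is still monotone, but only superadditive.
    Subadditivity holds when one summand is measurable: if a simple function s
    is below g + k then the positive part of s - g is measurable and below k. *)
Lemma ge0_le_integral_nomeas (D : set T) (f g k : T -> \bar R) :
  measurable D -> (forall x, D x -> 0 <= f x) -> (forall x, D x -> 0 <= g x) ->
  (forall x, D x -> 0 <= k x) -> measurable_fun D g ->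
  {ae mu, forall x, D x -> f x <= g x + k x} ->
  \int[mu]_(x in D) f x <= \int[mu]_(x in D) g x + \int[mu]_(x in D) k x.
Proof.
move=> mD f0 g0 k0 mg [N [mN N0 HN]].
rewrite (integral_mkcond _ f) (integral_mkcond _ g) (integral_mkcond _ k).
set f' := f \_ D; set g' := g \_ D; set k' := k \_ D.
have f'0 x : 0 <= f' x by rewrite /f' patchE; case: ifPn => // /set_mem/f0.
have g'0 x : 0 <= g' x by rewrite /g' patchE; case: ifPn => // /set_mem/g0.
have k'0 x : 0 <= k' x by rewrite /k' patchE; case: ifPn => // /set_mem/k0.
have mg' : measurable_fun setT g'.
  by apply/measurable_restrict => //; rewrite setIidr.
(* g made infinite on the exceptional null set, so that the bound holds everywhere *)
pose h x := if x \in N then +oo else g' x.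
have mh : measurable_fun setT h.
  apply: measurable_fun_ifT => //; apply: (measurable_fun_bool true).
  by rewrite setTI preimage_mem_true.
have h0 x : 0 <= h x by rewrite /h; case: ifPn.
have H x : f' x <= h x + k' x.
  rewrite /h; case: ifPn => xN; first by rewrite addye ?leey// -ltNye (lt_le_trans _ (k'0 x)).
  have [xD|xD] := boolP (x \in D); last by rewrite /f' /g' /k' !patchE (negbTE xD) adde0.
  rewrite /f' /g' /k' !patchE xD.
  apply: contrapT => C; move/negP: xN; apply; apply/mem_set/HN => /= /(_ (set_mem xD)).
  exact: C.
have -> : \int[mu]_x g' x = \int[mu]_x h x.
  apply: ge0_ae_eq_integral => //.
  exists N; split => // x /= gh; apply: contrapT => xN; apply: gh => _.
  by rewrite /h memNset.
rewrite [leLHS]ge0_integralTE//; apply: ge_ereal_sup => /= _ [s sf <-].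
pose s' x := maxe ((s x)%:E - h x) 0.
have ms : measurable_fun setT (fun x => (s x)%:E) by exact/measurable_EFinP.
have ms' : measurable_fun setT s'.
  by apply: measurable_maxe => //; apply: emeasurable_funB.
have s'0 x : 0 <= s' x by rewrite /s' le_max lexx orbT.
have s'k x : s' x <= k' x.
  rewrite /s' ge_max k'0 andbT.
  have := le_trans (sf x) (H x).
  move: (h0 x); case: (h x) => [hx| |]// _; last by rewrite leNye.
  by rewrite leeBlDl.
rewrite -integralT_nnsfun.
apply: (@le_trans _ _ (\int[mu]_x (h x + s' x))).
  apply: ge0_le_integral => //.
  - by move=> x _; rewrite lee_fin.
  - exact: emeasurable_funD.
  move=> x _; rewrite /s'.
  move: (h0 x); case: (h x) => [hx| |]// _.
    by rewrite addeC -leeBlDr// le_max lexx.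
  by rewrite addye ?leey//; rewrite -ltNye lt_max ltNy0 orbT.
rewrite ge0_integralD// leeD2l//; exact: le_integralT_nomeas.
Qed.

Lemma subset_integral_nomeas (A B : set T) (f : T -> \bar R) : A `<=` B ->
  (forall x, B x -> 0 <= f x) ->
  \int[mu]_(x in A) f x <= \int[mu]_(x in B) f x.
Proof.
move=> AB f0; rewrite integral_mkcond [leRHS]integral_mkcond.
apply: le_integralT_nomeas => x.
  by rewrite patchE; case: ifPn => // /set_mem/AB/f0.
rewrite !patchE; case: ifPn => [xA|_]; last by case: ifPn => // /set_mem/f0.
by rewrite mem_set//; exact/AB/set_mem.
Qed.

Lemma integral_scale_nomeas (D : set T) (f : T -> \bar R) (c : R) : (0 < c)%R ->
  (forall x, D x -> 0 <= f x) ->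
  \int[mu]_(x in D) (c%:E * f x) <= c%:E * \int[mu]_(x in D) f x.
Proof.
move=> c0 f0; rewrite (integral_mkcond _ (fun x => _ * _)) (integral_mkcond _ f).
have g0 x : 0 <= (f \_ D) x by rewrite patchE; case: ifPn => // /set_mem/f0.
have E x : ((fun x => c%:E * f x) \_ D) x = c%:E * (f \_ D) x.
  by rewrite !patchE; case: ifPn => //; rewrite mule0.
have c0' : 0 <= c%:E by rewrite lee_fin ltW.
have ic0 : (0 <= c^-1)%R by rewrite invr_ge0 ltW.
rewrite !ge0_integralTE//; last by move=> x; rewrite E mule_ge0.
apply: ge_ereal_sup => /= _ [h hf <-].
have -> : sintegral mu h = c%:E * sintegral mu (scale_nnsfun h ic0).
  by rewrite sintegralrM muleA -EFinM divff ?gt_eqF// mul1e.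
apply: lee_wpmul2l => //; apply: ereal_sup_ubound; exists (scale_nnsfun h ic0) => // x /=.
have := hf x; rewrite E => hx; rewrite EFinM.
have := lee_wpmul2l (x := c^-1%:E) _ hx; rewrite lee_fin => /(_ ic0) H.
by apply: (le_trans H); rewrite muleA -EFinM mulVf ?gt_eqF// mul1e.
Qed.

End lower_integral.

(** * Functions with compact support on coordinate lines *)
Section powers.
Context {R : realType}.
Implicit Types (y g : R).

Lemma powR_norm_cvg0 g : 0 < g -> `|y| `^ g @[y --> (0 : R)] --> (0 : R).
Proof.
move=> g0.
apply/cvgrPdist_lt => /= e e0.
near=> t; rewrite sub0r normrN ger0_norm ?powR_ge0//.
have te : `|t| < e `^ g^-1.
  near: t; apply/nbhs_normP; exists (e `^ g^-1); first by rewrite /= powR_gt0.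
  by move=> z /=; rewrite sub0r normrN.
have := @gt0_ltr_powR _ g g0 `|t| (e `^ g^-1).
rewrite !nnegrE powR_ge0 normr_ge0 -powRrM mulVf ?gt_eqF// powRr1 ?ltW//.
exact.
Unshelve. all: by end_near. Qed.

Lemma sg_powR_cvg0 g : 0 < g ->
  Num.sg y * `|y| `^ g @[y --> (0 : R)] --> Num.sg (0 : R) * `|0 : R| `^ g.
Proof.
move=> g0; rewrite sgr0 mul0r; apply/cvgr0Pnorm_lt => e e0 /=.
have /cvgrPdist_lt/(_ e e0) := powR_norm_cvg0 g0.
apply: filterS => z; rewrite sub0r normrN.
by apply: le_lt_trans; rewrite normrM ler_piMl// normr_sg lern1 leq_b1.
Qed.

Definition dpowR_norm g y := g * (Num.sg y * `|y| `^ (g - 1)).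

Lemma is_derive_powR_norm g y : 1 < g ->
  is_derive y 1 (fun z : R => `|z| `^ g) (dpowR_norm g y).
Proof.
move=> g1; have g0 : 0 < g by exact: lt_trans g1.
have [y0|y0|->] := ltgtP y 0.
- rewrite /dpowR_norm ltr0_sg// mulN1r ltr0_norm//.
  apply: (@near_eq_is_derive _ _ _ (fun z => (- z) `^ g)) => //.
    by near=> z; rewrite ltr0_norm//; near: z; exact: lt_nbhsl.
  have Ny0 : 0 < - y by rewrite oppr_gt0.
  have H := is_derive1_powR g Ny0.
  have := @is_derive1_comp _ _ _ _ _ _ H (is_deriveNid y 1).
  by rewrite !mulrN mulr1.
- rewrite /dpowR_norm gtr0_sg// mul1r gtr0_norm//.
  apply: (@near_eq_is_derive _ _ _ (fun z => z `^ g)).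
    by near=> z; rewrite gtr0_norm//; near: z; exact: lt_nbhsr.
  exact: is_derive1_powR.
- rewrite /dpowR_norm sgr0 mul0r mulr0; apply/is_derive1_caratheodory.
  exists (fun z => Num.sg z * `|z| `^ (g - 1)); split.
  + move=> z; rewrite normr0 powR0 ?gt_eqF// !subr0.
    by rewrite mulrAC -normrEsg mulr_powRB1.
  + by apply: sg_powR_cvg0; rewrite subr_gt0.
  + by rewrite sgr0 mul0r.
Unshelve. all: by end_near. Qed.

Lemma continuous_dpowR_norm g : 1 < g -> continuous (dpowR_norm g).
Proof.
move=> g1 y; have g10 : 0 < g - 1 by rewrite subr_gt0.
apply: cvgM; first exact: cvg_cst.
have cpow (z : R) : 0 < z -> {for z, continuous (fun x : R => x `^ (g - 1))}.
  move=> z0; apply: differentiable_continuous; apply/derivable1_diffP.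
  by have [] := is_derive1_powR (g - 1) z0.
have [y0|y0|->] := ltgtP y 0.
- rewrite ltr0_sg// ltr0_norm// mulN1r.
  apply: (@cvg_trans _ ((fun z => - (- z) `^ (g - 1)) z @[z --> y])).
    apply: near_eq_cvg; near=> z.
    have z0 : z < 0 by near: z; exact: lt_nbhsl.
    by rewrite ltr0_sg// ltr0_norm// mulN1r.
  have H : (- z) `^ (g - 1) @[z --> y] --> (- y) `^ (g - 1).
    apply: (@continuous_comp R R R (fun z => - z) (fun z => z `^ (g - 1))).
      exact: opp_continuous.
    by apply: cpow; rewrite oppr_gt0.
  exact: (cvgN H).
- rewrite gtr0_sg// gtr0_norm// mul1r.
  apply: (@cvg_trans _ ((fun z => z `^ (g - 1)) z @[z --> y])).
    apply: near_eq_cvg; near=> z.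
    have z0 : 0 < z by near: z; exact: lt_nbhsr.
    by rewrite gtr0_sg// gtr0_norm// mul1r.
  have H : z `^ (g - 1) @[z --> y] --> y `^ (g - 1) by exact: cpow.
  exact: H.
- exact: sg_powR_cvg0.
Unshelve. all: by end_near. Qed.

Lemma norm_dpowR_norm g y : 1 < g -> `|dpowR_norm g y| = g * `|y| `^ (g - 1).
Proof.
move=> g1; rewrite /dpowR_norm !normrM (gtr0_norm (lt_trans ltr01 g1)).
rewrite (ger0_norm (powR_ge0 _ _)); have [->|y0] := eqVneq y 0.
  by rewrite normr0 powR0 ?mulr0// subr_eq0 gt_eqF.
by rewrite normr_sg y0 mul1r.
Qed.

End powers.

Section one_dim.
Context {R : realType}.
Local Notation leb1 := (@lebesgue_measure R).
Variables (h h' : R -> R) (L : R).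
Hypothesis dh : forall t : R, is_derive t 1 h (h' t).
Hypothesis ch' : continuous h'.
Hypothesis hL : forall t, L <= `|t| -> h t = 0.

Let ch : continuous h.
Proof.
move=> t; apply: differentiable_continuous; apply/derivable1_diffP.
by have [] := dh t.
Qed.

Let ftc a b : a < b ->
  (\int[leb1]_(x in `[a, b]) (h' x)%:E = (h b)%:E - (h a)%:E)%E.
Proof.
move=> ab; apply: (@continuous_FTC2 _ _ h) => //.
- exact: continuous_subspaceT.
- split.
  + by move=> x _; have [] := dh x.
  + exact/cvg_at_right_filter/ch.
  + exact/cvg_at_left_filter/ch.
- by move=> x _; rewrite derive1E; have [] := dh x.
Qed.

Let mh' : measurable_fun setT (fun s : measurableTypeR R => (h' s)%:E).
Proof. by apply/measurable_EFinP; exact: continuous_measurable_fun. Qed.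

Lemma line_le (t : R) :
  (`|h t|%:E <= \int[leb1]_s `|h' s|%:E)%E.
Proof.
pose a : R := - (`|t| + `|L| + 1).
have a_t : a < t.
  by rewrite /a ltrNl (le_lt_trans (ler_norm _))// normrN -addrA ltrDl ltr_wpDl.
have ha : h a = 0.
  apply: hL; rewrite normrN ger0_norm ?addr_ge0//.
  by rewrite (le_trans (ler_norm _))// [`|t| + _]addrC -addrA lerDl addr_ge0.
have := ftc a_t; rewrite ha sube0 => e.
rewrite -[`|h t|%:E]/(`|(h t)%:E|)%E -e.
apply: (le_trans (le_abse_integral _ _ _)) => //.
  exact: measurable_funTS.
apply: ge0_subset_integral => //.
exact: measurableT_comp.
Qed.

(** The integral of h' vanishes since h has compact support.  In terms of
    positive and negative parts this can be integrated over all lines by Tonelli's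
    theorem for nonnegative functions. *)
Lemma line_int0 : (\int[leb1]_s (Num.max (h' s) 0)%:E =
                   \int[leb1]_s (Num.max (- h' s) 0)%:E)%E.
Proof.
pose M : R := `|L| + 1.
pose I : set R := `[- M, M]%classic.
have h'0 s : `|L| < `|s| -> h' s = 0.
  move=> Ls; have [_ <-] := dh s.
  rewrite (@near_eq_derive _ _ _ _ (cst 0)) ?derive_cst//.
  near=> z; apply: hL; rewrite (le_trans (ler_norm L))// ltW//.
  near: z; apply: (@cvgr_gt _ _ (nbhs s) _ _ `|s|) => //.
  exact: norm_continuous.
have M0 : - M < M by rewrite gtrN// ltr_wpDl.
have := ftc M0.
have hM : h M = 0.
  by apply: hL; rewrite (le_trans (ler_norm _))// [leRHS]ger0_norm ?addr_ge0// lerDl.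
have hNM : h (- M) = 0.
  by apply: hL; rewrite (le_trans (ler_norm _))// normrN [leRHS]ger0_norm ?addr_ge0// lerDl.
rewrite hM hNM subee//.
have ih : leb1.-integrable `[- M, M] (EFin \o h').
  apply: continuous_compact_integrable; first exact: segment_compact.
  exact: continuous_subspaceT.
have red (f : R -> R) : (forall s, `|L| < `|s| -> f s = 0) ->
  (\int[leb1]_s (f s)%:E = \int[leb1]_(s in I) (f s)%:E)%E.
  move=> f0; rewrite [RHS]integral_mkcond; apply: eq_integral => s _.
  rewrite patchE; case: ifPn => // /negP sM; rewrite f0// ltNge; apply/negP => sL.
  apply: sM; apply/mem_set; rewrite /I /= in_itv/= -ler_norml (le_trans sL)//.
  by rewrite lerDl.
rewrite (red (fun s => Num.max (h' s) 0)); last by move=> s /h'0 ->; rewrite maxxx.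
rewrite (red (fun s => Num.max (- h' s) 0)); last by move=> s /h'0 ->; rewrite oppr0 maxxx.
rewrite integralE.
have -> : (\int[leb1]_(x in I) (Num.max (h' x) 0)%:E =
           \int[leb1]_(x in I) ((EFin \o h')^\+ x))%E.
  by apply: eq_integral => s _; rewrite funeposE -EFin_max.
have -> : (\int[leb1]_(x in I) (Num.max (- h' x) 0)%:E =
           \int[leb1]_(x in I) ((EFin \o h')^\- x))%E.
  by apply: eq_integral => s _; rewrite funenegE -EFinN -EFin_max.
have mI : measurable (I : set (measurableTypeR R)) by exact: measurable_itv.
have := @integrable_pos_fin_num _ _ _ leb1 I mI _ ih.
have := @integrable_neg_fin_num _ _ _ leb1 I mI _ ih.
by move=> /fineK <- /fineK <- /eqP; rewrite -EFinB eqe subr_eq0 => /eqP ->.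
Unshelve. all: by end_near. Qed.

End one_dim.

Section lines.
Context {R : realType} {n : nat}.
Notation Rn := 'rV[R]_n.
Implicit Types f g : Rn -> R.

Definition e_ (k : 'I_n) : Rn := delta_mx ord0 k.

Lemma upd_shift (x : Rn) i (t s : R) : upd x i (t + s) = upd x i t + s *: e_ i.
Proof.
apply/rowP => j; rewrite !mxE eqxx /=.
by case: eqP => _; rewrite ?mulr1 ?mulr0 ?addr0.
Qed.

Lemma upd_id (x : Rn) i : upd x i (x ord0 i) = x.
Proof. by apply/rowP => j; rewrite mxE; case: eqP => [->|]. Qed.

Lemma continuous_upd (x : Rn) i : continuous (upd x i).
Proof.
have -> : upd x i = (fun t => upd x i 0 + t *: e_ i).
  by apply/funext => t; rewrite -upd_shift add0r.
move=> t; apply: cvgD; first exact: cvg_cst.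
by apply: cvgZr_tmp; exact: cvg_id.
Qed.

Definition C1 f := continuous f /\ forall k,
  (forall x, derivable f x (e_ k)) /\ continuous (dpartial k f).

(** Bounded support, in the form needed on coordinate lines, where a single
    coordinate tends to infinity. *)
Definition bsupp f := exists L : R, forall x : Rn, (exists i, L <= `|x ord0 i|) -> f x = 0.

Lemma is_derive_line f k (x : Rn) (t : R) : (forall x, derivable f x (e_ k)) ->
  is_derive t 1 (fun s : R => f (upd x k s)) (dpartial k f (upd x k t)).
Proof.
move=> df.
have e : (fun h : R => h^-1 *: ((fun s => f (upd x k s)) (h *: (1 : R) + t) - f (upd x k t))) =
  (fun h : R => h^-1 *: (f (h *: e_ k + upd x k t) - f (upd x k t))).
  apply/funext => h; congr (_ *: (f _ - _)).
  have -> : h *: (1 : R) + t = t + h by rewrite addrC; congr (_ + _); exact: mulr1.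
  by rewrite upd_shift addrC.
have d1 : derivable (fun s : R => f (upd x k s)) t 1 by rewrite /derivable e; exact: df.
by apply: DeriveDef => //; rewrite /derive e.
Qed.

Lemma line_dominated f k (x : Rn) : C1 f -> bsupp f ->
  (`|f x|%:E <= \int[lebesgue_measure]_t `|dpartial k f (upd x k t)|%:E)%E.
Proof.
move=> [cf df] [L fL]; have [dfk cfk] := df k.
rewrite -{1}(upd_id x k).
apply: (line_le (L := L) (h := fun s => f (upd x k s))
  (h' := fun s => dpartial k f (upd x k s))).
- by move=> t; exact: is_derive_line.
- by move=> t; apply: (@continuous_comp _ _ _ (upd x k)); [exact: continuous_upd|exact: cfk].
- by move=> t Lt; apply: fL; exists k; rewrite mxE eqxx.
Qed.

Lemma line_dominated_pow f k (x : Rn) (g : R) : 1 < g -> C1 f -> bsupp f ->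
  ((`|f x| `^ g)%:E <= \int[lebesgue_measure]_t
    (g * `|f (upd x k t)| `^ (g - 1) * `|dpartial k f (upd x k t)|)%:E)%E.
Proof.
move=> g1 [cf df] [L fL]; have [dfk cfk] := df k.
rewrite -{1}(upd_id x k).
have -> : (fun t => (g * `|f (upd x k t)| `^ (g - 1) * `|dpartial k f (upd x k t)|)%:E) =
  (fun t => `|dpowR_norm g (f (upd x k t)) * dpartial k f (upd x k t)|%:E).
  by apply/funext => t; rewrite normrM norm_dpowR_norm.
rewrite -[_ `^ _]ger0_norm ?powR_ge0//.
apply: (line_le (L := L) (h := fun s => `|f (upd x k s)| `^ g)
  (h' := fun s => dpowR_norm g (f (upd x k s)) * dpartial k f (upd x k s))).
- move=> t.
  exact: (is_derive1_comp (is_derive_powR_norm (f (upd x k t)) g1) (is_derive_line x t dfk)).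
- move=> t; apply: cvgM.
    apply: (@continuous_comp _ _ _ (fun s => f (upd x k s)) (dpowR_norm g)); last exact: continuous_dpowR_norm.
    apply: (@continuous_comp _ _ _ (upd x k)); [exact: continuous_upd|exact: cf].
  by apply: (@continuous_comp _ _ _ (upd x k)); [exact: continuous_upd|exact: cfk].
- move=> t Lt; rewrite fL ?normr0 ?powR0 ?gt_eqF ?(lt_trans _ g1)//.
  by exists k; rewrite mxE eqxx.
Qed.

Lemma integral_dpartial0 f k : C1 f -> bsupp f ->
  (\int[product_lebesgue n]_x (Num.max (dpartial k f x) 0)%:E =
   \int[product_lebesgue n]_x (Num.max (- dpartial k f x) 0)%:E)%E.
Proof.
move=> [cf df] [L fL]; have [dfk cfk] := df k.
have md : measurable_fun setT (dpartial k f : Rn -> measurableTypeR R).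
  exact: continuous_measurable_rV.
apply: (eq_integral_line (i := k)).
- by apply/measurable_EFinP; exact: measurable_maxr.
- by move=> x; rewrite lee_fin le_max lexx orbT.
- by apply/measurable_EFinP; apply: measurable_maxr => //; exact: measurableT_comp.
- by move=> x; rewrite lee_fin le_max lexx orbT.
move=> x.
apply: (line_int0 (L := L) (h := fun s => f (upd x k s))
  (h' := fun s => dpartial k f (upd x k s))).
- by move=> t; exact: is_derive_line.
- by move=> t; apply: (@continuous_comp _ _ _ (upd x k)); [exact: continuous_upd|exact: cfk].
- by move=> t Lt; apply: fL; exists k; rewrite mxE eqxx.
Qed.

Lemma C1M f g : C1 f -> C1 g -> C1 (fun x => f x * g x).
Proof.
move=> [cf df] [cg dg]; split; first by move=> x; exact: (cvgM (cf x) (cg x)).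
move=> k; have [dfk cfk] := df k; have [dgk cgk] := dg k; split.
  by move=> x; exact: derivableM.
have -> : dpartial k (fun x => f x * g x) =
    (fun x => f x * dpartial k g x + g x * dpartial k f x).
  by apply/funext => x; rewrite /dpartial deriveM.
by move=> x; exact: (cvgD (cvgM (cf x) (cgk x)) (cvgM (cg x) (cfk x))).
Qed.

Lemma dpartialM f g k x : C1 f -> C1 g ->
  dpartial k (fun x => f x * g x) x = f x * dpartial k g x + g x * dpartial k f x.
Proof.
move=> [cf df] [cg dg]; have [dfk _] := df k; have [dgk _] := dg k.
by rewrite /dpartial deriveM.
Qed.

Lemma C1X f m : C1 f -> C1 (fun x => f x ^+ m).
Proof.
move=> cf; elim: m => [|m IH].
  under eq_fun do rewrite expr0.
  split; first by move=> x; exact: (@cst_continuous Rn R 1 x).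
  move=> k; split; first by move=> x; exact: (@derivable_cst _ _ _ (1 : R)).
  have -> : dpartial k (fun=> 1 : R) = (fun=> 0).
    by apply/funext => x; rewrite /dpartial derive_cst.
  by move=> x; exact: (@cst_continuous Rn R 0 x).
under eq_fun do rewrite exprS.
exact: C1M.
Qed.

Lemma dpartialX f k m x : C1 f ->
  dpartial k (fun x => f x ^+ m.+1) x = m.+1%:R * f x ^+ m * dpartial k f x.
Proof.
move=> cf; elim: m => [|m IH].
  by rewrite mulr1 mul1r; congr (dpartial k _ x); apply/funext => y; rewrite expr1.
have -> : (fun x => f x ^+ m.+2) = (fun x => f x * f x ^+ m.+1).
  by apply/funext => y; rewrite exprS.
rewrite dpartialM//; last exact: C1X.
by rewrite IH -[m.+2%:R]natr1 exprS; ring.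
Qed.

End lines.

(** * Smooth cutoff functions *)
Section flat_function.
Context {R : realType}.
Implicit Types (P : {poly R}) (t : R).

(** For P = 1 this is the smooth function exp(-1/t) extended by zero; with the
    polynomial factors in 1/t the family is closed under differentiation. *)
Definition flat P t : R := if 0 < t then P.[t^-1] * expR (- t^-1) else 0.

(** exp(1/t) dominates (1/t)^(m+1), where m bounds the degree of P; hence the
    derivative at the origin is zero. *)
Lemma flat_le_lin P : exists C : R, forall t, t <= 1 -> `|flat P t| <= C * `|t|.
Proof.
pose m := size P.
exists ((\sum_(i < m) `|P`_i|) * m.+1`!%:R) => t t1; rewrite /flat; case: ifPn => t0; last first.
  by rewrite normr0 mulr_ge0// mulr_ge0// sumr_ge0.
have y0 : 0 < t^-1 by rewrite invr_gt0.
have y1 : 1 <= t^-1 by rewrite invf_ge1.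
rewrite normrM (ger0_norm (expR_ge0 _)).
have bP : `|P.[t^-1]| <= (\sum_(i < m) `|P`_i|) * t^-1 ^+ m.
  rewrite horner_coef (le_trans (ler_norm_sum _ _ _))// mulr_suml ler_sum// => i _.
  rewrite normrM ler_wpM2l// ger0_norm ?exprn_ge0 ?(ltW y0)//.
  by rewrite ler_weXn2l// ltnW.
have be : expR (- t^-1) <= m.+1`!%:R / t^-1 ^+ m.+1.
  rewrite expRN -[leRHS]invrK lef_pV2 ?posrE ?expR_gt0 ?invr_gt0 ?divr_gt0 ?exprn_gt0 ?ltr0n ?fact_gt0//.
  rewrite invf_div (le_trans _ (expR_ge1Dxn m (ltW y0)))//.
  by rewrite lerDr.
apply: (le_trans (ler_pM _ _ bP be)); rewrite ?expR_ge0//.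
rewrite -!mulrA ler_wpM2l ?sumr_ge0// mulrCA ler_wpM2l ?ler0n//.
by rewrite exprSr invfM mulrA divff ?mul1r ?invrK ?gtr0_norm// expf_neq0 ?gt_eqF.
Qed.

Lemma flat0 P t : t <= 0 -> flat P t = 0.
Proof. by rewrite /flat ltNge => ->. Qed.

(** The derivative of P(1/t) exp(-1/t) is t^-2 (P(1/t) - P'(1/t)) exp(-1/t). *)
Lemma is_derive_flat P t : is_derive t 1 (flat P) (flat ('X^2 * (P - P^`())) t).
Proof.
have [t0|t0|->] := ltgtP t 0.
- rewrite [flat _ t]flat0 ?ltW//.
  apply: (@near_eq_is_derive _ _ _ (cst 0)).
    by near=> z; rewrite flat0// ltW//; near: z; exact: lt_nbhsl.
- apply: (@near_eq_is_derive _ _ _ (fun z : R => P.[z^-1] * expR (- z^-1))).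
    near=> z; rewrite /flat ifT//; near: z; exact: lt_nbhsr.
  have tN0 : t != 0 by rewrite gt_eqF.
  have dV : is_derive t 1 (fun z : R => z^-1) (- t^-2).
    have := @is_deriveV _ (fun z : R => z) t 1 1 tN0 (is_derive_id _ _).
    by rewrite /GRing.scale/= mulr1.
  have dP := is_derive1_comp (is_derive_poly P t^-1) dV.
  have dE := @is_derive1_comp _ expR (fun z : R => - z^-1) t _ _ (is_derive_expR (- t^-1)) (is_deriveN dV).
  have := is_deriveM dP dE; set D := (X in is_derive _ _ _ X -> _).
  suff -> : flat ('X^2 * (P - P^`())) t = D by [].
  rewrite /D /flat t0 hornerM hornerD hornerN hornerXn /GRing.scale/= exprVn; ring.
- rewrite [flat _ 0]flat0//; apply/is_derive1_caratheodory.
  exists (flat ('X * P)); split; last by rewrite flat0.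
    move=> z; rewrite [flat _ 0]flat0// !subr0 /flat; case: ifPn => z0; last by rewrite mul0r.
    by rewrite hornerM hornerX [RHS]mulrC !mulrA mulfV ?mul1r// gt_eqF.
  have [C HC] := flat_le_lin ('X * P).
  suff H : flat ('X * P) z @[z --> (0 : R)] --> flat ('X * P) 0 by apply: H.
  rewrite [flat _ 0]flat0//; apply/cvgr0Pnorm_lt => e e0 /=.
  have C0 : 0 < `|C| + 1 by rewrite ltr_wpDl.
  near=> z.
  have z1 : `|z| < Num.min 1 (e / (`|C| + 1)).
    near: z; apply/nbhs_normP; exists (Num.min 1 (e / (`|C| + 1))).
      by rewrite /= lt_min ltr01 divr_gt0.
    by move=> z /=; rewrite sub0r normrN.
  move: z1; rewrite lt_min => /andP[z1 ze].
  have := HC z (le_trans (ler_norm _) (ltW z1)).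
  move=> /le_lt_trans; apply.
  move: ze; rewrite ltr_pdivlMr//; apply: le_lt_trans.
  by rewrite mulrC ler_wpM2l// (le_trans (ler_norm _))// lerDl.
Unshelve. all: by end_near. Qed.

Lemma flat1_ge0 t : 0 <= flat 1 t.
Proof. by rewrite /flat; case: ifP => // _; rewrite hornerC mul1r expR_ge0. Qed.

Lemma flat1_le1 t : flat 1 t <= 1.
Proof.
rewrite /flat; case: ifPn => // t0; rewrite hornerC mul1r.
by rewrite -expR0 ler_expR oppr_le0 invr_ge0 ltW.
Qed.

Lemma flat1_gt0 t : (0 < flat 1 t) = (0 < t).
Proof.
by rewrite /flat; case: ifPn; rewrite ?ltxx// => _; rewrite hornerC mul1r expR_gt0.
Qed.

Lemma flat1_homo s t : s <= t -> flat 1 s <= flat 1 t.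
Proof.
rewrite /flat; case: ifPn => s0 st; last first.
  by case: ifPn => // t0; rewrite hornerC mul1r expR_ge0.
rewrite (lt_le_trans s0 st) !hornerC !mul1r ler_expR lerN2 lef_pV2// posrE.
exact: lt_le_trans s0 st.
Qed.

End flat_function.

Section elem.
Context {R : realType} {n : nat}.
Notation Rn := 'rV[R]_n.
Implicit Types f g : Rn -> R.

(** A class of explicit functions closed under products and partial derivatives
    by construction, so that its members are smooth by a plain induction
    ([elem_smooth]), without any formula for iterated derivatives. *)
Inductive elem : (Rn -> R) -> Prop :=
| elem_cst c : elem (fun=> c)
| elem_flat P a b i : elem (fun x : Rn => flat P (a * x ord0 i + b))
| elemD f g : elem f -> elem g -> elem (fun x => f x + g x)
| elemM f g : elem f -> elem g -> elem (fun x => f x * g x).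

Let continuous_flatx P (a b : R) i : continuous (fun x : Rn => flat P (a * x ord0 i + b)).
Proof.
move=> x.
have Hx : (fun y : Rn => y ord0 i) @ x --> x ord0 i by exact: coord_continuous.
have H1 : (fun y : Rn => a * y ord0 i + b) @ x --> a * x ord0 i + b.
  exact: (cvgD (cvgM (cvg_cst a) Hx) (cvg_cst b)).
apply: (@cvg_comp _ _ _ _ (flat P) _ _ _ H1).
apply: differentiable_continuous; apply/derivable1_diffP.
by have [] := is_derive_flat P (a * x ord0 i + b).
Qed.

Let is_derive_flatx P (a b : R) i k (x : Rn) :
  is_derive x (e_ k) (fun x : Rn => flat P (a * x ord0 i + b))
    (a * (i == k)%:R * flat ('X^2 * (P - P^`())) (a * x ord0 i + b)).
Proof.
set u := a * x ord0 i + b; set a' := a * (i == k)%:R.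
have e : (fun h : R => h^-1 *: ((fun x : Rn => flat P (a * x ord0 i + b)) (h *: e_ k + x) - flat P u)) =
  (fun h : R => h^-1 *: ((fun s => flat P (a' * s + u)) (h *: (1 : R) + 0) - (fun s => flat P (a' * s + u)) 0)).
  apply/funext => h; rewrite mulr0 add0r addr0; congr (_ *: (flat P _ - _)).
  rewrite !mxE /= /u /a' mulrDr -addrA; congr (_ + _).
  rewrite /GRing.scale/= mulr1 -mulrA; congr (_ * _).
  by rewrite mulrC.
have H : is_derive (0 : R) 1 (fun s : R => flat P (a' * s + u))
    (a' * flat ('X^2 * (P - P^`())) u).
  have d1 : is_derive (0 : R) 1 (fun s : R => a' * s + u) a'.
    have := @is_deriveD _ _ _ _ _ _ _ _ _ (is_deriveZ a' (is_derive_id (0 : R) (1 : R))) (is_derive_cst u (0:R) (1:R)).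
    by rewrite addr0 /GRing.scale/= mulr1.
  have := @is_derive1_comp _ (flat P) (fun s : R => a' * s + u) 0 _ _ _ d1.
  rewrite mulr0 add0r mulrC; apply; exact: is_derive_flat.
have [d1 d2] := H.
by apply: DeriveDef; [rewrite /derivable e; exact: d1|rewrite /derive e; exact: d2].
Qed.

Lemma elem_calculus f : elem f -> continuous f /\
  forall k, (forall x, derivable f x (e_ k)) /\ elem (dpartial k f).
Proof.
elim => {f} [c|P a b i|f g ef [cf df] eg [cg dg]|f g ef [cf df] eg [cg dg]].
- split; first by move=> x; exact: (@cst_continuous Rn R c x).
  move=> k; split; first by move=> x; exact: (@derivable_cst _ _ _ (c : R)).
  have -> : dpartial k (fun=> c : R) = (fun=> 0).
    by apply/funext => x; rewrite /dpartial derive_cst.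
  exact: elem_cst.
- split; first exact: continuous_flatx.
  move=> k; split; first by move=> x; have [] := is_derive_flatx P a b i k x.
  have -> : dpartial k (fun x : Rn => flat P (a * x ord0 i + b)) =
    (fun x => a * (i == k)%:R * flat ('X^2 * (P - P^`())) (a * x ord0 i + b)).
    by apply/funext => x; have [] := is_derive_flatx P a b i k x.
  by apply: elemM; [exact: elem_cst|exact: elem_flat].
- split; first by move=> x; exact: (cvgD (cf x) (cg x)).
  move=> k; have [dfk efk] := df k; have [dgk egk] := dg k; split.
    by move=> x; exact: derivableD.
  have -> : dpartial k (fun x => f x + g x) = (fun x => dpartial k f x + dpartial k g x).
    by apply/funext => x; rewrite /dpartial deriveD.
  exact: elemD.
- split; first by move=> x; exact: (cvgM (cf x) (cg x)).
  move=> k; have [dfk efk] := df k; have [dgk egk] := dg k; split.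
    by move=> x; exact: derivableM.
  have -> : dpartial k (fun x => f x * g x) =
      (fun x => f x * dpartial k g x + g x * dpartial k f x).
    by apply/funext => x; rewrite /dpartial deriveM.
  by apply: elemD; apply: elemM.
Qed.

Lemma elem_smooth f : elem f -> smooth f.
Proof.
move=> ef s /=.
have : elem (foldr dpartial f s).
  by elim: s => //= k s /elem_calculus[_ /(_ k)[]].
by move=> /elem_calculus[? H]; split => // k x; have [+ _] := H k; exact.
Qed.

Lemma smooth_C1 f : smooth f -> C1 f.
Proof.
move=> sf; have [cf df] := sf [::]; split => // k; split; first exact: df.
by have [+ _] := sf [:: k].
Qed.

Lemma elemX f m : elem f -> elem (fun x => f x ^+ m).
Proof.
move=> ef; elim: m => [|m IH].
  under eq_fun do rewrite expr0; exact: elem_cst.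
under eq_fun do rewrite exprS; exact: elemM.
Qed.

Lemma elem_prod (I : Type) (s : seq I) (F : I -> Rn -> R) :
  (forall i, elem (F i)) -> elem (fun x => \prod_(i <- s) F i x).
Proof.
move=> eF; elim: s => [|i s IH].
  under eq_fun do rewrite big_nil; exact: elem_cst.
under eq_fun do rewrite big_cons; exact: elemM.
Qed.

Definition bump (c : Rn) (e : R) (x : Rn) : R :=
  \prod_(i < n) (flat 1 (x ord0 i - c ord0 i + e) * flat 1 (e - (x ord0 i - c ord0 i))).

Lemma elem_bump c e : elem (bump c e).
Proof.
apply: elem_prod => i; apply: elemM.
  have := elem_flat 1 1 (e - c ord0 i) i.
  by congr elem; apply/funext => x; congr flat; ring.
have := elem_flat 1 (-1) (e + c ord0 i) i.
by congr elem; apply/funext => x; congr flat; ring.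
Qed.

Lemma bump_ge0 c e x : 0 <= bump c e x.
Proof. by apply: prodr_ge0 => i _; rewrite mulr_ge0// flat1_ge0. Qed.

Lemma bump_le1 c e x : bump c e x <= 1.
Proof.
suff /andP[] : 0 <= bump c e x <= 1 by [].
apply: (big_ind (fun y => 0 <= y <= 1)) => [|y z /andP[y0 y1] /andP[z0 z1]|i _].
- by rewrite ler01 lexx.
- by rewrite mulr_ge0//= mulr_ile1.
- by rewrite mulr_ge0 ?flat1_ge0//= mulr_ile1 ?flat1_ge0 ?flat1_le1.
Qed.

Lemma bump_gt0 c e x : (0 < bump c e x) <-> cube c e x.
Proof.
have E i : (0 < flat 1 (x ord0 i - c ord0 i + e) * flat 1 (e - (x ord0 i - c ord0 i))) =
    (`|x ord0 i - c ord0 i| < e).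
  rewrite lt0r mulr_ge0 ?flat1_ge0// andbT mulf_eq0 negb_or.
  have fE (t : R) : (flat 1 t != 0) = (0 < t) by rewrite -flat1_gt0 lt0r flat1_ge0 andbT.
  by rewrite !fE subr_gt0 ltr_norml -ltrBlDr sub0r.
split => [H i|H]; last by apply: prodr_gt0 => i _; rewrite E.
rewrite -E lt0r mulr_ge0 ?flat1_ge0// andbT; apply/negP => /eqP j0.
by move: H; rewrite /bump (bigD1 i)//= j0 mul0r ltxx.
Qed.

Lemma bump_half c e (x : Rn) : 0 < e -> cube c (e / 2) x ->
  (flat 1 (e / 2)) ^+ (n + n) <= bump c e x.
Proof.
move=> e0 H; rewrite exprD -exprMn -[X in _ ^+ X](card_ord n) -prodr_const.
apply: ler_prod => i _; rewrite mulr_ge0 ?flat1_ge0//=.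
have := H i; rewrite ltr_norml => /andP[h1 h2].
by apply: ler_pM; rewrite ?flat1_ge0//; apply: flat1_homo; lra.
Qed.

Lemma closure_supp (f : Rn -> R) c e : (forall x, ~ cube c e x -> f x = 0) ->
  closure [set x | f x != 0] `<=` ccube c e.
Proof.
move=> f0; have cl : closed (ccube c e).
  by apply: compact_closed; [exact: norm_hausdorff|exact: compact_ccube].
move/closure_id : cl => ->; apply: closure_subset => x /= fx i.
by apply: contrapT => /negP; rewrite -ltNge => xi; move/eqP: fx; apply; apply: f0 => /(_ i)/ltW; rewrite leNgt xi.
Qed.

Lemma elem_test_fun Omega (f : Rn -> R) c e : elem f ->
  (forall x, ~ cube c e x -> f x = 0) -> ccube c e `<=` Omega -> test_fun Omega f.
Proof.
move=> ef f0 cO; have H := closure_supp f0; split.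
- exact: elem_smooth.
- apply: subclosed_compact H; [exact: closed_closure|exact: compact_ccube].
- exact: subset_trans H cO.
Qed.

Lemma test_fun_bsupp Omega (f : Rn -> R) : test_fun Omega f -> bsupp f.
Proof.
move=> [_ /compact_bounded[M [Mr HM]] _].
exists (`|M| + 2) => x [i xi]; apply: contrapT => /eqP fx.
have xc : closure [set x | f x != 0] x by exact: subset_closure.
have /= := HM (`|M| + 1) _ x xc.
have -> : M < `|M| + 1 by rewrite (le_lt_trans (ler_norm M))// ltrDl.
move=> /(_ isT) xM.
have : cube (0 : Rn) (`|M| + 2) x.
  rewrite -ball_cube ?ltr_wpDl// -ball_normE /ball_/= sub0r normrN.
  by rewrite (le_lt_trans xM)// ltrD2l ltr1n.
by move=> /(_ i); rewrite mxE subr0 ltNge xi.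
Qed.

End elem.

(** * The fundamental lemma of the calculus of variations *)
Section fundamental_lemma.
Context {R : realType} {n : nat}.
Notation Rn := 'rV[R]_n.
Local Notation L := (lebesgueRn R n).
Local Notation mu := (@product_lebesgue R n).
Local Notation leb := (@leb R n).

(** The intersection of Borel covers of A whose measures tend to the outer measure
    of A. *)
Lemma borel_hull (A : set L) : measurable A -> (leb A < +oo)%E ->
  exists B : set Rn, [/\ measurable B, A `<=` B & leb (B `\` A) = 0%E].
Proof.
move=> mA Aoo.
have Af : leb A \is a fin_num by rewrite ge0_fin_numE.
have /choice[F HF] : forall m, exists F : (set Rn)^nat, @measurable_cover _ Rn A F /\
    (\sum_(k <oo) mu (F k) < leb A + (m.+1%:R^-1)%:E)%E.
  move=> m.
  have m0 : (0 < m.+1%:R^-1 :> R)%R by rewrite invr_gt0.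
  have [_ [F cF <-] HF] := lb_ereal_inf_adherent m0 Af.
  exists F; split; [exact: cF|exact: HF].
pose C m := \bigcup_k F m k.
have mC m : measurable (C m) by apply: bigcup_measurable => k _; have [[+ _] _] := HF m; exact.
have mB : measurable (\bigcap_m C m) by exact: bigcapT_measurable.
have AB : A `<=` \bigcap_m C m by move=> x Ax m _; have [[_ +] _] := HF m; exact.
have Ble m : (leb (\bigcap_m C m) <= leb A + (m.+1%:R^-1)%:E)%E.
  have [[mF AF] /ltW FA] := HF m; apply: le_trans FA.
  apply: (@le_trans _ _ (mu (C m))).
    rewrite leb_borel// le_measure ?inE//; exact: bigcap_inf.
  exact: measure_sigma_subadditive.
exists (\bigcap_m C m); split => //.
have mBL : measurable (\bigcap_m C m : set L) by exact: borel_lebesgue.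
have BA : (leb (\bigcap_m C m) <= leb A)%E.
  apply/lee_addgt0Pr => e e0.
  have [m _ /(_ m (leqnn m)) /= me] := near_infty_natSinv_lt (PosNum e0).
  by apply: (le_trans (Ble m)); rewrite leeD2l// lee_fin ltW.
rewrite measureD//=; last by rewrite (le_lt_trans BA).
rewrite setIidr// (_ : leb (\bigcap_m C m) = leb A) ?subee//.
by apply/eqP; rewrite eq_le BA le_measure ?inE.
Qed.

(** The Borel sets are reached from these sets by the pi-lambda theorem: they are
    stable under intersection and contain the cubes. *)
Definition elem_sets : set (set Rn) :=
  [set A | exists f, [/\ elem f, forall x, 0 <= f x <= 1 & A = [set x | 0 < f x]]].

Lemma elem_sets_setI : setI_closed elem_sets.
Proof.
move=> _ _ [f [ef f01 ->]] [g [eg g01 ->]]; exists (fun x => f x * g x); split.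
- exact: elemM.
- move=> x; have /andP[f0 f1] := f01 x; have /andP[g0 g1] := g01 x.
  by rewrite mulr_ge0//= mulr_ile1.
apply/seteqP; split => x /=; have /andP[f0 f1] := f01 x; have /andP[g0 g1] := g01 x.
  by move=> [? ?]; rewrite mulr_gt0.
by rewrite !lt0r mulf_eq0 negb_or f0 g0 !andbT => /andP[/andP[]].
Qed.

Lemma elem_sets_cube c e : elem_sets (cube c e).
Proof.
exists (bump c e); split; first exact: elem_bump.
  by move=> x; rewrite bump_ge0 bump_le1.
by apply/seteqP; split => x /bump_gt0.
Qed.

Lemma elem_sets_gen : (measurable : set (set Rn)) = <<s elem_sets >>.
Proof.
apply/seteqP; split; last first.
  apply: smallest_sub; first exact: sigma_algebra_measurable.
  move=> _ [f [/elem_calculus[/continuousP cf _] _ ->]].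
  apply: open_measurable_rV.
  rewrite (_ : [set _ | _] = f @^-1` `]0, +oo[%classic); first exact/cf/interval_open.
  by apply/seteqP; split => x /=; rewrite in_itv/= andbT.
apply: smallest_sub; first exact: smallest_sigma_algebra.
move=> A; rewrite -bigcup_seq/= => -[i _ [B mB <-]]; rewrite setTI.
have mf : measurable_fun (setT : set (g_sigma_algebraType elem_sets))
    ((fun x => x ord0 i) : g_sigma_algebraType elem_sets -> measurableTypeR R).
  apply: (measurability _ (RGenOpens.measurableE R)).
  move=> _ [_ [a [b ->] <-]]; rewrite setTI.
  have o : open ((fun x : Rn => x ord0 i) @^-1` `]a, b[%classic).
    by have /continuousP := @coord_continuous R 1 n ord0 i; apply; exact: interval_open.
  have [D [c [e [_ _]]]] := open_bigcup_cube o.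
  rewrite /preimage/= => ->; apply: bigcup_measurable => k _.
  by apply: sub_sigma_algebra; exact: elem_sets_cube.
by have := mf measurableT B mB; rewrite setTI.
Qed.

Section on_cube.
Variables (Omega : set Rn) (w : Rn -> R) (c : Rn) (e : R).
Hypothesis cO : ccube c e `<=` Omega.
Hypothesis iw : leb.-integrable (ccube c e : set L) (EFin \o w).
Hypothesis w0 : forall chi, test_fun Omega chi ->
  (\int[leb]_(x in (Omega : set L)) (w x * chi x) = 0)%R.

Let mcc : measurable (ccube c e : set L).
Proof. by apply: borel_lebesgue; exact: measurable_ccube. Qed.

Let mc : measurable (cube c e : set L).
Proof. by apply: borel_lebesgue; exact: measurable_cube. Qed.

Let cc : cube c e `<=` ccube c e.
Proof. by move=> x H i; exact/ltW/H. Qed.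

Let mw : measurable_fun (ccube c e : set L) w.
Proof. by apply/measurable_EFinP; have /integrableP[] := iw. Qed.

(** The functions f here vanish off a cube whose closure is inside Omega, hence
    are test functions. *)
Let test_int0 (f : Rn -> R) : elem f -> (forall x, 0 <= f x <= 1) ->
  (forall x, ~ cube c e x -> f x = 0) ->
  (\int[leb]_(x in (ccube c e : set L)) (w x * f x)%:E = 0)%E.
Proof.
move=> ef f01 f0.
have := w0 (elem_test_fun ef f0 cO).
have mf : measurable_fun setT (f : L -> measurableTypeR R).
  apply: measurable_borel_lebesgue; apply: continuous_measurable_rV.
  by have [] := elem_calculus ef.
have -> : (\int[leb]_(x in (Omega : set L)) (w x * f x) =
           fine (\int[leb]_(x in (ccube c e : set L)) (w x * f x)%:E))%R.
  rewrite /Rintegral; congr fine.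
  rewrite integral_mkcond [RHS]integral_mkcond; apply: eq_integral => x _.
  rewrite !patchE.
  have [xc|xc] := boolP (x \in (ccube c e : set L)).
    by rewrite ifT//; apply/mem_set/cO/set_mem.
  rewrite f0 ?mulr0 ?if_same//; move/negP : xc; apply: contra_not => xc.
  exact/mem_set/cc.
have : leb.-integrable (ccube c e : set L) (fun x => (w x * f x)%:E).
  apply: le_integrable iw => //.
    by apply/measurable_EFinP; apply: measurable_funM => //; exact: measurable_funTS.
  move=> x _; rewrite lee_fin normrM ler_piMr//.
  by have /andP[f00 f1] := f01 x; rewrite ger0_norm.
move=> /(integrable_fin_num mcc) fn H.
by rewrite -(fineK fn) H.
Qed.

Let set_int0 A : elem_sets A ->
  (\int[leb]_(x in (cube c e `&` A : set L)) (w x)%:E = 0)%E.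
Proof.
move=> [f [ef f01 ->]].
pose b x := bump c e x * f x.
have b01 x : 0 <= b x <= 1.
  have /andP[f0 f1] := f01 x.
  by rewrite mulr_ge0 ?bump_ge0//= mulr_ile1 ?bump_ge0 ?bump_le1.
have eb : elem b by apply: elemM => //; exact: elem_bump.
have b0 x : ~ cube c e x -> b x = 0.
  move=> xc; rewrite /b (_ : bump c e x = 0) ?mul0r//.
  apply/eqP; rewrite eq_le bump_ge0 andbT leNgt; apply/negP => /bump_gt0; exact: xc.
(* chi m is in the class, and increases to the indicator function of {b > 0} *)
pose chi m x := 1 - (1 - b x) ^+ m.
have echi m : elem (chi m).
  have e1 : elem (fun x => 1 - b x).
    have := elemD (elem_cst 1) (elemM (elem_cst (-1)) eb).
    by congr elem; apply/funext => x; rewrite mulN1r.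
  have := elemD (elem_cst 1) (elemM (elem_cst (-1)) (elemX m e1)).
  by congr elem; apply/funext => x; rewrite mulN1r.
have chi01 m x : 0 <= chi m x <= 1.
  have /andP[b0' b1] := b01 x.
  have h0 : 0 <= (1 - b x) ^+ m <= 1 by rewrite exprn_ge0 ?exprn_ile1 ?subr_ge0//; lra.
  rewrite /chi; lra.
have chi0 m x : ~ cube c e x -> chi m x = 0.
  by move=> /b0; rewrite /chi => ->; rewrite subr0 expr1n subrr.
have H m : (\int[leb]_(x in (ccube c e : set L)) (w x * chi m x)%:E = 0)%E.
  exact: (test_int0 (echi m) (chi01 m) (chi0 m)).
pose B : set Rn := [set x | 0 < b x].
have BE : B = cube c e `&` [set x | 0 < f x].
  apply/seteqP; split => x /=.
    have /andP[f0 _] := f01 x.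
    rewrite /B /b /= lt0r mulf_eq0 negb_or => /andP[/andP[h1 h2] _]; split.
      by apply/bump_gt0; rewrite lt0r h1 bump_ge0.
    by rewrite lt0r h2.
  by move=> [/bump_gt0 h1 h2]; rewrite /B /b/= mulr_gt0.
rewrite -BE.
have mB : measurable (B : set L).
  apply: borel_lebesgue; rewrite elem_sets_gen; apply: sub_sigma_algebra.
  by exists b.
have Bc : B `<=` ccube c e by rewrite BE => x [/cc].
have cvgchi x : chi m x @[m --> \oo] --> (\1_B x : R).
  rewrite indicE; have [xB|xB] := boolP (x \in B).
    rewrite -[X in _ --> X]subr0; apply: cvgB; first exact: cvg_cst.
    apply: cvg_expr; have /andP[? ?] := b01 x.
    have bx : 0 < b x := set_mem xB.
    by rewrite ger0_norm ?subr_ge0// ltrBlDr ltrDl.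
  have -> : chi^~ x = (fun=> 0).
    apply/funext => m; rewrite /chi (_ : b x = 0) ?subr0 ?expr1n ?subrr//.
    have /andP[? ?] := b01 x.
    by apply/eqP; rewrite eq_le; apply/andP; split => //; rewrite leNgt; apply/negP => bx; move/negP: xB; apply; exact/mem_set.
  exact: cvg_cst.
have mchi m : measurable_fun setT (chi m : L -> measurableTypeR R).
  apply: measurable_borel_lebesgue; apply: continuous_measurable_rV.
  by have [] := elem_calculus (echi m).
have mf m : measurable_fun (ccube c e : set L) (fun x => (w x * chi m x)%:E).
  apply/measurable_EFinP; apply: measurable_funM => //.
  by apply: (measurable_funTS (mchi m)).
have mf1 : measurable_fun (ccube c e : set L) (fun x => (w x * \1_B x)%:E).
  by apply/measurable_EFinP; apply: measurable_funM => //; apply: measurable_funTS; exact: measurable_indic.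
have f_f : {ae leb, forall x, (ccube c e : set L) x ->
    (fun m => (w x * chi m x)%:E) @ \oo --> (w x * \1_B x)%:E}.
  apply/aeW => x _; apply: cvg_EFin; first exact: nearW.
  exact: (cvgM (cvg_cst (w x)) (cvgchi x)).
have ig : leb.-integrable (ccube c e : set L) (fun x => `|(w x)%:E|%E).
  exact: integrable_abse.
have f_g : {ae leb, forall x m, (ccube c e : set L) x ->
    (`|(w x * chi m x)%:E| <= `|(w x)%:E|)%E}.
  apply/aeW => x m _; rewrite lee_fin normrM ler_piMr//.
  by have /andP[? ?] := chi01 m x; rewrite ger0_norm.
have [_ _] := dominated_convergence mcc mf mf1 f_f ig f_g.
under eq_fun do rewrite H.
move=> /cvg_lim; rewrite lim_cst// => /(_ (@ereal_hausdorff _)) E0.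
transitivity (\int[leb]_(x in (ccube c e : set L)) (w x * \1_B x)%:E)%E; last by rewrite -E0.
rewrite integral_mkcond [RHS]integral_mkcond; apply: eq_integral => x _.
rewrite !patchE indicE.
have [xB|xB] := boolP (x \in B).
  by rewrite mem_set ?mulr1//; exact/Bc/set_mem.
by rewrite mulr0 if_same.
Qed.

Let Pset (A : set Rn) : Prop := (\int[leb]_(x in (cube c e `&` A : set L)) (w x)%:E = 0)%E.

Let iwc : leb.-integrable (cube c e : set L) (EFin \o w).
Proof. exact: integrableS iw. Qed.

Let borel_int0 (A : set Rn) : measurable A -> Pset A.
Proof.
rewrite {1}elem_sets_gen.
have PT : Pset setT.
  apply: set_int0; exists (fun=> 1); split; first exact: elem_cst.
    by move=> x; rewrite ler01 lexx.
  by apply/seteqP; split => x //= _; exact: ltr01.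
apply: (dynkin_induction elem_sets_gen elem_sets_setI PT).
- exact: set_int0.
- move=> S mS PS; rewrite /Pset.
  have mS' : measurable (S : set L) by exact: borel_lebesgue.
  move: PT; rewrite /Pset -(setUv S) setIUr integral_setU.
  + by move: PS; rewrite /Pset => ->; rewrite add0e.
  + exact: measurableI.
  + by apply: measurableI => //; exact: measurableC.
  + rewrite -setIUr setUv setIT; exact: (measurable_int _ iwc).
  + by apply/disj_setPS => x [[_ Sx] [_ nSx]].
- move=> F mF tF PF; rewrite /Pset setI_bigcupr integral_bigcup.
  + by rewrite eseries0// => i _ _; exact: PF.
  + exact: trivIset_setIl.
  + by move=> k; apply: measurableI => //; exact: borel_lebesgue.
  + rewrite -setI_bigcupr; apply: integrableS iwc => //.
    apply: measurableI => //; apply: borel_lebesgue; exact: bigcup_measurable.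
Qed.

(** The integral of w vanishes over every set of [elem_sets] by dominated
    convergence, over every Borel set by the pi-lambda theorem, and over every
    Lebesgue set because it differs from a Borel set by a null set. *)
Lemma fundamental_lemma_cube : {ae leb, forall x, (cube c e : set L) x -> w x = 0}.
Proof.
suff : ae_eq leb (cube c e : set L) (EFin \o w) (cst 0%E).
  by apply: filterS => x /[apply] -[].
apply: integral_ae_eq => // E Ec mE.
have Eoo : (leb E < +oo)%E.
  apply: le_lt_trans (mu_ccube_lty c e).
  rewrite -leb_borel; last exact: measurable_ccube.
  by rewrite le_measure ?inE//; exact: subset_trans cc.
have [B [mB EB BE0]] := borel_hull mE Eoo.
have mBL : measurable (B : set L) by exact: borel_lebesgue.
rewrite integral0 -[RHS](borel_int0 mB).
rewrite [LHS]integral_mkcond [RHS]integral_mkcond.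
apply: ae_eq_integral => //.
- exact: (iffLR (measurable_restrictT _ mE) (measurable_funS mc Ec (measurable_int _ iwc))).
- have mcB : measurable (cube c e `&` B : set L) by exact: measurableI.
  exact: (iffLR (measurable_restrictT _ mcB)
    (measurable_funS mc (@subIsetl _ _ _) (measurable_int _ iwc))).
exists (B `\` E); split => //; first exact: measurableD.
move=> x /=; apply: contra_notP => xBE _.
rewrite !patchE; have [xE|xE] := boolP (x \in E).
  by rewrite mem_set//; split; [exact/Ec/set_mem|exact/EB/set_mem].
rewrite memNset// => -[xc xB]; apply: xBE; split => //.
by move/negP: xE; apply: contra_not; exact: mem_set.
Qed.

End on_cube.

(** Omega is a countable union of cubes with closure in Omega. *)
Lemma fundamental_lemma (Omega : set Rn) (w : Rn -> R) : open Omega -> L1loc Omega w ->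
  (forall chi, test_fun Omega chi ->
    (\int[leb]_(x in (Omega : set L)) (w x * chi x) = 0)%R) ->
  {ae leb, forall x, Omega x -> w x = 0}.
Proof.
move=> oO wl w0.
have [D [c [e [e0 cO OE]]]] := open_bigcup_cube oO.
have H k : {ae leb, forall x, D k -> cube (c k) (e k) x -> w x = 0}.
  have [Dk|nDk] := pselect (D k); last exact/aeW.
  have iw := wl _ (@compact_ccube R n (c k) (e k)) (cO _ Dk).
  have := fundamental_lemma_cube (cO _ Dk) iw w0.
  by apply: filterS => x Hx _.
have := ae_foralln H.
apply: filterS => x Hx; rewrite OE => -[k Dk xk]; exact: Hx Dk xk.
Qed.

End fundamental_lemma.

(** * Weak derivatives and test functions *)
Section weak.
Context {R : realType} {n : nat}.
Notation Rn := 'rV[R]_n.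
Local Notation L := (lebesgueRn R n).
Local Notation mu := (@product_lebesgue R n).
Local Notation leb := (@leb R n).
Variable Omega : set Rn.
Hypothesis oO : open Omega.

Let mO : measurable (Omega : set L).
Proof. by apply: borel_lebesgue; exact: open_measurable_rV. Qed.

Lemma compact_measurable_rV (K : set Rn) : compact K -> measurable K.
Proof.
move=> cK; rewrite -[K]setCK; apply: measurableC; apply: open_measurable_rV.
by rewrite openC; apply: compact_closed => //; exact: norm_hausdorff.
Qed.

Lemma bounded_ccube (A : set Rn) : bounded_set A -> exists e : R, 0 < e /\ A `<=` cube 0 e.
Proof.
move=> [M [Mr HM]]; exists (`|M| + 2); split; first by rewrite ltr_wpDl.
move=> x Ax; have /= := HM (`|M| + 1) _ x Ax.
have -> : M < `|M| + 1 by rewrite (le_lt_trans (ler_norm M))// ltrDl.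
move=> /(_ isT) xM.
rewrite -ball_cube ?ltr_wpDl// -ball_normE /ball_/= sub0r normrN.
by rewrite (le_lt_trans xM)// ltrD2l ltr1n.
Qed.

Lemma bounded_leb_lty (A : set Rn) : measurable (A : set L) -> bounded_set A ->
  (leb (A : set L) < +oo)%E.
Proof.
move=> mA /bounded_ccube[e [e0 Ae]].
apply: le_lt_trans (mu_ccube_lty (0 : Rn) e).
rewrite -leb_borel; last exact: measurable_ccube.
rewrite le_measure ?inE//; first by apply: borel_lebesgue; exact: measurable_ccube.
by move=> x /Ae xe i; exact/ltW/xe.
Qed.

Definition Cc (g : Rn -> R) := continuous g /\
  exists K : set Rn, [/\ compact K, K `<=` Omega & forall x, ~ K x -> g x = 0].

Lemma Cc_bounded g : Cc g -> exists M : R, forall x, `|g x| <= M.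
Proof.
move=> [cg [K [cK _ g0]]].
have : compact (g @` K).
  by apply: continuous_compact => //; exact: continuous_subspaceT.
move=> /compact_bounded[M [Mr HM]].
exists (`|M| + 1) => x.
have [Kx|nKx] := pselect (K x).
  apply: HM; last by exists x.
  by rewrite (le_lt_trans (ler_norm M))// ltrDl.
by rewrite g0// normr0 addr_ge0.
Qed.

Lemma measurable_continuous_L (g : Rn -> R) : continuous g ->
  measurable_fun setT (g : L -> R).
Proof. by move=> cg; apply: measurable_borel_lebesgue; exact: continuous_measurable_rV. Qed.

Lemma Cc_integrable f g : L1loc Omega f -> Cc g ->
  leb.-integrable (Omega : set L) (fun x => (f x * g x)%:E).
Proof.
move=> fl Cg; have [M HM] := Cc_bounded Cg; have [cg [K [cK KO g0]]] := Cg.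
have mK : measurable (K : set L) by apply: borel_lebesgue; exact: compact_measurable_rV.
have iK : leb.-integrable (K : set L) (fun x => (f x * g x)%:E).
  apply: (@le_integrable _ _ _ _ _ mK _ (fun x => M%:E * (f x)%:E)%E).
  - apply/measurable_EFinP; apply: measurable_funM.
      by have /measurable_int/measurable_EFinP := fl K cK KO.
    exact/measurable_funTS/measurable_continuous_L.
  - move=> x _; rewrite -EFinM lee_fin normrM normrM mulrC ler_wpM2r//.
    by rewrite (le_trans (HM x))// ler_norm.
  - by apply: integrableZl => //; exact: fl.
apply/(integrable_mkcond _ mO).
have -> : (fun x => (f x * g x)%:E) \_ Omega = ((fun x => (f x * g x)%:E) \_ K).
  apply/funext => x; rewrite !patchE.
  have [xK|xK] := boolP (x \in K); first by rewrite mem_set//; apply: KO; exact: set_mem.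
  rewrite g0 ?mulr0 ?if_same//; move/negP: xK; apply: contra_not; exact: mem_set.
exact/(integrable_mkcond _ mK).
Qed.

Lemma continuous_L1loc f : continuous f -> L1loc Omega f.
Proof.
move=> cf K cK KO; have mK : measurable (K : set L) by apply: borel_lebesgue; exact: compact_measurable_rV.
apply: measurable_bounded_integrable => //.
- apply: bounded_leb_lty => //; exact: compact_bounded.
- exact/measurable_funTS/measurable_continuous_L.
- have : compact (f @` K) by apply: continuous_compact => //; exact: continuous_subspaceT.
  by move=> /compact_bounded[M [Mr HM]]; exists M; split => // x Mx y Ky; apply: HM => //; exists y.
Qed.

Lemma test_Cc chi : test_fun Omega chi -> Cc chi.
Proof.
move=> [s cs sO]; split; first by have [] := s [::].
exists (closure [set x | chi x != 0]); split => // x xc; apply/eqP; apply: contrapT => cx.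
by apply: xc; apply: subset_closure; exact/negP.
Qed.

Lemma test_dpartial_Cc chi k : test_fun Omega chi -> Cc (dpartial k chi).
Proof.
move=> [s cs sO]; split; first by have [] := s [:: k].
exists (closure [set x | chi x != 0]); split => // x xc.
rewrite /dpartial (@near_eq_derive _ _ _ _ (cst 0)) ?derive_cst//.
have : open (~` closure [set x | chi x != 0]) by rewrite openC; exact: closed_closure.
rewrite openE => /(_ x xc); apply: filterS => y yc; apply/eqP; apply: contrapT => cy.
by apply: yc; apply: subset_closure; exact/negP.
Qed.

Lemma test_C1 chi : test_fun Omega chi -> C1 chi.
Proof. by move=> [s _ _]; exact: smooth_C1. Qed.

(** The product psi chi has compact support, so its partial derivative has
    integral zero ([integral_dpartial0]). *)
Lemma test_by_parts psi chi k : test_fun Omega psi -> test_fun Omega chi ->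
  (\int[leb]_(x in (Omega : set L)) (psi x * dpartial k chi x) =
   - \int[leb]_(x in (Omega : set L)) (dpartial k psi x * chi x))%R.
Proof.
move=> tp tc.
have Cp := test_Cc tp; have Cdp := test_dpartial_Cc k tp.
have Cc_ := test_Cc tc; have Cdc := test_dpartial_Cc k tc.
have i1 : leb.-integrable (Omega : set L) (fun x => (psi x * dpartial k chi x)%:E).
  apply: Cc_integrable => //; apply: continuous_L1loc; exact: Cp.1.
have i2 : leb.-integrable (Omega : set L) (fun x => (dpartial k psi x * chi x)%:E).
  apply: Cc_integrable => //; apply: continuous_L1loc; exact: Cdp.1.
apply/eqP; rewrite -subr_eq0 opprK -RintegralD//; apply/eqP.
have bs : bsupp (fun x => psi x * chi x).
  have [M HM] := test_fun_bsupp tp.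
  by exists M => x /HM ->; rewrite mul0r.
have cc := C1M (test_C1 tp) (test_C1 tc).
have [cD dD] := cc; have [_ cdD] := dD k.
have := integral_dpartial0 k cc bs.
set D := dpartial k _ => E0.
have DE x : D x = psi x * dpartial k chi x + dpartial k psi x * chi x.
  rewrite /D dpartialM; [|exact: test_C1|exact: test_C1].
  by rewrite [chi x * _]mulrC.
under eq_Rintegral do rewrite -DE.
rewrite /Rintegral integral_mkcond.
have -> : (fun x => (D x)%:E) \_ Omega = (fun x => (D x)%:E).
  apply/funext => x; rewrite patchE; case: ifPn => // xO.
  have nO : ~ Omega x by move/negP: xO; apply: contra_not; exact: mem_set.
  rewrite DE; have [_ [K [_ KO ->]]] := Cdc; last by move=> /KO.
  by have [_ [K' [_ KO' ->]]] := Cdp; [rewrite mulr0 mul0r addr0|move=> /KO'].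
have mD := measurable_continuous_L cdD.
rewrite integralE.
have -> : (\int[leb]_x ((fun x => (D x)%:E)^\+ x) = \int[mu]_x (Num.max (D x) 0)%:E)%E.
  rewrite -integral_leb.
  - by apply: eq_integral => x _; rewrite funeposE EFin_max.
  - by apply/measurable_EFinP; apply: measurable_maxr => //; exact: continuous_measurable_rV.
  - by move=> x; rewrite lee_fin le_max lexx orbT.
have -> : (\int[leb]_x ((fun x => (D x)%:E)^\- x) = \int[mu]_x (Num.max (- D x) 0)%:E)%E.
  rewrite -integral_leb.
  - by apply: eq_integral => x _; rewrite funenegE EFin_max.
  - apply/measurable_EFinP; apply: measurable_maxr => //; apply: measurableT_comp => //.
    exact: continuous_measurable_rV.
  - by move=> x; rewrite lee_fin le_max lexx orbT.
rewrite -E0; set I := (\int[_]_x _)%E.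
have : (0 <= I)%E by apply: integral_ge0 => x _; rewrite lee_fin le_max lexx orbT.
by case: I => [r| |]//= _; rewrite subrr.
Qed.

Lemma is_weak_partial_test k psi : test_fun Omega psi ->
  is_weak_partial Omega k psi (dpartial k psi).
Proof.
move=> tp; split.
- by apply: continuous_L1loc; have [] := test_Cc tp.
- by apply: continuous_L1loc; have [] := test_dpartial_Cc k tp.
- by move=> chi tc; exact: test_by_parts.
Qed.

Lemma L1locB f g : L1loc Omega f -> L1loc Omega g -> L1loc Omega (fun x => f x - g x).
Proof.
move=> fl gl K cK KO; have mK : measurable (K : set L) by apply: borel_lebesgue; exact: compact_measurable_rV.
have := @integrableB _ _ _ leb K mK _ _ (fl K cK KO) (gl K cK KO).
exact.
Qed.

Lemma is_weak_partialB k u1 u2 v1 v2 : is_weak_partial Omega k u1 v1 ->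
  is_weak_partial Omega k u2 v2 ->
  is_weak_partial Omega k (fun x => u1 x - u2 x) (fun x => v1 x - v2 x).
Proof.
move=> [u1l v1l H1] [u2l v2l H2]; split; [exact: L1locB|exact: L1locB|].
move=> chi tc; have Cc_ := test_Cc tc; have Cdc := test_dpartial_Cc k tc.
under eq_Rintegral do rewrite mulrBl.
under [in RHS]eq_Rintegral do rewrite mulrBl.
rewrite !RintegralB//; try exact: Cc_integrable.
by rewrite H1// H2// opprB opprK addrC.
Qed.

Lemma weak_partialP k u v : is_weak_partial Omega k u v ->
  is_weak_partial Omega k u (weak_partial Omega k u).
Proof. by move=> H; rewrite /weak_partial; apply: xgetPex; exists v. Qed.

Lemma ae_leb_imply (P Q : Rn -> Prop) : {ae leb, forall x, P x} ->
  (forall x, P x -> Q x) -> {ae leb, forall x, Q x}.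
Proof.
move=> [A [mA A0 PA]] PQ; exists A; split => // x /= nQ.
by apply: PA => /= /PQ.
Qed.

Lemma weak_partial_unique k u v1 v2 : is_weak_partial Omega k u v1 ->
  is_weak_partial Omega k u v2 -> {ae leb, forall x, Omega x -> v1 x = v2 x}.
Proof.
move=> [_ v1l H1] [_ v2l H2].
have := fundamental_lemma oO (L1locB v1l v2l).
have H chi : test_fun Omega chi ->
    (\int[leb]_(x in (Omega : set L)) ((v1 x - v2 x) * chi x) = 0)%R.
  move=> tc; have Cc_ := test_Cc tc.
  under eq_Rintegral do rewrite mulrBl.
  rewrite RintegralB//; try exact: Cc_integrable.
  by apply/eqP; rewrite subr_eq0 -eqr_opp -H1// -H2.
move=> /(_ H)/ae_leb_imply; apply => x Hx Ox.
by apply/eqP; rewrite -subr_eq0; apply/eqP; exact: Hx.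
Qed.

(** The weak derivative is an arbitrarily chosen representative, so it is additive
    only up to null sets. *)
Lemma dpartial_weak_partial k u v psi : is_weak_partial Omega k u v ->
  test_fun Omega psi ->
  {ae leb, forall x, Omega x -> dpartial k psi x =
    weak_partial Omega k u x - weak_partial Omega k (fun x => u x - psi x) x}.
Proof.
move=> Hu tp.
have Hp := is_weak_partial_test k tp.
have := weak_partial_unique (is_weak_partialB (weak_partialP Hu) Hp)
   (weak_partialP (is_weak_partialB Hu Hp)).
move/ae_leb_imply; apply => x Hx Ox; rewrite -(Hx Ox); ring.
Qed.

End weak.

(** * Growth of a generalized Phi-function *)
Section growth.
Context {R : realType}.
Local Notation leb1 := (@lebesgue_measure R).
Variables (f : R -> R).
Hypothesis cf : {within `[0, +oo[, continuous f}.
Hypothesis df : forall s : R, 0 < s -> derivable f s 1.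
Hypothesis f_gt0 : forall s : R, 0 < s -> 0 < f s.

Let Phi s := (\int[leb1]_(t in `[0%R, s]) f t)%R.

Let cf0s s : {within `[0, s], continuous f}.
Proof.
apply: continuous_subspaceW cf => x /=; rewrite !in_itv/= andbT.
by move=> /andP[].
Qed.

Let intf s : leb1.-integrable `[0, s] (EFin \o f).
Proof. by apply: continuous_compact_integrable => //; exact: segment_compact. Qed.

Let cfs (s : R) : 0 < s -> {for s, continuous f}.
Proof. by move=> s0; apply: differentiable_continuous; apply/derivable1_diffP/df. Qed.

Lemma is_derive_Phi (s : R) : 0 < s -> is_derive s 1 Phi (f s).
Proof.
move=> s0.
have ss : s < s + 1 by rewrite ltrDl.
have [d1 d2] := continuous_FTC1_closed ss (intf (s + 1)) s0 (cfs s0).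
by apply: DeriveDef; [exact: d1|rewrite -derive1E; exact: d2].
Qed.

Lemma Phi0 : Phi 0 = 0.
Proof. by rewrite /Phi set_itv1 Rintegral_set1. Qed.

Lemma continuous_Phi s : 0 <= s -> {within `[0, s], continuous Phi}.
Proof. by move=> s0; apply: (parameterized_integral_continuous s0 (intf s)). Qed.

Lemma Phi_gt0 (s : R) : 0 < s -> 0 < Phi s.
Proof.
move=> s0; rewrite -Phi0.
apply: (@gtr0_derive1_lt_cc _ Phi 0 s) => //.
- by move=> x; rewrite in_itv/= => /andP[x0 _]; have [] := is_derive_Phi x0.
- move=> x; rewrite in_itv/= => /andP[x0 _]; rewrite derive1E.
  by have [_ ->] := is_derive_Phi x0; exact: f_gt0.
- exact/continuous_Phi/ltW.
- by rewrite in_itv/= lexx ltW.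
- by rewrite in_itv/= lexx ltW.
Qed.

Section quotient.
Variable (p : R).
Let H s := s * f s - p * Phi s.

Let cH s : 0 <= s -> {within `[0, s], continuous H}.
Proof.
move=> s0 x.
have H1 := @continuous_Phi s s0 x.
have H2 : {within `[0, s], continuous (fun t : R => t * f t)}.
  move=> y; apply: cvgM; [|exact: cf0s].
  by apply: continuous_subspaceT; move=> z; exact: cvg_id.
apply: cvgB; first exact: H2.
by apply: cvgM; [exact: cvg_cst|exact: H1].
Qed.

Let dH (s : R) : 0 < s -> is_derive s 1 H (f s * (1 - p) + s * 'D_1 f s).
Proof.
move=> s0.
have d1 := derivableP (df s0).
have d2 := is_derive_Phi s0.
have := is_deriveB (is_deriveM (is_derive_id s 1) d1) (is_deriveM (is_derive_cst p s 1) d2).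
set D := (X in is_derive _ _ _ X -> _).
suff -> : f s * (1 - p) + s * 'D_1 f s = D by [].
rewrite /D /GRing.scale/=; ring.
Qed.

(** H(s) = s f(s) - p Phi(s) vanishes at 0, and H' = f (1 - p + s f' / f) has the
    sign given by the bound on s f' / f. *)
Lemma quotient_ge (s : R) : 0 < s -> (forall t : R, 0 < t -> p - 1 <= t * 'D_1 f t / f t) ->
  p <= s * f s / Phi s.
Proof.
move=> s0 Hp; rewrite ler_pdivlMr ?Phi_gt0// -subr_ge0.
have <- : H 0 = 0 by rewrite /H mul0r Phi0 mulr0 subrr.
apply: (@ger0_derive1_le_cc _ H 0 s) => //.
- by move=> x; rewrite in_itv/= => /andP[x0 _]; have [] := dH x0.
- move=> x; rewrite in_itv/= => /andP[x0 _]; rewrite derive1E.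
  have [_ ->] := dH x0; have := Hp x x0.
  by rewrite ler_pdivlMr ?f_gt0//; lra.
- exact/cH/ltW.
- by rewrite in_itv/= lexx ltW.
- by rewrite in_itv/= lexx ltW.
- exact: ltW.
Qed.

Lemma quotient_le (s : R) : 0 < s -> (forall t : R, 0 < t -> t * 'D_1 f t / f t <= p - 1) ->
  s * f s / Phi s <= p.
Proof.
move=> s0 Hp; rewrite ler_pdivrMr ?Phi_gt0// -subr_le0.
have <- : H 0 = 0 by rewrite /H mul0r Phi0 mulr0 subrr.
apply: (@ler0_derive1_le_cc _ H 0 s) => //.
- by move=> x; rewrite in_itv/= => /andP[x0 _]; have [] := dH x0.
- move=> x; rewrite in_itv/= => /andP[x0 _]; rewrite derive1E.
  have [_ ->] := dH x0; have := Hp x x0.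
  by rewrite ler_pdivrMr ?f_gt0//; lra.
- exact/cH/ltW.
- by rewrite in_itv/= lexx ltW.
- by rewrite in_itv/= lexx ltW.
- exact: ltW.
Qed.

Let K s := ln (Phi s) - p * ln s.

Let dK (s : R) : 0 < s -> is_derive s 1 K ((s * f s / Phi s - p) / s).
Proof.
move=> s0.
have d2 := is_derive1_comp (is_derive1_ln (Phi_gt0 s0)) (is_derive_Phi s0).
have := is_deriveB d2 (is_deriveM (is_derive_cst p s 1) (is_derive1_ln s0)).
set D := (X in is_derive _ _ _ X -> _).
suff -> : (s * f s / Phi s - p) / s = D by [].
rewrite /D /GRing.scale/=; field.
by rewrite !gt_eqF ?Phi_gt0.
Qed.

Let cK (s : R) : 0 < s -> {for s, continuous K}.
Proof. by move=> s0; apply: differentiable_continuous; apply/derivable1_diffP; have [] := dK s0. Qed.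

Let Kpow (s t : R) : 0 < s -> s <= t -> t / s = expR (ln t - ln s).
Proof. by move=> s0 st; rewrite expRB !lnK ?posrE// (lt_le_trans s0). Qed.

(** ln (Phi s) - p ln s is nondecreasing, its derivative being
    (s f / Phi - p) / s. *)
Lemma Phi_growth_ge (s t : R) : 0 < s -> s <= t ->
  (forall t : R, 0 < t -> p <= t * f t / Phi t) ->
  Phi s * (t / s) `^ p <= Phi t.
Proof.
move=> s0 st Hp; have t0 : 0 < t by exact: lt_le_trans st.
have KK : K s <= K t.
  apply: (@ger0_derive1_le_cc _ K s t) => //.
  - by move=> x; rewrite in_itv/= => /andP[x0 _]; have [] := dK (lt_trans s0 x0).
  - move=> x; rewrite in_itv/= => /andP[x0 _]; rewrite derive1E.
    have x0' := lt_trans s0 x0.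
    by have [_ ->] := dK x0'; rewrite divr_ge0 ?(ltW x0')// subr_ge0 Hp.
  - apply: continuous_in_subspaceT => x /set_mem/=; rewrite in_itv/= => /andP[x0 _].
    exact/cK/(lt_le_trans s0).
  - by rewrite in_itv/= lexx.
  - by rewrite in_itv/= lexx andbT.
rewrite -[Phi s]lnK ?posrE ?Phi_gt0// -[leRHS]lnK ?posrE ?Phi_gt0//.
rewrite Kpow// /powR gt_eqF ?expR_gt0// expRK -expRD ler_expR.
by move: KK; rewrite /K; lra.
Qed.

Lemma Phi_growth_le (s t : R) : 0 < s -> s <= t ->
  (forall t : R, 0 < t -> t * f t / Phi t <= p) ->
  Phi t <= Phi s * (t / s) `^ p.
Proof.
move=> s0 st Hp; have t0 : 0 < t by exact: lt_le_trans st.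
have KK : K t <= K s.
  apply: (@ler0_derive1_le_cc _ K s t) => //.
  - by move=> x; rewrite in_itv/= => /andP[x0 _]; have [] := dK (lt_trans s0 x0).
  - move=> x; rewrite in_itv/= => /andP[x0 _]; rewrite derive1E.
    have x0' := lt_trans s0 x0.
    have [_ ->] := dK x0'; rewrite mulr_le0_ge0 ?subr_le0 ?invr_ge0 ?(ltW x0')//; exact: Hp.
  - apply: continuous_in_subspaceT => x /set_mem/=; rewrite in_itv/= => /andP[x0 _].
    by apply: cK; exact: lt_le_trans x0.
  - by rewrite in_itv/= lexx andbT.
  - by rewrite in_itv/= lexx.
rewrite -[Phi s]lnK ?posrE ?Phi_gt0// -[leLHS]lnK ?posrE ?Phi_gt0//.
rewrite Kpow// /powR gt_eqF ?expR_gt0// expRK -expRD ler_expR.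
by move: KK; rewrite /K; lra.
Qed.

End quotient.

Lemma Phi_homo (s t : R) : 0 <= s -> s <= t -> Phi s <= Phi t.
Proof.
move=> s0 st; apply: (@ger0_derive1_le_cc _ Phi 0 t) => //.
- by move=> x; rewrite in_itv/= => /andP[x0 _]; have [] := is_derive_Phi x0.
- move=> x; rewrite in_itv/= => /andP[x0 _]; rewrite derive1E.
  by have [_ ->] := is_derive_Phi x0; exact/ltW/f_gt0.
- exact/continuous_Phi/(le_trans s0).
- by rewrite in_itv/= s0 st.
- by rewrite in_itv/= lexx andbT (le_trans s0).
Qed.

End growth.

Section gen_phi.
Context {R : realType} {d : nat}.
Notation Rd := 'rV[R]_d.
Local Notation L := (lebesgueRn R d).
Local Notation leb := (@leb R d).
Variables (Omega : set Rd) (phi : Rd -> R -> R) (beta : R).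
Hypothesis gphi : gen_Phi_function Omega phi.
Hypothesis beta_gt0 : 0 < beta.

Local Notation Phi := (Phi_of phi).

Let cphi x : Omega x -> {within `[0, +oo[, continuous (phi x)}.
Proof. by have [_ + _ _ _] := gphi; apply. Qed.

Let dphi x : Omega x -> forall s : R, 0 < s -> derivable (phi x) s 1.
Proof. by move=> Ox s s0; have [_ _ + _ _] := gphi; move=> /(_ x s Ox s0)[]. Qed.

Let phi0 x : Omega x -> forall s : R, 0 < s -> 0 < phi x s.
Proof. by move=> Ox s s0; have [_ _ _ + _] := gphi; apply. Qed.

Lemma Phi_of0 x : Phi x 0 = 0.
Proof. exact: Phi0. Qed.

Lemma Phi_of_homo x (s t : R) : Omega x -> 0 <= s -> s <= t -> Phi x s <= Phi x t.
Proof. by move=> Ox; exact: (Phi_homo (cphi Ox) (dphi Ox) (phi0 Ox)). Qed.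

Lemma Phi_of_ge0 x (s : R) : Omega x -> 0 <= s -> 0 <= Phi x s.
Proof. by move=> Ox s0; rewrite -(Phi_of0 x) Phi_of_homo. Qed.

Lemma quotient_bounds : exists pm pp : R, 1 < pm /\
  forall x (t : R), Omega x -> 0 < t -> pm <= t * phi x t / Phi x t <= pp.
Proof.
have [_ _ _ _ [pm [pp [pm1 H]]]] := gphi.
exists pm, pp; split; first by lra.
move=> x t Ox t0; apply/andP; split.
  apply: (quotient_ge (cphi Ox) (dphi Ox) (phi0 Ox)) => // s s0.
  by rewrite -derive1E; have /andP[] := H x s Ox s0.
apply: (quotient_le (cphi Ox) (dphi Ox) (phi0 Ox)) => // s s0.
by rewrite -derive1E; have /andP[] := H x s Ox s0.
Qed.

Lemma p_minus_le A x (t : R) : A x -> Omega x -> 0 < t ->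
  p_minus Omega phi A <= t * phi x t / Phi x t.
Proof.
move=> Ax Ox t0; have [pm [pp [_ H]]] := quotient_bounds.
apply: ge_inf; last by exists x => //; exists t.
by exists pm => _ [y [_ Oy] [s s0 <-]]; have /andP[] := H y s Oy s0.
Qed.

Lemma p_plus_ge A x (t : R) : A x -> Omega x -> 0 < t ->
  t * phi x t / Phi x t <= p_plus Omega phi A.
Proof.
move=> Ax Ox t0; have [pm [pp [_ H]]] := quotient_bounds.
apply: sup_upper_bound; last by exists x => //; exists t.
split; first by exists (t * phi x t / Phi x t); exists x => //; exists t.
by exists pp => _ [y [_ Oy] [s s0 <-]]; have /andP[] := H y s Oy s0.
Qed.

Lemma p_minus_mono A B : A `<=` B -> A `&` Omega !=set0 ->
  p_minus Omega phi B <= p_minus Omega phi A.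
Proof.
move=> AB [x [Ax Ox]]; apply: lb_le_inf.
  by exists (1 * phi x 1 / Phi x 1), x => //; exists 1 => //=; exact: ltr01.
by move=> _ [y [Ay Oy] [s s0 <-]]; apply: p_minus_le => //; exact: AB.
Qed.

Lemma p_plus_mono A B : A `<=` B -> A `&` Omega !=set0 ->
  p_plus Omega phi A <= p_plus Omega phi B.
Proof.
move=> AB [x [Ax Ox]]; apply: sup_le_ub.
  by exists (1 * phi x 1 / Phi x 1), x => //; exists 1 => //=; exact: ltr01.
by move=> _ [y [Ay Oy] [s s0 <-]]; apply: p_plus_ge => //; exact: AB.
Qed.

Lemma p_minus_gt1 A : A `&` Omega !=set0 -> 1 < p_minus Omega phi A.
Proof.
move=> [x [Ax Ox]]; have [pm [pp [pm1 H]]] := quotient_bounds.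
apply: (lt_le_trans pm1); apply: lb_le_inf.
  by exists (1 * phi x 1 / Phi x 1), x => //; exists 1 => //=; exact: ltr01.
by move=> _ [y [Ay Oy] [s s0 <-]]; have /andP[] := H y s Oy s0.
Qed.

(** The growth bound with exponent 1, which is allowed since p^- > 1. *)
Lemma Phi_of_div x (t c : R) : Omega x -> 0 <= t -> 1 <= c -> Phi x (t / c) <= Phi x t / c.
Proof.
move=> Ox; rewrite le_eqVlt => /predU1P[<-|t0] c1.
  by rewrite !mul0r Phi_of0 mul0r.
have c0 : 0 < c by exact: lt_le_trans c1.
have tc0 : 0 < t / c by exact: divr_gt0.
have tct : t / c <= t by rewrite ler_pdivrMr// ler_peMr// ltW.
have := @Phi_growth_ge _ _ (cphi Ox) (dphi Ox) (phi0 Ox) 1 (t / c) t tc0 tct.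
move=> H.
have /H : forall t : R, 0 < t -> 1 <= t * phi x t / Phi x t.
  have [pm [pp [pm1 H']]] := quotient_bounds.
  by move=> s s0; have /andP[+ _] := H' x s Ox s0; apply: le_trans; exact: ltW.
rewrite (_ : t / (t / c) = c); last by field; rewrite !gt_eqF.
by rewrite powRr1 ?(ltW c0)// ler_pdivlMr.
Qed.

Definition normal_pt x := Omega x /\ exists s0 : R, beta <= s0 <= beta^-1 /\ Phi x s0 = 1.

Lemma normalized_ae : normalized Omega phi beta ->
  {ae leb, forall x, Omega x -> normal_pt x}.
Proof.
move=> H; apply: (ae_leb_imply H) => x /[swap] Ox /(_ Ox).
rewrite /Phi_inv; case: xgetP => [s _ [s0 Ps] bs|_ /andP[]].
  split => //; exists s; split; [exact: bs|exact: Ps].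
by rewrite leNgt beta_gt0.
Qed.

(** Above the normalization point s, with Phi(x, s) = 1 and s <= 1 / beta, Phi
    grows at least like (t / s)^q; below it, beta t <= 1. *)
Lemma Phi_lower A x (t q : R) : A x -> normal_pt x -> 0 <= t -> 0 <= q ->
  q <= p_minus Omega phi A -> (beta * t) `^ q <= 1 + Phi x t.
Proof.
move=> Ax [Ox [s [/andP[bs sb] Ps]]] t0 q0 qp.
have s0 : 0 < s by exact: lt_le_trans bs.
have bt0 : 0 <= beta * t by rewrite mulr_ge0// ltW.
have [ts|st] := leP t s.
  have bt1 : beta * t <= 1.
    by rewrite -ler_pdivlMl// mulr1 (le_trans ts).
  have : (beta * t) `^ q <= 1 `^ q by apply: ge0_ler_powR; rewrite ?nnegrE.
  by rewrite powR1; have := Phi_of_ge0 Ox t0; lra.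
have := @Phi_growth_ge _ _ (cphi Ox) (dphi Ox) (phi0 Ox) q s t s0 (ltW st).
have H : forall t : R, 0 < t -> q <= t * phi x t / Phi x t.
  by move=> r r0; apply: (le_trans qp); exact: p_minus_le.
move=> /(_ H); rewrite -/(Phi_of phi x s) Ps mul1r => H1.
have : (beta * t) `^ q <= (t / s) `^ q.
  apply: ge0_ler_powR; rewrite ?nnegrE ?divr_ge0 ?(ltW s0)//.
  by rewrite mulrC ler_wpM2l// -[beta]invrK lef_pV2 ?posrE ?invr_gt0.
move=> /le_trans; apply; apply: (le_trans H1); rewrite /Phi_of; lra.
Qed.

(** Above the normalization point s, with Phi(x, s) = 1 and s >= beta, Phi grows
    at most like (t / s)^r; below it, Phi <= 1. *)
Lemma Phi_upper A x (t r : R) : A x -> normal_pt x -> 0 <= t -> 0 <= r ->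
  p_plus Omega phi A <= r -> Phi x t <= 1 + (t / beta) `^ r.
Proof.
move=> Ax [Ox [s [/andP[bs sb] Ps]]] t0 r0 pr.
have s0 : 0 < s by exact: lt_le_trans bs.
have [ts|st] := leP t s.
  have := Phi_of_homo Ox t0 ts; rewrite Ps; have := powR_ge0 (t / beta) r; lra.
have := @Phi_growth_le _ _ (cphi Ox) (dphi Ox) (phi0 Ox) r s t s0 (ltW st).
have H : forall t : R, 0 < t -> t * phi x t / Phi x t <= r.
  by move=> q q0; apply: le_trans pr; exact: p_plus_ge.
move=> /(_ H); rewrite -/(Phi_of phi x s) Ps mul1r => H1.
have : (t / s) `^ r <= (t / beta) `^ r.
  apply: ge0_ler_powR; rewrite ?nnegrE ?divr_ge0 ?(ltW s0) ?(ltW beta_gt0)//.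
  by rewrite ler_wpM2l// lef_pV2.
by rewrite /Phi_of in H1 *; lra.
Qed.

End gen_phi.

(** * The local Sobolev estimate *)
Section absorb.
Context {R : realType}.

(** In the application a is the integral of |eta^d psi|^r.  Its two exponents on
    the right are at most 1 - 1/D - 1/(D P), so for a > 1 division leaves
    a^(1/(D P)) on the left.  The bound P on r, instead of r itself, makes the
    result uniform over the balls. *)
Lemma absorb (a D P r C1 C2 KK : R) :
  2 <= D -> D / (D - 1) < r -> r <= P -> 1 <= C1 -> 1 <= C2 -> 0 <= KK -> 0 <= a ->
  a `^ (1 - D^-1) <= (r * (1 - D^-1)) *
     (a `^ (1 - (r^-1 + D^-1)) * C1 `^ (r^-1 + D^-1) +
      KK * (a `^ ((r * (1 - D^-1) - 1) / (r - 1)) * C2 `^ (1 - (r * (1 - D^-1) - 1) / (r - 1)))) ->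
  a <= (P * (C1 + KK * C2)) `^ (D * P).
Proof.
move=> D2 rD rP C11 C21 KK0 a0.
have D0 : 0 < D by lra.
have D1 : 0 < D - 1 by lra.
have r1 : 1 < r by apply: lt_trans rD; rewrite ltr_pdivlMr//; lra.
have P1 : 1 < P by lra.
have Dr : D < r * (D - 1) by rewrite -ltr_pdivrMr.
set C := P * (C1 + KK * C2).
have KC0 : 0 <= KK * C2 by rewrite mulr_ge0//; lra.
have C_ge1 : 1 <= C.
  rewrite /C -[1]mulr1; apply: ler_pM => //; lra.
have [a1 _|a1] := leP a 1.
  have : 1 `^ (D * P) <= C `^ (D * P).
    apply: ge0_ler_powR; rewrite ?nnegrE//; [by rewrite mulr_ge0//; lra|lra].
  by rewrite powR1; exact: le_trans.
(* a common upper bound for the two exponents of a on the right-hand side *)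
set e := 1 - D^-1 - (D * P)^-1.
have eq1 : 1 - (r^-1 + D^-1) <= e.
  have : (D * P)^-1 <= r^-1.
    rewrite lef_pV2 ?posrE ?mulr_gt0//; try lra.
    by apply: (le_trans rP); rewrite ler_peMl//; lra.
  by rewrite /e; lra.
set th := (r * (1 - D^-1) - 1) / (r - 1).
have thE : th = 1 - D^-1 - (D * (r - 1))^-1.
  rewrite /th; field; apply/andP; split; rewrite gt_eqF//; lra.
have eq2 : th <= e.
  have : (D * P)^-1 <= (D * (r - 1))^-1.
    by rewrite lef_pV2 ?posrE ?mulr_gt0 ?ler_pM2l//; lra.
  by rewrite /e thE; lra.
have g1 : 1 < r * (1 - D^-1).
  rewrite (_ : r * (1 - D^-1) = r * (D - 1) / D); last by field; rewrite gt_eqF.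
  by rewrite ltr_pdivlMr// mul1r.
have th0 : 0 <= th by rewrite /th divr_ge0//; lra.
have rD0 : 0 < r * D^-1 by rewrite mulr_gt0 ?invr_gt0//; lra.
have rV0 : 0 < r^-1 by rewrite invr_gt0; lra.
have th1 : th <= 1 by rewrite /th ler_pdivrMr ?mul1r; lra.
have q01 : 0 <= r^-1 + D^-1 <= 1.
  rewrite addr_ge0 ?invr_ge0 ?(ltW D0)/=; try lra.
  have : r^-1 * (r * (1 - D^-1)) = 1 - D^-1 by field; rewrite !gt_eqF//; lra.
  by move: g1; rewrite -(ltr_pM2l rV0); lra.
have b1 : a `^ (1 - (r^-1 + D^-1)) <= a `^ e by apply: ler_powR => //; exact: ltW.
have b2 : a `^ th <= a `^ e by apply: ler_powR => //; exact: ltW.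
have c1 : C1 `^ (r^-1 + D^-1) <= C1 by apply: ler1_powR => //; case/andP : q01.
have c2 : C2 `^ (1 - th) <= C2 by apply: ler1_powR => //; lra.
have gP : r * (1 - D^-1) <= P by lra.
move=> H.
have {}H : a `^ (1 - D^-1) <= C * a `^ e.
  apply: (le_trans H).
  rewrite /C -[P * _ * _]mulrA; apply: ler_pM => //.
  - lra.
  - by rewrite addr_ge0 ?mulr_ge0 ?powR_ge0.
  rewrite mulrDl lerD//.
    by rewrite mulrC; apply: ler_pM; rewrite ?powR_ge0.
  rewrite -mulrA ler_wpM2l// mulrC; apply: ler_pM; rewrite ?powR_ge0//.
have aE : 1 - D^-1 = e + (D * P)^-1 by rewrite /e; lra.
have a0' : 0 < a by lra.
have DP0 : 0 < D * P by rewrite mulr_gt0//; lra.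
move: H; rewrite aE powRD ?(gt_eqF a0') ?implybT// mulrC ler_pM2r ?powR_gt0// => H.
rewrite -[leLHS](powRr1 a0) -(mulVf (lt0r_neq0 DP0)) [a `^ _]powRrM.
by apply: ge0_ler_powR; rewrite ?nnegrE ?powR_ge0 ?(ltW DP0)//; lra.
Qed.

End absorb.

Section local.
Context {R : realType}.

(** The powers of psi on both sides agree; the power of the cutoff on the left,
    D g - 1, is at least the power D r th on the right because D (1 - th) >= 1.
    This is what the D-th power of the cutoff is for. *)
Lemma cutoff_interp (eta psi r g th D : R) (d : nat) : (0 < d)%N -> D = d.+1%:R ->
  0 <= eta <= 1 -> 0 <= psi -> 1 < r -> 1 < g ->
  r * th + (1 - th) = g -> 1 <= D * (1 - th) ->
  (eta ^+ d.+1 * psi) `^ (g - 1) * (eta ^+ d * psi) <=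
  ((eta ^+ d.+1 * psi) `^ r) `^ th * psi `^ (1 - th).
Proof.
move=> d0 DE /andP[eta0 eta1] psi0 r1 g1 gE Dth.
have rhs0 : 0 <= ((eta ^+ d.+1 * psi) `^ r) `^ th * psi `^ (1 - th) by rewrite mulr_ge0 ?powR_ge0.
have [e0|e0] := eqVneq eta 0.
  by rewrite {2}e0 expr0n eqn0Ngt d0/= mul0r mulr0.
have [p0|p0] := eqVneq psi 0; first by rewrite {2}p0 !mulr0.
have ep : 0 < eta by rewrite lt0r e0.
have pp : 0 < psi by rewrite lt0r p0.
have E (s : R) : (eta ^+ d.+1 * psi) `^ s = eta `^ (D * s) * psi `^ s.
  by rewrite powRM ?exprn_ge0// -powR_mulrn// -powRrM -DE.
rewrite -powRrM !E -(powR_mulrn d eta0).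
rewrite [leLHS](_ : _ = (eta `^ (D * (g - 1)) * eta `^ d%:R) * (psi `^ (g - 1) * psi `^ 1)).
  rewrite [leRHS](_ : _ = eta `^ (D * (r * th)) * (psi `^ (r * th) * psi `^ (1 - th))); last by rewrite [RHS]mulrA.
  rewrite -!powRD ?e0 ?p0 ?implybT// gE subrK ler_wpM2r ?powR_ge0//.
  apply: ger_powR; first by rewrite ep.
  rewrite (_ : d%:R = D - 1); last by rewrite DE -natr1 addrK.
  by rewrite -gE; lra.
by rewrite powRr1//; ring.
Qed.

End local.

Section local_estimate.
Context {R : realType} (m : nat).
Let d := m.+2.
Notation Rd := 'rV[R]_d.
Let D : R := d%:R.
Local Notation mu := (@product_lebesgue R d).
Variables (psi eta G : Rd -> R) (B : set Rd) (K r P A1 A2 : R).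
Hypotheses (psiC : C1 psi) (psib : bsupp psi) (etaC : C1 eta).
Hypothesis eta01 : forall x, 0 <= eta x <= 1.
Hypothesis etaK : forall k x, `|dpartial k eta x| <= K.
Hypotheses (mB : measurable B) (etaB : forall x, ~ B x -> eta x = 0).
Hypotheses (cG : continuous G) (psiG : forall k x, `|dpartial k psi x| <= G x).
Hypotheses (rD : D / (D - 1) < r) (rP : r <= P) (A1_ge1 : 1 <= A1) (A2_ge1 : 1 <= A2).
Let iq := r^-1 + D^-1.
Hypothesis H1 : (\int[mu]_x ((\1_B x * G x) `^ iq^-1)%:E <= A1%:E)%E.
Hypothesis H2 : (\int[mu]_x `|psi x|%:E <= A2%:E)%E.

Let f x := eta x ^+ d * psi x.
Variable g : R.
Hypothesis gE : g = r * (1 - D^-1).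
Let th := (g - 1) / (r - 1).

Let D2 : 2 <= D. Proof. by rewrite /D ler_nat. Qed.
Let r1 : 1 < r.
Proof. by apply: lt_trans rD; rewrite ltr_pdivlMr; have := D2; lra. Qed.
Let g1 : 1 < g.
Proof.
have := D2 => D2'; have D0 : 0 < D by lra.
move: rD; rewrite ltr_pdivrMr; last lra.
rewrite gE (_ : r * (1 - D^-1) = r * (D - 1) / D); last by field; rewrite gt_eqF.
by rewrite ltr_pdivlMr// mul1r.
Qed.
Let g_ge0 : 0 <= g. Proof. exact: ltW (lt_trans ltr01 g1). Qed.
Let K0 : 0 <= K. Proof. exact: le_trans (etaK ord0 0). Qed.

Let fC : C1 f. Proof. exact: (C1M (C1X d etaC) psiC). Qed.
Let fb : bsupp f.
Proof. by have [l H] := psib; exists l => x /H; rewrite /f => ->; rewrite mulr0. Qed.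
Let cf : continuous f. Proof. by have [] := fC. Qed.
Let cpsi : continuous psi. Proof. by have [] := psiC. Qed.
Let ceta : continuous eta. Proof. by have [] := etaC. Qed.

Let mc (h : Rd -> R) : continuous h -> measurable_fun setT (fun x => `|h x| : measurableTypeR R).
Proof. by move=> ch; apply: measurableT_comp => //; exact: continuous_measurable_rV. Qed.

Let mpow (h : Rd -> R) p : measurable_fun setT (h : _ -> measurableTypeR R) ->
  measurable_fun setT (fun x => h x `^ p : measurableTypeR R).
Proof. by move=> mh; exact: (@measurableT_comp _ _ _ _ _ _ (@powR R ^~ p)). Qed.

Let A : \bar R := (\int[mu]_x (`|f x| `^ r)%:E)%E.

Let A0 : (0 <= A)%E.
Proof. by apply: integral_ge0 => x _; rewrite lee_fin powR_ge0. Qed.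

Let A_fin : A \is a fin_num.
Proof.
rewrite ge0_fin_numE//.
have [l Hl] := psib; pose l' := `|l| + 1.
have f0 x : ~ ccube 0 l' x -> f x = 0.
  move=> nx; rewrite /f Hl ?mulr0//; apply: contrapT => H; apply: nx => i.
  rewrite mxE subr0 leNgt; apply/negP => xi; apply: H; exists i.
  by rewrite (le_trans (ler_norm _))// (le_trans _ (ltW xi))// /l' lerDl.
have [M HM] : exists M, forall x, `|f x| <= M.
  apply: (@Cc_bounded _ _ setT); split => //; exists (ccube 0 l'); split => //.
  exact: compact_ccube.
have M0 : 0 <= M by apply: le_trans (HM 0).
have r0 : 0 < r by exact: lt_trans ltr01 r1.
apply: (@le_lt_trans _ _ (\int[mu]_(x in ccube 0 l') (M `^ r)%:E)%E).
  rewrite [leRHS]integral_mkcond; apply: ge0_le_integral => //.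
  - by apply/measurable_EFinP; apply: mpow; exact: mc.
  - by apply: (iffLR (measurable_restrictT _ (measurable_ccube _ _))).
  move=> x _; rewrite patchE; case: ifPn => xc.
    by rewrite lee_fin; apply: ge0_ler_powR; rewrite ?nnegrE// ltW.
  rewrite f0 ?normr0 ?powR0 ?gt_eqF//.
  by move/negP: xc; apply: contra_not; exact: mem_set.
rewrite integral_cst; last exact: measurable_ccube.
by rewrite lte_mul_pinfty ?lee_fin ?powR_ge0//; exact: mu_ccube_lty.
Qed.

(** An upper bound for all the partial derivatives of |f|^g. *)
Let F x := g * (`|f x| `^ (g - 1) * (eta x ^+ d * G x) +
  D * K * (`|f x| `^ (g - 1) * (eta x ^+ m.+1 * `|psi x|))).

Let G0 x : 0 <= G x. Proof. exact: le_trans (psiG ord0 x). Qed.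

Let df_le k x : `|dpartial k f x| <= eta x ^+ d * G x + D * K * (eta x ^+ m.+1 * `|psi x|).
Proof.
have /andP[e0 e1] := eta01 x.
rewrite /f (dpartialM k x (C1X d etaC) psiC) (dpartialX k m.+1 x etaC); apply: (le_trans (ler_normD _ _)); apply: lerD.
  by rewrite normrM ger0_norm ?exprn_ge0// ler_wpM2l ?exprn_ge0.
rewrite !normrM (ger0_norm (ler0n _ _)) [`|eta x ^+ _|]ger0_norm ?exprn_ge0//.
rewrite -/D [leRHS](_ : _ = `|psi x| * (D * eta x ^+ m.+1 * K)); last by ring.
by rewrite ler_wpM2l// ler_wpM2l// mulr_ge0 ?exprn_ge0 ?ler0n.
Qed.

Let mF1 : measurable_fun setT (fun x => `|f x| `^ (g - 1) * (eta x ^+ d * G x) : measurableTypeR R).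
Proof.
apply: measurable_funM; first by apply: mpow; exact: mc.
by apply: measurable_funM; [apply: measurable_funX|]; exact: continuous_measurable_rV.
Qed.
Let mF2 : measurable_fun setT (fun x => `|f x| `^ (g - 1) * (eta x ^+ m.+1 * `|psi x|) : measurableTypeR R).
Proof.
apply: measurable_funM; first by apply: mpow; exact: mc.
by apply: measurable_funM; [apply: measurable_funX; exact: continuous_measurable_rV|exact: mc].
Qed.

(** The Gagliardo-Nirenberg inequality for |f|^g, the exponent g being chosen such
    that its power in the inequality is |f|^r. *)
Let gn : (A `^ (1 - D^-1) <= \int[mu]_x (F x)%:E)%E.
Proof.
have e0 x : 0 <= eta x by have /andP[] := eta01 x.
have F0 x : 0 <= F x.
  rewrite /F; apply: mulr_ge0; first exact: g_ge0.
  apply: addr_ge0; first by rewrite mulr_ge0 ?powR_ge0// mulr_ge0 ?exprn_ge0.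
  apply: mulr_ge0; first by apply: mulr_ge0; [exact: ler0n|exact: K0].
  by rewrite mulr_ge0 ?powR_ge0// mulr_ge0 ?exprn_ge0.
have cE : (m.+2%:R / m.+1%:R : R) = (1 - D^-1)^-1.
  rewrite /D /d -[m.+2%:R]natr1; field.
  by rewrite addrK nat1r natr1 !pnatr_eq0.
have c0 : 0 < 1 - D^-1.
  by rewrite subr_gt0 invf_lt1 ?(lt_le_trans _ D2)//; have := D2; lra.
have := @gagliardo_nirenberg R m (fun x => (`|f x| `^ g)%:E) (fun x => (F x)%:E).
rewrite cE => H.
have {H} : (A <= (\int[mu]_x (F x)%:E) `^ (1 - D^-1)^-1)%E.
  rewrite /A; apply: le_trans (H _ _ _ _ _).
  - rewrite le_eqVlt; apply/orP; left; apply/eqP; apply: eq_integral => x _.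
    by rewrite poweR_EFin -powRrM gE mulfK ?gt_eqF.
  - by apply/measurable_EFinP; apply: mpow; exact: mc.
  - apply/measurable_EFinP; apply: measurable_funM => //.
    by apply: measurable_funD => //; exact: measurable_funM.
  - by move=> x; rewrite lee_fin powR_ge0.
  - by move=> x; rewrite lee_fin.
  move=> x k; apply: (le_trans (line_dominated_pow k x g1 fC fb)).
  have ml (h : Rd -> R) : measurable_fun setT (h : _ -> measurableTypeR R) ->
      measurable_fun setT (fun t : measurableTypeR R => h (upd x k t) : measurableTypeR R).
    move=> mh; apply: measurableT_comp mh _.
    exact: measurableT_comp (@measurable_upd R d k) (pair1_measurable x).
  apply: ge0_le_integral => //.
  - move=> t _; rewrite lee_fin; apply: mulr_ge0 => //; apply: mulr_ge0; [exact: g_ge0|exact: powR_ge0].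
  - apply/measurable_EFinP.
    apply: (ml (fun y => g * `|f y| `^ (g - 1) * `|dpartial k f y|)).
    apply: measurable_funM.
      by apply: measurable_funM => //; apply: mpow; exact: mc.
    by apply: mc; have [_ /(_ k)[]] := fC.
  - apply/measurable_EFinP; apply: (ml F).
    apply: measurable_funM => //.
    by apply: measurable_funD => //; exact: measurable_funM.
  - move=> t _; rewrite lee_fin /F -[leLHS]mulrA; apply: ler_wpM2l; first exact: g_ge0.
    rewrite [leRHS](_ : _ = `|f (upd x k t)| `^ (g - 1) *
      (eta (upd x k t) ^+ d * G (upd x k t) + D * K * (eta (upd x k t) ^+ m.+1 * `|psi (upd x k t)|))); last by ring.
    by rewrite ler_wpM2l ?powR_ge0// df_le.
move=> H.
have I0 : (0 <= \int[mu]_x (F x)%:E)%E by apply: integral_ge0 => x _; rewrite lee_fin.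
have -> : (\int[mu]_x (F x)%:E = (\int[mu]_x (F x)%:E) `^ (1 - D^-1)^-1 `^ (1 - D^-1))%E.
  by rewrite -poweRrM mulVf ?gt_eqF// poweRe1.
apply: gt0_ler_poweR; rewrite ?in_itv/= ?leey ?andbT ?poweR_ge0//.
exact: ltW.
Qed.

Lemma local_estimate_g :
  (\int[mu]_x (`|eta x ^+ d * psi x| `^ r)%:E <=
   ((P * (A1 + D * K * A2)) `^ (D * P))%:E)%E.
Proof.
have e0 x : 0 <= eta x by have /andP[] := eta01 x.
rewrite -/A -(fineK A_fin) lee_fin.
apply: (@absorb _ _ D P r) => //; first by rewrite mulr_ge0 ?ler0n.
  exact: fine_ge0.
rewrite -gE -/iq -/th.
have gn' := gn.
have mfr : measurable_fun setT (fun x => (`|f x| `^ r)%:E).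
  by apply/measurable_EFinP; apply: mpow; exact: mc.
have mBG : measurable_fun setT (fun x => \1_B x * G x : measurableTypeR R).
  by apply: measurable_funM; [exact: measurable_indic|exact: continuous_measurable_rV].
have BG0 x : 0 <= \1_B x * G x by rewrite mulr_ge0.
have r0 : 0 < r by exact: lt_trans ltr01 r1.
have D0 : 0 < D by apply: lt_le_trans D2.
have iq0 : 0 < iq by rewrite addr_gt0 ?invr_gt0.
have iq1 : 1 - iq = (g - 1) / r.
  by rewrite /iq gE; field; rewrite !gt_eqF.
have iq01 : 0 < 1 - iq < 1.
  by rewrite iq1 divr_gt0 ?subr_gt0//= -iq1 ltrBlDr ltrDl.
have gr : g < r by rewrite gE gtr_pMr// ltrBlDr ltrDl invr_gt0.
have r10 : 0 < r - 1 by rewrite subr_gt0.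
have th01 : 0 < th < 1.
  by rewrite /th divr_gt0 ?subr_gt0//= ltr_pdivrMr// mul1r ltrD2r.
(* Hölder between |f|^r and the q-th power of the gradient, where 1/q = iq *)
have T1 : (\int[mu]_x (`|f x| `^ (g - 1) * (eta x ^+ d * G x))%:E <=
    ((fine A) `^ (1 - iq) * A1 `^ iq)%:E)%E.
  have := @hoelder_poweR _ _ _ mu (fun x => (`|f x| `^ r)%:E)
    (fun x => ((\1_B x * G x) `^ iq^-1)%:E) (1 - iq) iq01 mfr _ _ _.
  rewrite subKr => /(_ _ _ _)/le_trans H.
  apply: le_trans; last first.
    apply: H; [by apply/measurable_EFinP; exact: mpow|by move=> x; rewrite lee_fin powR_ge0|by move=> x; rewrite lee_fin powR_ge0|].
    rewrite EFinM -!poweR_EFin (fineK A_fin); apply: lee_pmul; rewrite ?poweR_ge0//.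
    apply: gt0_ler_poweR; [exact: ltW| | |exact: H1].
      by rewrite in_itv/= leey andbT; apply: integral_ge0 => x _; rewrite lee_fin powR_ge0.
    by rewrite in_itv/= leey andbT lee_fin; exact: le_trans A1_ge1.
  apply: ge0_le_integral => //.
  - by move=> x _; rewrite lee_fin mulr_ge0 ?powR_ge0// mulr_ge0 ?exprn_ge0.
  - exact/measurable_EFinP.
  - apply: emeasurable_funM; apply: measurable_fun_poweR => //.
    by apply/measurable_EFinP; exact: mpow.
  move=> x _; rewrite !poweR_EFin -EFinM lee_fin -!powRrM iq1.
  rewrite (_ : r * ((g - 1) / r) = g - 1); last by field; rewrite gt_eqF.
  rewrite mulVf ?gt_eqF// powRr1// ler_wpM2l ?powR_ge0//.
  rewrite ler_wpM2r//.
  have /andP[_ e1] := eta01 x.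
  rewrite indicE; have [xB|xB] := boolP (x \in B); first by rewrite exprn_ile1.
  rewrite etaB ?expr0n//; move/negP: xB; apply: contra_not; exact: mem_set.
(* Hölder between |f|^r and |psi|, with the weights th and 1 - th of the interpolation *)
have T2 : (\int[mu]_x (`|f x| `^ (g - 1) * (eta x ^+ m.+1 * `|psi x|))%:E <=
    ((fine A) `^ th * A2 `^ (1 - th))%:E)%E.
  have th10 : 0 < 1 - th by case/andP: th01 => *; rewrite subr_gt0.
  have := @hoelder_poweR _ _ _ mu (fun x => (`|f x| `^ r)%:E)
    (fun x => `|psi x|%:E) th th01 mfr _ _ _.
  move=> /(_ _ _ _)/le_trans H.
  apply: le_trans; last first.
    apply: H; [by apply/measurable_EFinP; exact: mc|by move=> x; rewrite lee_fin powR_ge0|by move=> x; rewrite lee_fin|].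
    rewrite EFinM -!poweR_EFin (fineK A_fin); apply: lee_pmul; rewrite ?poweR_ge0//.
    apply: gt0_ler_poweR; [exact: ltW| | |exact: H2].
      by rewrite in_itv/= leey andbT; apply: integral_ge0 => x _; rewrite lee_fin.
    by rewrite in_itv/= leey andbT lee_fin; exact: le_trans A2_ge1.
  apply: ge0_le_integral => //.
  - by move=> x _; rewrite lee_fin mulr_ge0 ?powR_ge0// mulr_ge0 ?exprn_ge0.
  - exact/measurable_EFinP.
  - apply: emeasurable_funM; apply: measurable_fun_poweR => //.
    by apply/measurable_EFinP; exact: mc.
  move=> x _; rewrite !poweR_EFin -EFinM lee_fin.
  rewrite /f normrM ger0_norm ?exprn_ge0//.
  apply: (@cutoff_interp R _ _ _ _ _ D m.+1) => //.
  - by rewrite /th; field; rewrite gt_eqF.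
  - have -> : D * (1 - th) = r / (r - 1) by rewrite /th gE; field; rewrite !gt_eqF.
    by rewrite ler_pdivlMr// mul1r lerBlDr lerDl.
rewrite -lee_fin -[X in (X <= _)%E]poweR_EFin (fineK A_fin).
apply: (le_trans gn').
have DK0 : 0 <= D * K by apply: mulr_ge0; [exact: ltW|exact: K0].
rewrite (_ : (\int[mu]_x (F x)%:E = g%:E *
  (\int[mu]_x (`|f x| `^ (g - 1) * (eta x ^+ d * G x))%:E + (D * K)%:E *
   \int[mu]_x (`|f x| `^ (g - 1) * (eta x ^+ m.+1 * `|psi x|))%:E))%E); last first.
  rewrite -ge0_integralZl_EFin//; last 2 first.
  - by move=> x _; rewrite lee_fin mulr_ge0 ?powR_ge0// mulr_ge0 ?exprn_ge0.
  - exact/measurable_EFinP.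
  rewrite -ge0_integralD//; last 4 first.
  - by move=> x _; rewrite lee_fin mulr_ge0 ?powR_ge0// mulr_ge0 ?exprn_ge0.
  - exact/measurable_EFinP.
  - by move=> x _; rewrite -EFinM lee_fin mulr_ge0// mulr_ge0 ?powR_ge0// mulr_ge0 ?exprn_ge0.
  - by apply: measurable_funeM; exact/measurable_EFinP.
  rewrite -ge0_integralZl_EFin//; last 2 first.
  - move=> x _; rewrite -EFinM -EFinD lee_fin.
    apply: addr_ge0; last apply: mulr_ge0 => //.
      by rewrite mulr_ge0 ?powR_ge0// mulr_ge0 ?exprn_ge0.
    by rewrite mulr_ge0 ?powR_ge0// mulr_ge0 ?exprn_ge0.
  - apply: emeasurable_funD; first exact/measurable_EFinP.
    by apply: measurable_funeM; exact/measurable_EFinP.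
rewrite [leRHS]EFinM; apply: lee_wpmul2l; first by rewrite lee_fin; exact: g_ge0.
by rewrite EFinD; apply: leeD => //; rewrite [leRHS]EFinM; apply: lee_wpmul2l; rewrite ?lee_fin.
Qed.

End local_estimate.

(** The Sobolev inequality for psi on B with the exponent q such that
    1/q = 1/r + 1/D, in a form where the integral of |psi| takes the place of any
    boundary condition on B; the bound depends on r through P only. *)
Lemma local_estimate {R : realType} (m : nat) (psi eta G : 'rV[R]_m.+2 -> R)
    (B : set 'rV[R]_m.+2) (K r P A1 A2 : R) (D := m.+2%:R : R) :
  C1 psi -> bsupp psi -> C1 eta -> (forall x, 0 <= eta x <= 1) ->
  (forall k x, `|dpartial k eta x| <= K) ->
  measurable B -> (forall x, ~ B x -> eta x = 0) ->
  continuous G -> (forall k x, `|dpartial k psi x| <= G x) ->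
  D / (D - 1) < r -> r <= P -> 1 <= A1 -> 1 <= A2 ->
  (\int[product_lebesgue m.+2]_x
     ((\1_B x * G x) `^ (r^-1 + D^-1)^-1)%:E <= A1%:E)%E ->
  (\int[product_lebesgue m.+2]_x `|psi x|%:E <= A2%:E)%E ->
  (\int[product_lebesgue m.+2]_x (`|eta x ^+ m.+2 * psi x| `^ r)%:E <=
   ((P * (A1 + D * K * A2)) `^ (D * P))%:E)%E.
Proof.
move=> psiC psib etaC eta01 etaK mB etaB cG psiG rD rP A11 A21 H1 H2.
exact: (local_estimate_g psiC psib etaC eta01 etaK mB etaB cG psiG rD rP A11 A21 H1 H2 erefl).
Qed.

(** * L^1 bounds by the gradient *)
Section poincare_L1.
Context {R : realType} {n : nat}.
Notation Rn := 'rV[R]_n.+1.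
Local Notation mu := (@product_lebesgue R n.+1).

Let mnorm (h : Rn -> R) : continuous h -> measurable_fun setT (fun x => `|h x|%:E).
Proof.
by move=> ch; apply/measurable_EFinP; apply: measurableT_comp => //; exact: continuous_measurable_rV.
Qed.

(** On each line in the first direction f is at most the integral of |d_0 f|, and
    f vanishes off a segment of length 2 |l|. *)
Lemma poincare_L1 (f : Rn -> R) (l : R) : C1 f -> (forall x, ~ cube 0 l x -> f x = 0) ->
  (\int[mu]_x `|f x|%:E <= (2 * `|l|)%:E * \int[mu]_x `|dpartial ord0 f x|%:E)%E.
Proof.
move=> fC fl; have [cf dfC] := fC; have [_ cdf] := dfC ord0.
have fb : bsupp f.
  exists l => x [i xi]; apply: fl => /(_ i); rewrite mxE subr0 => xl.
  by rewrite leNgt xl in xi.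
have nn (h : Rn -> R) x : (0 <= `|h x|%:E)%E by rewrite lee_fin.
rewrite (tonelli_cons_swap (mnorm cf) (nn f)).
rewrite (tonelli_cons_swap (mnorm cdf) (nn (dpartial ord0 f))).
rewrite -ge0_integralZl_EFin//; last 2 first.
- by move=> y _; apply: integral_ge0.
- apply: (@measurable_fun_fubini_tonelli_G _ _ (measurableTypeR R) _ R lebesgue_measure
    (fun p => `|dpartial ord0 f (cons_rV p)|%:E)) => //.
  exact: measurableT_comp (mnorm cdf) (@measurable_cons_rV R n).
apply: ge0_le_integral => //.
- by move=> y _; apply: integral_ge0.
- apply: (@measurable_fun_fubini_tonelli_G _ _ (measurableTypeR R) _ R lebesgue_measure
    (fun p => `|f (cons_rV p)|%:E)) => //.
  exact: measurableT_comp (mnorm cf) (@measurable_cons_rV R n).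
- apply: measurable_funeM.
  apply: (@measurable_fun_fubini_tonelli_G _ _ (measurableTypeR R) _ R lebesgue_measure
    (fun p => `|dpartial ord0 f (cons_rV p)|%:E)) => //.
  exact: measurableT_comp (mnorm cdf) (@measurable_cons_rV R n).
move=> y _; set h := (\int[lebesgue_measure]_t `|dpartial ord0 f _|%:E)%E.
pose I : set (measurableTypeR R) := `[- `|l|, `|l|]%classic.
have mI : measurable I by exact: measurable_itv.
have h0 : (0 <= h)%E by apply: integral_ge0.
have fh t : (`|f (cons_rV (t, y))|%:E <= h)%E.
  have := line_dominated ord0 (cons_rV (t, y)) fC fb.
  by under eq_integral do rewrite upd_cons0.
have -> : (\int[lebesgue_measure]_t `|f (cons_rV (t, y))|%:E =
           \int[lebesgue_measure]_(t in I) `|f (cons_rV (t, y))|%:E)%E.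
  rewrite [RHS]integral_mkcond; apply: eq_integral => t _; rewrite patchE.
  case: ifPn => // tI; rewrite fl ?normr0// => /(_ ord0).
  rewrite cons_rVE unlift_none/= mxE subr0 => tl; move/negP: tI; apply; apply/mem_set.
  by rewrite /I/= in_itv/= -ler_norml (le_trans (ltW tl))// ler_norm.
apply: (@le_trans _ _ (\int[lebesgue_measure]_(t in I) cst h t)%E).
  apply: ge0_le_integral => //.
  apply: measurable_funTS.
  exact: measurableT_comp (mnorm cf) (@measurable_cons_l R n y).
rewrite integral_cst// muleC; apply: lee_wpmul2r => //.
have := lebesgue_measure_itv `[- `|l|, `|l|] => /= ->.
case: ifP => _; rewrite lee_fin; last by rewrite mulr_ge0.
by rewrite opprK mulr_natl mulr2n.
Qed.

End poincare_L1.

Lemma sup_bound_rV1 {R : realType} (f : 'rV[R]_1 -> R) x : C1 f -> bsupp f ->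
  (`|f x|%:E <= \int[product_lebesgue 1]_y `|dpartial ord0 f y|%:E)%E.
Proof.
move=> fC fb; rewrite (integral_rV1 x)//; first exact: line_dominated.
apply/measurable_EFinP; apply: measurableT_comp => //; apply: continuous_measurable_rV.
by have [_ /(_ ord0)[]] := fC.
Qed.

Lemma measurable_powR_comp d (T : measurableType d) (R : realType) (D : set T)
    (f : T -> R) p : measurable_fun D f -> measurable_fun D (fun x => (f x `^ p)%:E).
Proof.
by move=> mf; apply/measurable_EFinP; exact: (measurableT_comp (measurable_powR p) mf).
Qed.

(** * From the modular to integrals of powers *)
Section control.
Context {R : realType} {d : nat}.
Notation Rd := 'rV[R]_d.
Local Notation L := (lebesgueRn R d).
Local Notation leb := (@leb R d).
Local Notation mu := (@product_lebesgue R d).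
Variables (Omega : set Rd) (phi : Rd -> R -> R) (beta : R).
Hypothesis oO : open Omega.
Hypothesis bO : bounded_set Omega.
Hypothesis gphi : gen_Phi_function Omega phi.
Hypothesis beta01 : 0 < beta <= 1.
Hypothesis nphi : normalized Omega phi beta.

Let V : R := fine (leb (Omega : set L)).

Let mO : measurable (Omega : set L).
Proof. by apply: borel_lebesgue; exact: open_measurable_rV. Qed.

Lemma leb_Omega : leb (Omega : set L) = V%:E.
Proof. by rewrite fineK// ge0_fin_numE//; exact: bounded_leb_lty. Qed.

Let b0 : 0 < beta. Proof. by case/andP: beta01. Qed.

(** [Phi_lower] integrated: the q-th power integral of a function in the unit ball
    of the modular is bounded in terms of |Omega| only. *)
Lemma unit_ball_power_int (a : Rd -> R) (A : set Rd) (q : R) :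
  measurable A -> measurable_fun (Omega : set L) a -> (forall x, 0 <= a x) ->
  (modular Omega phi a <= 1)%E -> 0 <= q -> q <= p_minus Omega phi A ->
  (\int[leb]_(x in (Omega `&` A : set L)) ((beta * a x) `^ q)%:E <= (V + 1)%:E)%E.
Proof.
move=> mA ma a0 ma1 q0 qA.
have mAL : measurable (A : set L) by exact: borel_lebesgue.
have mOA : measurable (Omega `&` A : set L) by exact: measurableI.
have P0 x : Omega x -> (0 <= (Phi_of phi x `|a x|)%:E)%E.
  by move=> Ox; rewrite lee_fin; apply: (Phi_of_ge0 gphi).
apply: (@le_trans _ _ (\int[leb]_(x in (Omega `&` A : set L)) 1%:E +
   \int[leb]_(x in (Omega `&` A : set L)) (Phi_of phi x `|a x|)%:E)%E).
  apply: ge0_le_integral_nomeas => //.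
  - by move=> x _; rewrite lee_fin powR_ge0.
  - by move=> x [Ox _]; exact: P0.
  apply: (ae_leb_imply (normalized_ae b0 nphi)) => x Hx [Ox Ax].
  rewrite -EFinD lee_fin (ger0_norm (a0 x)).
  exact: (Phi_lower gphi b0 Ax (Hx Ox)).
rewrite EFinD; apply: leeD.
  by rewrite integral_cst// mul1e -leb_Omega le_measure ?inE.
by apply: le_trans ma1; apply: subset_integral_nomeas.
Qed.

Section family.
Variables (N : nat) (a : 'I_N -> Rd -> R) (G : Rd -> R).
Hypotheses (ma : forall j, measurable_fun (Omega : set L) (a j))
  (a0 : forall j x, 0 <= a j x) (am : forall j, (modular Omega phi (a j) <= 1)%E).
Hypotheses (cG : continuous G) (G0 : forall x, 0 <= G x) (GO : forall x, ~ Omega x -> G x = 0).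
Hypothesis Ga : {ae leb, forall x, Omega x -> exists j, G x <= a j x}.

(** The q-th power of G is at most the sum of those of the a j.  The constant is
    uniform in q because beta^-q <= beta^-D. *)
Lemma gradient_power_int (A : set Rd) (q D : R) : measurable A -> 1 <= q -> q <= D ->
  q <= p_minus Omega phi A ->
  (\int[mu]_x ((\1_A x * G x) `^ q)%:E <= (beta^-1 `^ D * (N%:R * (V + 1)))%:E)%E.
Proof.
move=> mA q1 qD qA.
have q0 : 0 < q by exact: lt_le_trans q1.
have mAL : measurable (A : set L) by exact: borel_lebesgue.
have mOA : measurable (Omega `&` A : set L) by exact: measurableI.
have mG : measurable_fun setT (fun x => (\1_A x * G x) `^ q : measurableTypeR R).
  apply: (@measurableT_comp _ _ _ _ _ _ (@powR R ^~ q)) => //.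
  by apply: measurable_funM; [exact: measurable_indic|exact: continuous_measurable_rV].
rewrite -integral_leb; [|exact/measurable_EFinP|by move=> x; rewrite lee_fin powR_ge0].
have -> : (\int[leb]_x ((\1_A x * G x) `^ q)%:E =
    \int[leb]_(x in (Omega `&` A : set L)) ((\1_A x * G x) `^ q)%:E)%E.
  rewrite [RHS]integral_mkcond; apply: eq_integral => x _; rewrite patchE.
  case: ifPn => // /negP xOA; rewrite (_ : _ * _ = 0) ?powR0 ?gt_eqF//.
  have [Ox|nOx] := pselect (Omega x); last by rewrite GO ?mulr0.
  rewrite indicE memNset ?mul0r// => Ax; apply: xOA; exact/mem_set.
pose c := (beta^-1) `^ q.
have c0 : 0 <= c by exact: powR_ge0.
have mb j : measurable_fun (Omega `&` A : set L) (fun x => ((beta * a j x) `^ q)%:E).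
  apply: measurable_powR_comp; apply: measurable_funM; first exact: measurable_cst.
  exact: (measurable_funS mO (@subIsetl _ _ _) (ma j)).
have c_j j : (0 <= c%:E * \int[leb]_(x in (Omega `&` A : set L)) ((beta * a j x) `^ q)%:E)%E.
  by rewrite mule_ge0 ?lee_fin// integral_ge0// => x _; rewrite lee_fin powR_ge0.
apply: (@le_trans _ _ (\int[leb]_(x in (Omega `&` A : set L))
   (c%:E * \sum_(j < N) ((beta * a j x) `^ q)%:E))%E).
  apply: (ae_ge0_le_integral mOA).
  - by move=> x _; rewrite lee_fin powR_ge0.
  - by apply: measurable_funTS; apply: measurable_borel_lebesgue; exact/measurable_EFinP.
  - move=> x _; rewrite mule_ge0 ?lee_fin// sume_ge0// => j _.
    by rewrite lee_fin powR_ge0.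
  - by apply: measurable_funeM; apply: emeasurable_sum.
  apply: (ae_leb_imply Ga) => x Hx [Ox Ax]; have [j Gj] := Hx Ox.
  rewrite indicE mem_set// mul1r sumEFin -EFinM lee_fin (bigD1 j)//=.
  apply: (@le_trans _ _ (c * (beta * a j x) `^ q)).
    rewrite /c -powRM ?invr_ge0 ?mulr_ge0 ?(ltW b0)// mulKf ?gt_eqF//.
    by apply: ge0_ler_powR; rewrite ?nnegrE// ltW.
  by rewrite ler_wpM2l// lerDl sumr_ge0// => k _; exact: powR_ge0.
rewrite ge0_integralZl_EFin; first last.
- exact: c0.
- exact: emeasurable_sum.
- by move=> x _; rewrite sume_ge0// => j _; rewrite lee_fin powR_ge0.
- exact: mOA.
rewrite ge0_integral_sum//; last by move=> j x _; rewrite lee_fin powR_ge0.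
rewrite EFinM; apply: lee_pmul.
- by rewrite lee_fin.
- by apply: sume_ge0 => j _; apply: integral_ge0 => x _; rewrite lee_fin powR_ge0.
- rewrite lee_fin; apply: ler_powR => //.
  by rewrite invf_ge1//; case/andP: beta01.
apply: (@le_trans _ _ (\sum_(j < N) (V + 1)%:E)%E).
  by apply: lee_sum => j _; apply: unit_ball_power_int => //; exact: ltW.
by rewrite sumEFin lee_fin sumr_const card_ord mulr_natl.
Qed.

End family.
End control.

(** * A finite covering and its exponents *)
Section covering.
Context {R : realType} {d : nat}.
Notation Rd := 'rV[R]_d.

(** One constant for all the finitely many cutoffs of the covering. *)
Lemma bump_grad_bound (s : seq Rd) (e : R) : 0 < e -> exists K : R, 0 <= K /\
  forall c, c \in s -> forall k x, `|dpartial k (bump c e) x| <= K.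
Proof.
move=> e0; elim: s => [|c s [K [K0 HK]]]; first by exists 0.
have tb : test_fun setT (bump c e).
  apply: (@elem_test_fun _ _ _ _ c e) => //; first exact: elem_bump.
  move=> x nx; apply/eqP; rewrite eq_le bump_ge0 andbT leNgt; apply/negP.
  by move=> /bump_gt0; exact: nx.
have /choice[M HM] : forall k, exists M : R, forall x, `|dpartial k (bump c e) x| <= M.
  by move=> k; apply: (@Cc_bounded _ _ setT); exact: test_dpartial_Cc.
exists (K + \sum_k `|M k|); split; first by rewrite addr_ge0// sumr_ge0.
move=> c'; rewrite inE => /predU1P[->|c's] k x.
  apply: (le_trans (HM k x)); apply: (le_trans (ler_norm _)).
  rewrite (bigD1 k)//= addrCA lerDl addr_ge0// sumr_ge0//.
by apply: (le_trans (HK c' c's k x)); rewrite lerDl sumr_ge0.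
Qed.

(** The centers are taken in Omega, as the jump condition speaks of balls centered
    in Omega; covering the closure of Omega makes compactness available. *)
Lemma finite_cube_cover (Omega : set Rd) (e : R) : bounded_set Omega -> 0 < e ->
  exists s : seq Rd, (forall c, c \in s -> Omega c) /\
    forall x, Omega x -> exists2 c, c \in s & cube c e x.
Proof.
move=> bO e0.
have cO : compact (closure Omega).
  have [l [l0 Ol]] := bounded_ccube bO.
  have clc : closed (ccube 0 l : set Rd).
    by apply: compact_closed; [exact: norm_hausdorff|exact: compact_ccube].
  apply: (@subclosed_compact _ _ (ccube 0 l)); [exact: closed_closure|exact: compact_ccube|].
  move/closure_id : clc => ->; apply: closure_subset => x /Ol xl i; exact/ltW/xl.
move: cO; rewrite compact_cover => /(_ Rd Omega (fun c => cube c e))[].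
- by move=> c _; rewrite -ball_cube//; exact: ball_open.
- move=> x /(_ (ball x e) (nbhsx_ballx _ _ e0))[y [Oy xy]].
  by exists y => //; rewrite -ball_cube//; exact: ball_sym.
move=> D DO cov; exists (finmap.enum_fset D); split => [c cD|x Ox]; first by have := DO c cD; rewrite inE.
have [c cD xc] := cov x (subset_closure Ox); by exists c.
Qed.

Lemma cube_eball (c : Rd) (e delta : R) : 0 < delta -> d%:R * e ^+ 2 < delta ^+ 2 ->
  cube c e `<=` eball c delta.
Proof.
move=> delta0 ed x xc; rewrite /eball/= /enorm.
rewrite -(ger0_norm (ltW delta0)) -sqrtr_sqr ltr_sqrt ?exprn_gt0//.
apply: le_lt_trans ed; rewrite mulr_natl -[X in _ *+ X](card_ord d) -sumr_const.
apply: ler_sum => i _; rewrite !mxE -[leLHS]real_normK ?num_real//.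
rewrite lerXn2r ?nnegrE//; first exact: le_trans (ltW (xc i)).
exact: ltW (xc i).
Qed.

Lemma sum_continuous (I : Type) (s : seq I) (F : I -> Rd -> R) :
  (forall i, continuous (F i)) -> continuous (fun x => \sum_(i <- s) F i x).
Proof.
move=> cF; elim: s => [|i s IH].
  under eq_fun do rewrite big_nil; move=> x; exact: (@cst_continuous Rd R 0 x).
under eq_fun do rewrite big_cons.
by move=> x; exact: (cvgD (cF i x) (IH x)).
Qed.

Definition gradsum (psi : Rd -> R) (x : Rd) : R := \sum_(k < d) `|dpartial k psi x|.

Lemma gradsum_test Omega psi : test_fun Omega psi ->
  [/\ continuous (gradsum psi), forall x, 0 <= gradsum psi x,
      forall x, ~ Omega x -> gradsum psi x = 0 &
      forall k x, `|dpartial k psi x| <= gradsum psi x].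
Proof.
move=> tp; split.
- apply: sum_continuous => k x.
  have [ck _] := test_dpartial_Cc k tp.
  apply: (@continuous_comp _ _ _ (dpartial k psi) (fun y => `|y|)); [exact: ck|exact: norm_continuous].
- by move=> x; apply: sumr_ge0.
- move=> x nx; rewrite /gradsum big1// => k _.
  by have [_ [K [_ KO ->]]] := test_dpartial_Cc k tp; rewrite ?normr0// => /KO.
- by move=> k x; rewrite /gradsum (bigD1 k)//= lerDl sumr_ge0.
Qed.

End covering.

Section conjugate_exponent.
Context {R : realType}.

(** The number q = (1/r + 1/D)^-1 is the exponent whose Sobolev conjugate is r.
    For r = pp it is at most pm by the jump condition (or because q <= D <= pm).
    The lower bound r0 on r, the conjugate of some q0 in ]1, 3/2] with
    q0 <= pminus, keeps q >= q0 > 1 and r > D / (D - 1). *)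
Lemma conjugate_exponent (D pm pp pminus q0 r0 r : R) : 2 <= D -> 1 < pminus -> pminus <= pm ->
  q0 = Num.min pminus (3 / 2) -> r0 = D * q0 / (D - q0) -> r = Num.max pp r0 ->
  D <= pm \/ (pm < D /\ pp <= D * pm / (D - pm)) ->
  [/\ D / (D - 1) < r, 1 <= (r^-1 + D^-1)^-1, (r^-1 + D^-1)^-1 <= D & (r^-1 + D^-1)^-1 <= pm].
Proof.
move=> D2 pm1 pmm q0E r0E rE J.
have q01 : 1 < q0 by rewrite q0E lt_min pm1/=; lra.
have q0D : q0 < D.
  have : q0 <= 3 / 2 by rewrite q0E ge_min lexx orbT.
  lra.
have q0m : q0 <= pm by apply: le_trans pmm; rewrite q0E ge_min lexx.
have D0 : 0 < D by lra.
have rD0 : D / (D - 1) < r0.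
  have H : D * (D - q0) < D * q0 * (D - 1).
    have : 0 < D * D * (q0 - 1) by rewrite !mulr_gt0 ?subr_gt0.
    by nra.
  by rewrite r0E ltr_pdivrMr ?subr_gt0; [rewrite mulrAC ltr_pdivlMr ?subr_gt0|lra].
have rr : r0 <= r by rewrite rE le_max lexx orbT.
have r00 : 0 < r0 by apply: lt_trans rD0; rewrite divr_gt0//; lra.
have r0' : 0 < r by exact: lt_le_trans rr.
have iq0 : 0 < r^-1 + D^-1 by rewrite addr_gt0 ?invr_gt0.
have iq01 : r0^-1 + D^-1 = q0^-1.
  by rewrite r0E; field; rewrite !gt_eqF//; lra.
split.
- exact: lt_le_trans rr.
- rewrite invf_ge1//; apply: (@le_trans _ _ (q0^-1)); last by rewrite invf_le1; lra.
  by rewrite -iq01 lerD2r lef_pV2.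
- rewrite -[leRHS]invrK lef_pV2 ?posrE ?invr_gt0//.
  by rewrite lerDr invr_ge0 ltW.
- case: J => [Dpm|[pmD ppD]].
    apply: le_trans Dpm; rewrite -[leRHS]invrK lef_pV2 ?posrE ?invr_gt0//.
    by rewrite lerDr invr_ge0 ltW.
  have pm0 : 0 < pm by lra.
  rewrite -[leRHS]invrK lef_pV2 ?posrE ?invr_gt0//.
  have [rpp|rr0] : r = pp \/ r = r0.
    by rewrite rE; case: (leP pp r0) => _; [right|left].
    rewrite rpp in r0' *.
    have : (D * pm / (D - pm))^-1 <= pp^-1 by rewrite lef_pV2 ?posrE//; exact: lt_le_trans ppD.
    have -> : (D * pm / (D - pm))^-1 = pm^-1 - D^-1.
      by field; rewrite !gt_eqF//; lra.
    lra.
  by rewrite rr0 iq01 lef_pV2 ?posrE//; lra.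
Qed.

End conjugate_exponent.

(** * An integrable majorant for test functions *)
Section majorant.
Context {R : realType} {d : nat}.
Notation Rd := 'rV[R]_d.
Local Notation L := (lebesgueRn R d).
Local Notation leb := (@leb R d).
Local Notation mu := (@product_lebesgue R d).
Variables (Omega : set Rd) (phi : Rd -> R -> R).

(** A form of the bound by the unit ball of the modular in which a sum of gradients
    is handled by listing the summands, without the triangle inequality for the
    Luxemburg norm. *)
Definition dominated_gradient (N : nat) (psi : Rd -> R) : Prop :=
  exists a : 'I_N -> Rd -> R,
    [/\ forall j, measurable_fun (Omega : set L) (a j), forall j x, 0 <= a j x,
        forall j, (modular Omega phi (a j) <= 1)%E &
        {ae leb, forall x, Omega x -> exists j, gradsum psi x <= a j x}].

(** The majorant is measurable, so it can be separated from an error term under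
    the integral ([ge0_le_integral_nomeas]). *)
Definition majorized (M : R) (psi : Rd -> R) : Prop :=
  exists H : Rd -> R,
    [/\ measurable_fun (Omega : set L) H, forall x, 0 <= H x,
        (\int[leb]_(x in (Omega : set L)) (H x)%:E <= M%:E)%E &
        {ae leb, forall x, Omega x -> Phi_of phi x `|psi x| <= H x}].

Hypothesis oO : open Omega.
Hypothesis bO : bounded_set Omega.

Let V : R := fine (leb (Omega : set L)).

Let mO : measurable (Omega : set L).
Proof. by apply: borel_lebesgue; exact: open_measurable_rV. Qed.

Lemma integral_affine_power (g : Rd -> R) (r W I : R) : continuous g -> 0 <= W ->
  (\int[mu]_x (`|g x| `^ r)%:E <= I%:E)%E ->
  (\int[leb]_(x in (Omega : set L)) (1 + W * `|g x| `^ r)%:E <= (V + W * I)%:E)%E.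
Proof.
move=> cg W0 gI.
have mg : measurable_fun setT (fun x => (`|g x| `^ r)%:E).
  apply: measurable_powR_comp; apply: measurableT_comp => //.
  exact: continuous_measurable_rV.
have mgL : measurable_fun (Omega : set L) (fun x => (`|g x| `^ r)%:E).
  by apply: measurable_funTS; exact: measurable_borel_lebesgue.
under eq_integral do rewrite EFinD EFinM.
have g0 x : (0 <= (`|g x| `^ r)%:E)%E by rewrite lee_fin powR_ge0.
rewrite ge0_integralD; first last.
- exact: measurable_funeM.
- by move=> x _; rewrite mule_ge0.
- exact: measurable_cst.
- by move=> x _; rewrite lee_fin.
- exact: mO.
rewrite EFinD; apply: leeD.
  by rewrite integral_cst// mul1e -(leb_Omega oO bO).
rewrite ge0_integralZl_EFin// EFinM; apply: lee_wpmul2l; first by rewrite lee_fin.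
apply: le_trans gI; rewrite -integral_leb//.
by apply: subset_integral_nomeas.
Qed.

Lemma p_plus_le_Omega (A : set Rd) : gen_Phi_function Omega phi -> A `&` Omega !=set0 ->
  p_plus Omega phi A <= p_plus Omega phi Omega.
Proof.
move=> gphi AO; rewrite (_ : p_plus Omega phi A = p_plus Omega phi (A `&` Omega)).
  by apply: (p_plus_mono gphi); [exact: subIsetr|rewrite -setIA setIid].
by rewrite /p_plus /growth_quotients -setIA setIid.
Qed.

Lemma p_minus_ge_Omega (A : set Rd) : gen_Phi_function Omega phi -> A `&` Omega !=set0 ->
  p_minus Omega phi Omega <= p_minus Omega phi A.
Proof.
move=> gphi AO; rewrite (_ : p_minus Omega phi A = p_minus Omega phi (A `&` Omega)).
  by apply: (p_minus_mono gphi); [exact: subIsetr|rewrite -setIA setIid].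
by rewrite /p_minus /growth_quotients -setIA setIid.
Qed.

End majorant.

Section gradient_L1.
Context {R : realType} {n : nat}.
Notation Rd := 'rV[R]_n.+1.
Local Notation L := (lebesgueRn R n.+1).
Local Notation leb := (@leb R n.+1).
Local Notation mu := (@product_lebesgue R n.+1).
Variables (Omega : set Rd) (phi : Rd -> R -> R) (beta : R).
Hypotheses (oO : open Omega) (bO : bounded_set Omega) (O0 : Omega !=set0).
Hypotheses (gphi : gen_Phi_function Omega phi) (nphi : normalized Omega phi beta).
Hypothesis beta01 : 0 < beta <= 1.
Variables (N : nat) (psi : Rd -> R).
Hypotheses (tpsi : test_fun Omega psi) (gpsi : dominated_gradient Omega phi N psi).

Let V : R := fine (leb (Omega : set L)).
Let A0 : R := beta^-1 `^ n.+1%:R * (N%:R * (V + 1)).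

(** The exponent 1 is at most p^- on the whole of Omega. *)
Lemma gradsum_L1 : (\int[mu]_x (gradsum psi x)%:E <= A0%:E)%E.
Proof.
have [a [ma a0 am aG]] := gpsi.
have [cG G0 GO _] := gradsum_test tpsi.
have := @gradient_power_int _ _ _ _ _ oO bO gphi beta01 nphi N a _ ma a0 am cG G0 GO aG setT 1 n.+1%:R
  (@measurableT _ _) (lexx 1).
rewrite ler1n => /(_ isT) H; apply: le_trans (H _); last first.
  by apply/ltW/(p_minus_gt1 gphi); rewrite setTI.
by apply: le_integralT_nomeas => x; rewrite lee_fin ?G0// indicT mul1r powRr1.
Qed.

Lemma test_L1 l : 0 < l -> Omega `<=` cube 0 l ->
  (\int[mu]_x `|psi x|%:E <= (2 * l * A0)%:E)%E.
Proof.
move=> l0 Ol; have [_ G0 _ dG] := gradsum_test tpsi.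
apply: (le_trans (poincare_L1 (test_C1 tpsi) (l := l) _)).
  move=> x nx; have [_ [K [_ KO ->]]] := test_Cc tpsi => //.
  by move=> /KO/Ol.
rewrite gtr0_norm// [leRHS]EFinM; apply: lee_wpmul2l; first by rewrite lee_fin mulr_ge0 ?ltW.
apply: le_trans gradsum_L1.
by apply: le_integralT_nomeas => x; rewrite lee_fin.
Qed.

End gradient_L1.

(** In dimension one psi is bounded by the L^1 norm of its derivative, so the
    majorant is a constant. *)
Lemma majorized_dim1 {R : realType} (Omega : set 'rV[R]_1) (pplus beta : R) (N : nat) :
  open Omega -> bounded_set Omega -> Omega !=set0 -> 0 < beta <= 1 ->
  exists M : R, 0 <= M /\ forall phi, gen_Phi_function Omega phi ->
    normalized Omega phi beta -> p_plus Omega phi Omega = pplus ->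
    forall psi, test_fun Omega psi -> dominated_gradient Omega phi N psi ->
    majorized Omega phi M psi.
Proof.
move=> oO bO O0 beta01; have b0 : 0 < beta by case/andP: beta01.
pose V : R := fine (leb (Omega : set (lebesgueRn R 1))).
have V0 : 0 <= V by exact: fine_ge0.
pose A0 : R := beta^-1 `^ 1 * (N%:R * (V + 1)).
pose P := Num.max pplus 0.
pose h := 1 + (A0 / beta) `^ P.
have h0 : 0 <= h by rewrite addr_ge0// powR_ge0.
exists (h * V); split; first exact: mulr_ge0.
move=> phi gphi nphi ppE psi tpsi dpsi.
have psiA x : `|psi x| <= A0.
  have := gradsum_L1 oO bO O0 gphi nphi beta01 tpsi dpsi; rewrite -/V -/A0.
  rewrite -lee_fin; apply: le_trans.
  apply: (le_trans (sup_bound_rV1 x (test_C1 tpsi) (test_fun_bsupp tpsi))).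
  by apply: le_integralT_nomeas => y; rewrite lee_fin// /gradsum big_ord1.
exists (fun=> h); split => //.
  rewrite integral_cst//; last by apply: borel_lebesgue; exact: open_measurable_rV.
  by rewrite EFinM -(leb_Omega oO bO).
apply: (ae_leb_imply (normalized_ae b0 nphi)) => x Hx Ox.
apply: (le_trans (Phi_upper gphi b0 Ox (Hx Ox) (normr_ge0 _) (r := P) _ _)).
- by rewrite le_max lexx orbT.
- by rewrite ppE le_max lexx.
rewrite lerD2l ge0_ler_powR ?nnegrE ?le_max ?lexx ?orbT//.
- by rewrite divr_ge0 ?(ltW b0).
- by rewrite divr_ge0 ?(ltW b0)//; apply: le_trans (psiA x).
- by rewrite ler_pM2r ?invr_gt0.
Qed.

(** Each x in Omega lies in the half cube around some center c, where the cutoff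
    eta_c is bounded below; there |psi| <= |eta_c^d psi| / kappa, and [Phi_upper]
    bounds Phi(x, |psi x|) by the summand of index c of the majorant, whose
    integral is bounded by [local_estimate]. *)
Lemma majorized_dim_ge2 {R : realType} (m : nat) (Omega : set 'rV[R]_m.+2)
    (delta pplus pminus beta : R) (N : nat) :
  open Omega -> bounded_set Omega -> Omega !=set0 -> 0 < delta -> 0 < beta <= 1 ->
  exists M : R, 0 <= M /\ forall phi, gen_Phi_function Omega phi ->
    normalized Omega phi beta -> jump_condition Omega phi delta ->
    p_plus Omega phi Omega = pplus -> p_minus Omega phi Omega = pminus ->
    forall psi, test_fun Omega psi -> dominated_gradient Omega phi N psi ->
    majorized Omega phi M psi.
Proof.
move=> oO bO O0 delta0 beta01; have b0 : 0 < beta by case/andP: beta01.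
pose D : R := m.+2%:R.
have D2 : 2 <= D by rewrite ler_nat.
have D0 : 0 < D by rewrite ltr0n.
(* small enough for the cube of half-side rho to lie in the Euclidean ball of radius delta *)
pose rho := delta / (2 * D).
have rho0 : 0 < rho by rewrite divr_gt0// mulr_gt0.
have rho20 : 0 < rho / 2 by rewrite divr_gt0.
have rhod : m.+2%:R * rho ^+ 2 < delta ^+ 2.
  rewrite -/D /rho expr_div_n mulrCA gtr_pMr ?exprn_gt0// ltr_pdivrMr ?exprn_gt0 ?mulr_gt0//.
  by rewrite mul1r expr2; clearbody D; nra.
have [l [l0 Ol]] := bounded_ccube bO.
have [s [sO sc]] := finite_cube_cover bO rho20.
have [K [K0 HK]] := bump_grad_bound s rho0.
pose V : R := fine (leb (Omega : set (lebesgueRn R m.+2))).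
have V0 : 0 <= V by exact: fine_ge0.
pose A0 : R := beta^-1 `^ D * (N%:R * (V + 1)).
have A00 : 0 <= A0 by rewrite mulr_ge0 ?powR_ge0// mulr_ge0// addr_ge0.
pose A2 := 1 + 2 * l * A0.
have A21 : 1 <= A2 by rewrite lerDl mulr_ge0// mulr_ge0// ltW.
pose q0 := Num.min pminus (3 / 2); pose r0 := D * q0 / (D - q0).
pose P := Num.max pplus r0.
pose Mloc := (P * ((1 + A0) + D * K * A2)) `^ (D * P).
(* lower bound of eta_c^d on the half cube, where eta_c is a product of 2 d flat functions *)
pose kappa : R := (flat 1 (rho / 2)) ^+ (m.+2 + m.+2) ^+ m.+2.
have k0 : 0 < kappa by rewrite !exprn_gt0// flat1_gt0.
(* the base is at least 1, so W bounds its powers for all the exponents r c <= P *)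
pose W := (kappa^-1 / beta) `^ P.
have W0 : 0 <= W by exact: powR_ge0.
exists ((size s)%:R * (V + W * Mloc)); split.
  by rewrite mulr_ge0// addr_ge0// mulr_ge0// powR_ge0.
move=> phi gphi nphi jphi ppE pmE psi tpsi dpsi.
have pm1 : 1 < pminus.
  by rewrite -pmE; apply: (p_minus_gt1 gphi); rewrite setIid.
pose r c := Num.max (p_plus Omega phi (eball c delta)) r0.
have Bc := fun c => @cube_eball R _ c rho delta delta0 rhod.
have cc (c : 'rV[R]_m.+2) (e : R) : 0 < e -> cube c e c.
  by move=> e0 i; rewrite subrr normr0.
have rP c : c \in s -> r c <= P.
  move=> cs; rewrite /r /P ge_max !le_max lexx orbT andbT -ppE p_plus_le_Omega//.
  by exists c; split; [exact/Bc/cc|exact: sO].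
have ex c : c \in s -> [/\ D / (D - 1) < r c, 1 <= ((r c)^-1 + D^-1)^-1,
    ((r c)^-1 + D^-1)^-1 <= D &
    ((r c)^-1 + D^-1)^-1 <= p_minus Omega phi (eball c delta)].
  move=> cs; apply: (@conjugate_exponent _ D (p_minus Omega phi (eball c delta))
    (p_plus Omega phi (eball c delta)) pminus q0 r0) => //.
    rewrite -pmE p_minus_ge_Omega//.
    by exists c; split; [exact/Bc/cc|exact: sO].
  exact: jphi (sO c cs).
have r0' c : c \in s -> 0 <= r c.
  move=> /ex[/ltW H _ _ _]; apply: le_trans H.
  by rewrite divr_ge0 ?(ltW D0)// subr_ge0; lra.
pose f c x := bump c rho x ^+ m.+2 * psi x.
have psiC := test_C1 tpsi.
have cf c : continuous (f c).
  have cb : continuous (fun x => bump c rho x ^+ m.+2).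
    by have [] := elem_calculus (elemX m.+2 (elem_bump c rho)).
  have [cpsi _] := psiC.
  by move=> x; exact: (cvgM (cb x) (cpsi x)).
have If c : c \in s -> (\int[product_lebesgue m.+2]_x (`|f c x| `^ r c)%:E <= Mloc%:E)%E.
  move=> cs; have [rD q1 qD qm] := ex c cs.
  have [a [ma a0 am aG]] := dpsi.
  have [cG G0 GO dG] := gradsum_test tpsi.
  apply: (@local_estimate R m psi (bump c rho) (gradsum psi) (cube c rho) K (r c) P) => //.
  - exact: test_fun_bsupp tpsi.
  - exact/smooth_C1/elem_smooth/elem_bump.
  - by move=> x; rewrite bump_ge0 bump_le1.
  - exact: HK.
  - exact: measurable_cube.
  - move=> x nx; apply/eqP; rewrite eq_le bump_ge0 andbT leNgt; apply/negP.
    by move=> /bump_gt0.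
  - exact: rP.
  - by rewrite lerDl.
  - apply: (@le_trans _ _ A0%:E); last by rewrite lee_fin lerDr.
    apply: (gradient_power_int oO bO gphi beta01 nphi ma a0 am cG G0 GO aG) => //.
      exact: measurable_cube.
    apply: (le_trans qm); apply: (p_minus_mono gphi (Bc c)).
    by exists c; split; [exact: cc|exact: sO].
  - apply: (@le_trans _ _ (2 * l * A0)%:E); last by rewrite lee_fin lerDr.
    exact: (test_L1 oO bO O0 gphi nphi beta01 tpsi dpsi l0 Ol).
pose h c x := 1 + W * `|f c x| `^ r c.
have h0 c x : 0 <= h c x by rewrite addr_ge0// mulr_ge0// powR_ge0.
have mh c : measurable_fun (Omega : set (lebesgueRn R m.+2)) (h c).
  apply/measurable_funTS/measurable_borel_lebesgue; apply: measurable_funD => //.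
  apply: measurable_funM => //; apply/measurable_EFinP; apply: measurable_powR_comp.
  by apply: measurableT_comp => //; exact: continuous_measurable_rV.
exists (fun x => \sum_(c <- s) h c x); split.
- exact: measurable_sum.
- by move=> x; apply: sumr_ge0.
- under eq_integral do rewrite -sumEFin.
  rewrite ge0_integral_sum; first last.
  + by move=> c x _; rewrite lee_fin.
  + by move=> c; exact/measurable_EFinP.
  + by apply: borel_lebesgue; exact: open_measurable_rV.
  apply: (@le_trans _ _ (\sum_(c <- s) (V + W * Mloc)%:E)%E).
    rewrite !big_seq; apply: lee_sum => c cs.
    by apply: integral_affine_power => //; exact: If.
  by rewrite sumEFin lee_fin big_const_seq count_predT iter_addr addr0 mulr_natl.
apply: (ae_leb_imply (normalized_ae b0 nphi)) => x Hx Ox.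
have [c cs xc] := sc x Ox.
have xB : eball c delta x.
  apply: Bc => i; apply: lt_trans (xc i) _; lra.
apply: (@le_trans _ _ (h c x)); last first.
  by rewrite (big_rem c)//= lerDl sumr_ge0.
apply: (le_trans (Phi_upper gphi b0 xB (Hx Ox) (normr_ge0 _) (r0' c cs) _)).
  by rewrite le_max lexx.
rewrite lerD2l.
have kb : 1 <= kappa^-1 / beta.
  have /andP[_ b1] := beta01.
  have k1 : kappa <= 1.
    by rewrite !exprn_ile1// ?exprn_ge0// ?flat1_ge0// flat1_le1.
  have kb0 : 0 < kappa * beta by exact: mulr_gt0.
  rewrite -invfM (invf_ge1 kb0).
  by apply: mulr_ile1 => //; exact: ltW.
apply: (@le_trans _ _ ((kappa^-1 / beta) `^ r c * `|f c x| `^ r c)); last first.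
  by rewrite ler_wpM2r ?powR_ge0// ler_powR// rP.
rewrite -powRM//; last exact: le_trans kb.
apply: ge0_ler_powR; rewrite ?nnegrE ?r0'//.
- by rewrite divr_ge0// ltW.
- by rewrite mulr_ge0//; exact: le_trans kb.
rewrite mulrAC ler_pM2r ?invr_gt0// ler_pdivlMl//.
rewrite normrM; apply: ler_wpM2r => //.
apply: le_trans (ler_norm _).
by rewrite lerXn2r ?nnegrE ?bump_ge0 ?exprn_ge0 ?flat1_ge0// bump_half.
Qed.

Lemma test_majorized {R : realType} (d : nat) (Omega : set 'rV[R]_d)
    (delta pplus pminus beta : R) (N : nat) : (0 < d)%N ->
  open Omega -> bounded_set Omega -> Omega !=set0 -> 0 < delta -> 0 < beta <= 1 ->
  exists M : R, 0 <= M /\ forall phi, gen_Phi_function Omega phi ->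
    normalized Omega phi beta -> jump_condition Omega phi delta ->
    p_plus Omega phi Omega = pplus -> p_minus Omega phi Omega = pminus ->
    forall psi, test_fun Omega psi -> dominated_gradient Omega phi N psi ->
    majorized Omega phi M psi.
Proof.
case: d Omega => [//|[|m]] Omega _ oO bO O0 delta0 beta01; last exact: majorized_dim_ge2.
have [M [M0 HM]] := majorized_dim1 pplus N oO bO O0 beta01.
exists M; split => // phi gphi nphi _ ppE _; exact: HM.
Qed.

(** * Approximation by test functions *)
Section approximation.
Context {R : realType} {d : nat}.
Notation Rd := 'rV[R]_d.
Local Notation L := (lebesgueRn R d).
Local Notation leb := (@leb R d).
Variable (Omega : set Rd).
Hypothesis oO : open Omega.

Let mO : measurable (Omega : set L).
Proof. by apply: borel_lebesgue; exact: open_measurable_rV. Qed.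

Lemma L1loc_measurable v : L1loc Omega v -> measurable_fun (Omega : set L) v.
Proof.
move=> lv; have [D [c [e [_ eO OE]]]] := open_bigcup_cube oO.
rewrite OE bigcup_mkcond; apply/measurable_fun_bigcup => [k|k].
  case: ifPn => _ //; apply: borel_lebesgue; exact: measurable_cube.
case: ifPn => [/set_mem Dk|_]; last exact: measurable_fun_set0.
have : measurable_fun (ccube (c k) (e k) : set L) v.
  apply/measurable_EFinP.
  by have /integrableP[] := lv _ (@compact_ccube _ _ (c k) (e k)) (eO k Dk).
apply: measurable_funS; first by apply: borel_lebesgue; exact: measurable_ccube.
by move=> x xk i; exact/ltW/xk.
Qed.

Lemma smoothZ psi (a : R) : smooth psi -> smooth (fun x : Rd => a * psi x) /\
  forall k, dpartial k (fun x => a * psi x) = (fun x => a * dpartial k psi x).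
Proof.
move=> spsi.
have dZ (f : Rd -> R) k : (forall x, derivable f x (delta_mx ord0 k : Rd)) ->
    (forall x, derivable (fun x => a * f x) x (delta_mx ord0 k : Rd)) /\
    dpartial k (fun x => a * f x) = (fun x => a * dpartial k f x).
  move=> df; split=> [x|]; first exact: (derivableZ (df x)).
  by apply/funext => x; exact: (deriveZ a (df x)).
have IH s : foldr dpartial (fun x => a * psi x) s = (fun x => a * foldr dpartial psi s x).
  elim: s => //= k s ->; have [_ ds] := spsi s.
  by have [_ ->] := dZ _ k (ds k).
split=> [s|k].
  rewrite IH; have [cs ds] := spsi s; split=> [x|k].
    exact: (cvgM (@cst_continuous Rd R a x) (cs x)).
  by have [] := dZ _ k (ds k).
by have [_ ds] := spsi [::]; have [] := dZ _ k (ds k).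
Qed.

Lemma test_funZ psi (a : R) : test_fun Omega psi -> test_fun Omega (fun x => a * psi x).
Proof.
move=> [sp cp pO].
have H : closure [set x | a * psi x != 0] `<=` closure [set x | psi x != 0].
  by apply: closure_subset => x /=; rewrite mulf_eq0 negb_or => /andP[].
split; first by have [] := smoothZ a sp.
- by apply: (subclosed_compact _ cp H); exact: closed_closure.
- exact: subset_trans pO.
Qed.

Lemma gradsumZ (psi : Rd -> R) (a : R) x : smooth psi ->
  gradsum (fun y : Rd => a * psi y) x = `|a| * gradsum psi x.
Proof.
move=> sp; have [_ H] := smoothZ a sp; rewrite /gradsum mulr_sumr.
by apply: eq_bigr => k _; rewrite H normrM.
Qed.

Lemma enorm_ge_coord (y : Rd) k : `|y ord0 k| <= enorm y.
Proof.
rewrite -sqrtr_sqr /enorm ler_sqrt ?sumr_ge0// => [|i _]; last exact: sqr_ge0.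
by rewrite (bigD1 k)//= lerDl sumr_ge0// => i _; exact: sqr_ge0.
Qed.

Lemma measurable_enorm (v : Rd -> Rd) :
  (forall k, measurable_fun (Omega : set L) (fun x => v x ord0 k)) ->
  measurable_fun (Omega : set L) (fun x => enorm (v x)).
Proof.
move=> mv; apply: (@measurableT_comp _ _ _ _ _ _ (@Num.sqrt R)).
  by apply: continuous_measurable_fun; exact: sqrt_continuous.
by apply: measurable_sum => k; exact: measurable_funX.
Qed.

Lemma ae_ord (P : 'I_d -> Rd -> Prop) : (forall k, {ae leb, forall x, P k x}) ->
  {ae leb, forall x, forall k, P k x}.
Proof.
move=> H.
have := @ae_foralln _ _ _ leb (fun n x => forall h : (n < d)%N, P (Ordinal h) x).
move=> K; apply: (ae_leb_imply (K _)) => [n|x Hx [k kd]]; last exact: Hx.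
have [h|h] := pselect (is_true (n < d)%N); last by apply: aeW.
by apply: (ae_leb_imply (H (Ordinal h))) => x Px h'; rewrite (bool_irrelevance h' h).
Qed.

(** Up to the factor 1 / (2 d lam), the sum of the |d_k psi| is an average of 2 d
    numbers among |grad u| / lam and the |d_k (u - psi)| / l, since l <= lam; so
    it is at most one of them.  Index 0 stands for grad u, index k + 1 for
    d_k (u - psi). *)
Lemma approx_dominated phi u psi (lam l : R) : (0 < d)%N ->
  (forall k, exists v, is_weak_partial Omega k u v) -> test_fun Omega psi ->
  0 < l -> l <= lam ->
  (modular Omega phi (fun x => enorm (weak_grad Omega u x) / lam)%R <= 1)%E ->
  (forall k, modular Omega phi
     (fun x => weak_partial Omega k (fun x => u x - psi x) x / l)%R <= 1)%E ->
  dominated_gradient Omega phi d.+1 (fun x => (2 * d%:R * lam)^-1 * psi x).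
Proof.
move=> d0 wu tpsi l0 llam mu1 mk1.
have lam0 : 0 < lam by exact: lt_le_trans llam.
pose w k := weak_partial Omega k (fun x => u x - psi x).
pose a (j : 'I_d.+1) x := oapp (fun k => `|w k x| / l)
  (enorm (weak_grad Omega u x) / lam) (unlift ord0 j).
have a0 j x : 0 <= a j x.
  rewrite /a; case: (unlift ord0 j) => [k|] /=; rewrite divr_ge0 ?(ltW l0) ?(ltW lam0)//.
  exact: sqrtr_ge0.
exists a; split; [|exact: a0| |].
- move=> j; rewrite /a; case: (unlift ord0 j) => [k|] /=.
    apply: measurable_funM; last exact: measurable_cst.
    apply: measurableT_comp; first exact: normr_measurable.
    apply: L1loc_measurable.
    have [v uv] := wu k.
    by have [_ + _] := weak_partialP (is_weak_partialB oO uv (is_weak_partial_test oO k tpsi)).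
  apply: measurable_funM; last exact: measurable_cst.
  apply: measurable_enorm => k.
  under eq_fun do rewrite mxE; apply: L1loc_measurable.
  by have [v /weak_partialP[]] := wu k.
- move=> j; rewrite /a; case: (unlift ord0 j) => [k|] /=; last exact: mu1.
  rewrite (_ : modular _ _ _ = modular Omega phi (fun x => w k x / l)); first exact: mk1.
  by apply: eq_integral => x _; rewrite !normrM normr_id.
have H k : {ae leb, forall x, Omega x -> dpartial k psi x =
    weak_partial Omega k u x - w k x}.
  by have [v uv] := wu k; exact: (dpartial_weak_partial oO uv tpsi).
apply: (ae_leb_imply (ae_ord H)) => x Hx Ox.
have [sp _ _] := tpsi; rewrite gradsumZ//.
set C := 2 * d%:R * lam; have C0 : 0 < C by rewrite !mulr_gt0// ltr0n.
apply: contrapT => Ha; set g := _ * _ in Ha.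
have ag j : a j x < g by rewrite ltNge; apply/negP => ?; apply: Ha; exists j.
have wg k : `|w k x| < lam * g.
  have := ag (lift ord0 k); rewrite /a liftK/= ltr_pdivrMr// => /lt_le_trans; apply.
  rewrite mulrC ler_wpM2r// (le_trans (a0 ord0 x))//; exact/ltW.
have ug k : `|weak_partial Omega k u x| < lam * g.
  have := ag ord0; rewrite /a unlift_none/= ltr_pdivrMr// mulrC; apply: le_lt_trans.
  by have := enorm_ge_coord (weak_grad Omega u x) k; rewrite mxE.
suff : gradsum psi x < C * g.
  by rewrite /g gtr0_norm ?invr_gt0// mulrA divff ?gt_eqF// mul1r ltxx.
have -> : C * g = \sum_(k < d) (lam * g + lam * g).
  by rewrite sumr_const card_ord -mulr_natl /C; ring.
apply: ltr_sum => [|k _]; first by apply/hasP; exists (Ordinal d0); rewrite ?mem_index_enum.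
by rewrite Hx//; apply: (le_lt_trans (ler_normB _ _)); exact: ltrD.
Qed.

End approximation.

Section modular.
Context {R : realType} {d : nat}.
Notation Rd := 'rV[R]_d.
Local Notation L := (lebesgueRn R d).
Local Notation leb := (@leb R d).
Variables (Omega : set Rd) (phi : Rd -> R -> R).
Hypothesis oO : open Omega.
Hypothesis gphi : gen_Phi_function Omega phi.

Let mO : measurable (Omega : set L).
Proof. by apply: borel_lebesgue; exact: open_measurable_rV. Qed.

Lemma modular_ge0 u : (0 <= modular Omega phi u)%E.
Proof. by apply: integral_ge0 => x Ox; rewrite lee_fin (Phi_of_ge0 gphi). Qed.

(** A mean is at most the maximum, and Phi(x, .) is nondecreasing. *)
Lemma Phi_of_le_add x (s a b : R) : Omega x -> 0 <= s -> 0 <= a -> 0 <= b ->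
  s <= (a + b) / 2 -> Phi_of phi x s <= Phi_of phi x a + Phi_of phi x b.
Proof.
move=> Ox s0 a0 b0 sab; have [ab|ba] := leP a b.
  apply: (@le_trans _ _ (Phi_of phi x b)); last by rewrite lerDr (Phi_of_ge0 gphi).
  by apply: (Phi_of_homo gphi) => //; lra.
apply: (@le_trans _ _ (Phi_of phi x a)); last by rewrite lerDl (Phi_of_ge0 gphi).
by apply: (Phi_of_homo gphi) => //; lra.
Qed.

(** A test function psi is chosen at distance less than lam from u.  As
    u = psi + (u - psi), Phi(x, |u|) at the scale 4 d (M + 1) lam is at most
    1 / (M + 1) times the majorant for psi / (2 d lam) plus Phi(x, |u - psi| / l);
    the integrals of these two are at most M and 1. *)
Lemma poincare_modular (M : R) (u : Rd -> R) (lam : R) : (0 < d)%N -> 0 <= M ->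
  (forall psi, test_fun Omega psi -> dominated_gradient Omega phi d.+1 psi ->
    majorized Omega phi M psi) ->
  W01Phi Omega phi u -> 0 < lam ->
  (modular Omega phi (fun x => enorm (weak_grad Omega u x) / lam)%R <= 1)%E ->
  (modular Omega phi (fun x => u x / (4 * d%:R * (M + 1) * lam))%R <= 1)%E.
Proof.
move=> d0 M0 HM [[_ wu] /(_ lam) uapp] lam0 mu1.
have [psi [tpsi _ /ereal_inf_lt[_ [l [l0 ml1] <-]]]] := uapp lam0.
rewrite lte_fin => llam.
have wu' k : exists v, is_weak_partial Omega k u v by have [v uv _] := wu k; exists v.
have mk1 k : (modular Omega phi
    (fun x => weak_partial Omega k (fun x => u x - psi x) x / l)%R <= 1)%E.
  apply: le_trans ml1; rewrite (bigD1 k)//= addeCA leeDl// adde_ge0 ?modular_ge0//.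
  by apply: sume_ge0 => *; exact: modular_ge0.
have m01 : (modular Omega phi (fun x => (u x - psi x) / l)%R <= 1)%E.
  apply: le_trans ml1; rewrite leeDl//.
  by apply: sume_ge0 => *; exact: modular_ge0.
have [H [mH H0 HI HP]] := HM _ (test_funZ (2 * d%:R * lam)^-1 tpsi)
  (approx_dominated oO d0 wu' tpsi l0 (ltW llam) mu1 mk1).
pose C := 2 * d%:R * lam; pose N := M + 1.
have N1 : 1 <= N by rewrite lerDr.
have N0 : 0 < N by exact: lt_le_trans N1.
have d1 : 1 <= d%:R :> R by rewrite ler1n.
have lC : l <= C.
  by apply: (le_trans (ltW llam)); rewrite ler_peMl ?(ltW lam0)//; lra.
have C0 : 0 < C by exact: lt_le_trans lC.
have CN0 : 0 < 2 * C * N by exact: mulr_gt0 (mulr_gt0 _ C0) N0.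
pose k x := (Phi_of phi x `|(u x - psi x) / l|)%:E.
have k0 x : Omega x -> (0 <= k x)%E by move=> Ox; rewrite lee_fin (Phi_of_ge0 gphi).
have iN0 : 0 < N^-1 by rewrite invr_gt0.
apply: (@le_trans _ _ (\int[leb]_(x in (Omega : set L)) (N^-1%:E * (H x)%:E) +
    \int[leb]_(x in (Omega : set L)) (N^-1%:E * k x))%E).
  apply: ge0_le_integral_nomeas.
  - exact: mO.
  - by move=> x Ox; rewrite lee_fin (Phi_of_ge0 gphi).
  - by move=> x Ox; rewrite mule_ge0 ?lee_fin// ltW.
  - by move=> x Ox; rewrite mule_ge0 ?k0// lee_fin ltW.
  - by apply: measurable_funeM; exact/measurable_EFinP.
  apply: (ae_leb_imply HP) => x Hx Ox.
  rewrite /k -!EFinM -EFinD lee_fin.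
  apply: (@le_trans _ _ (Phi_of phi x (`|C^-1 * psi x| / N) +
      Phi_of phi x (`|(u x - psi x) / l| / N))).
    apply: Phi_of_le_add => //; try by rewrite divr_ge0// ltW.
    have -> : u x / (4 * d%:R * N * lam) = (psi x + (u x - psi x)) / (2 * C * N).
      by rewrite /C; congr (_ / _); ring.
    rewrite !normrM (gtr0_norm (x := (2 * C * N)^-1)) ?invr_gt0//.
    rewrite (gtr0_norm (x := C^-1)) ?invr_gt0// (gtr0_norm (x := l^-1)) ?invr_gt0//.
    have -> : (C^-1 * `|psi x| / N + `|u x - psi x| / l / N) / 2 =
        (`|psi x| + `|u x - psi x| * (C / l)) / (2 * C * N).
      by field; rewrite !gt_eqF.
    rewrite ler_pM2r ?invr_gt0//.
    apply: (le_trans (ler_normD _ _)).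
    by rewrite lerD2l ler_peMr// ler_pdivlMr// mul1r.
  rewrite ![N^-1 * _]mulrC; apply: lerD.
    apply: (le_trans (Phi_of_div gphi Ox (normr_ge0 _) N1)).
    by rewrite ler_pM2r//; exact: Hx.
  exact: (Phi_of_div gphi Ox (normr_ge0 _) N1).
have -> : (1%E = N^-1%:E * M%:E + N^-1%:E * 1)%E.
  by rewrite mule1 -EFinM -EFinD -[X in _ + X]mulr1 -mulrDr mulVf// gt_eqF.
apply: leeD.
  rewrite ge0_integralZl_EFin; first last.
  - exact: ltW.
  - exact/measurable_EFinP.
  - by move=> x _; rewrite lee_fin.
  - exact: mO.
  by apply: lee_wpmul2l => //; rewrite lee_fin ltW.
apply: (le_trans (@integral_scale_nomeas _ L R leb Omega k _ iN0 k0)).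
by apply: lee_wpmul2l => //; rewrite lee_fin ltW.
Qed.

End modular.

Theorem theorem17 (R : realType) (d : nat) (hd : (0 < d)%N)
    (Omega : set 'rV[R]_d)
    (Omega_nonempty : Omega !=set0) (Omega_open : open Omega)
    (Omega_connected : connected Omega) (Omega_bounded : bounded_set Omega)
    (delta : R) (delta_gt0 : 0 < delta) (pplus pminus beta : R)
    (beta_gt0 : 0 < beta) (beta_le1 : beta <= 1) :
  exists c : R, forall phi : 'rV[R]_d -> R -> R,
    gen_Phi_function Omega phi ->
    normalized Omega phi beta ->
    jump_condition Omega phi delta ->
    p_plus Omega phi Omega = pplus ->
    p_minus Omega phi Omega = pminus ->
    forall u : 'rV[R]_d -> R, W01Phi Omega phi u ->
      (LPhi_norm Omega phi u <=
       c%:E * LPhi_norm Omega phi (fun x => enorm (weak_grad Omega u x)))%E.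
Proof.
have beta01 : 0 < beta <= 1 by rewrite beta_gt0.
have [M [M0 HM]] := test_majorized pplus pminus d.+1 hd Omega_open Omega_bounded
  Omega_nonempty delta_gt0 beta01.
pose c : R := 4 * d%:R * (M + 1).
have c0 : 0 < c by rewrite !mulr_gt0 ?ltr0n// ltr_wpDl.
exists c => phi gphi nphi jphi ppE pmE u uW.
rewrite -lee_pdivrMl; last exact: c0.
apply: le_ereal_inf_tmp => _ [lam [lam0 mlam] <-].
rewrite lee_pdivrMl; last exact: c0.
rewrite -EFinM; apply: ereal_inf_lbound; exists (c * lam); last exact: erefl.
split; first exact: mulr_gt0.
exact: (poincare_modular Omega_open gphi hd M0 (HM phi gphi nphi jphi ppE pmE) uW lam0 mlam).
Qed.
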